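(* Suppose that the coefficient assumption, the initial-condition assumption and the mRPC stability assumption (all stated in the context) hold. Then there is a constant $\delta>0$, depending only on $K$, $T$ and $\delta_0$, such that the following holds when the truncation level is chosen as $R=\delta^{-1/2}(-2\log h)^{1/2}$, with $L=\lfloor\lambda_1R^\eta\rfloor$, $S=\lfloor\lambda_2R^\eta\rfloor$ and $J=2L+S$. For every $N\ge 0$ there exist constants $C_N>0$ and $h_N>0$, depending only on $N,K,T,d,C_{b,\sigma},\lambda_1,\lambda_2$ and $\delta_0$, such that for all $h\in(0,h_N)$, $$\sup_{0\le k\le n} d\left(\{m^{R,S}_{k,\gamma}\}_{|\gamma|\le J},\{m^{\mathrm{RPC}}_{k,\gamma}\}_{|\gamma|\le J}\right)\le C_N(-\log h)^{-N},$$ where $m^{R,S}_{k,\gamma}=\mathbb E[(v^{R,S}_k)^\gamma]$ are the moments of the solution $v^{R,S}_k$ of the projected scheme, $m^{\mathrm{RPC}}_{k,\gamma}$ are the moments computed by the mRPC algorithm, and $d(\{m_{1,\gamma}\}_{|\gamma|\le J},\{m_{2,\gamma}\}_{|\gamma|\le J})=\sum_{|\gamma|\le J}\frac{|m_{1,\gamma}-m_{2,\gamma}|}{|\gamma|!}$.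
   Context: Notation. $\mathbb N=\{0,1,2,\dots\}$; for a multi-index $\gamma\in\mathbb N^d$, $|\gamma|=\sum_i\gamma_i$ and $x^\gamma=\prod_i x_i^{\gamma_i}$; $e_i$ is the $i$-th unit multi-index; $|\cdot|$ is the Euclidean norm on vectors and $|A|=\sqrt{\mathrm{tr}(AA^T)}$ for matrices; $I_R=[-R,R]^d$. Euler-type scheme. Fix $T>0$ and $d,m\ge1$. A step size is $h=T/n$ with $n\in\mathbb N$, $n\ge 1$, $t_k=kh$. For each $h$ let $b_h:\mathbb R^d\to\mathbb R^d$ and $\sigma_h:\mathbb R^d\to\mathbb R^{d\times m}$ be given (numerical drift and diffusion for an SDE $du=b(u)dt+\sigma(u)dW$, $u(0)=u_0$). Let $z_0,z_1,\dots$ be i.i.d. standard Gaussian vectors in $\mathbb R^m$, independent of $u_0$. The Euler-type scheme is $v_{k+1}=v_k+b_h(v_k)h+\sigma_h(v_k)z_k\sqrt h$, $v_0=u_0$, $0\le k\le n-1$. Truncation. $\chi_R:\mathbb R^d\to I_R$ acts coordinatewise, $\chi_R(x)=(\chi(x_1),\dots,\chi(x_d))$, where $\chi:\mathbb R\to\mathbb R$ is a fixed smooth, odd, $1$-Lipschitz function with $\chi(s)=s$ for $|s|\le R/3$ and $\chi(s)=0$ for $|s|\ge R$. In particular $|\chi_R(x)-\chi_R(y)|\le|x-y|$. Coefficient assumption. (i) There is $K>0$ (independent of $h$) such that for all $x,y\in\mathbb R^d$: $|b_h(x)|\le K(|x|+1)$, $\sup_x|\sigma_h(x)|<K$, $|b_h(x)-b_h(y)|\le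 K|x-y|$, $|\sigma_h(x)-\sigma_h(y)|\le K|x-y|$. (ii) There are $r>0$ and $C>0$ such that for every $R>0$ and every integer $S\ge0$ there are polynomial maps $p_b^{R,S}$ ($\mathbb R^d$-valued) and $p_\sigma^{R,S}$ ($\mathbb R^{d\times m}$-valued) with $\max\{\deg p_b^{R,S},2\deg p_\sigma^{R,S}\}\le S$ and $\max\{\sup_{x\in I_R}|b_h(x)-p_b^{R,S}(x)|,\ \sup_{x\in I_R}|\sigma_h(x)-p_\sigma^{R,S}(x)|\}\le CR^rS^{-r}$ (with $S^{-r}=+\infty$ for $S=0$). Write $p_b^{R,S}(x)=\sum_{|\alpha|\le S}b_\alpha x^\alpha$ and $p_\sigma^{R,S}(x)p_\sigma^{R,S}(x)^T=\sum_{|\alpha|\le S}\sigma_\alpha x^\alpha$. (iii) There are constants $R^*>0$, $\lambda_1\ge\lambda_2>0$, $\eta\in(1,2)$ and $C_{b,\sigma}>0$, independent of $R$, such that for each $R>R^*$, with $L=\lfloor\lambda_1R^\eta\rfloor$, $S=\lfloor\lambda_2R^\eta\rfloor$, $M_{R,b}=\sum_{|\alpha|\le S}|b_\alpha|(2L+2S)^{|\alpha|}$, $M_{R,\sigma}=\sum_{|\alpha|\le S}|\sigma_\alpha|(2L+2S)^{|\alpha|}$, one has $M_{R,b,\sigma}:=M_{R,b}+\tfrac12M_{R,\sigma}\le C_{b,\sigma}R^\eta$. Initial-condition assumption. There is $\delta_0>0$ with $\mathbb E[\exp(\delta_0|u_0|^2)]<\infty$. Projected scheme. With the same $z_k$: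 $v^{R,S}_{k+1}=\chi_R\big(v^{R,S}_k+p_b^{R,S}(v^{R,S}_k)h+p_\sigma^{R,S}(v^{R,S}_k)z_k\sqrt h\big)$, $v^{R,S}_0=\chi_R(u_0)$. mRPC algorithm (with $J=2L+S$, $S\le L$). Let $\mathcal J_{L,S}=\{(\alpha,\beta,\gamma):|\alpha|,|\beta|,|\gamma|\le L,\ |\alpha|+|\beta|+|\gamma|\le J\}$. Given a sequence $m=(m_\gamma)_{|\gamma|\le J}$ whose Hankel matrix $(m_{\alpha+\beta})_{|\alpha|,|\beta|\le L}$ is positive definite, let $\Lambda_m$ be the linear functional on polynomials of degree $\le J$ with $\Lambda_m(x^\gamma)=m_\gamma$; let $\{T_\alpha\}_{|\alpha|\le L}$ be obtained by Gram–Schmidt from the monomials $\{x^\alpha\}_{|\alpha|\le L}$ (in a fixed degree-graded order) for $\langle p,q\rangle=\Lambda_m(pq)$, and let $\Gamma_{\alpha\beta\gamma}=\Lambda_m(T_\alpha T_\beta T_\gamma)$ for $(\alpha,\beta,\gamma)\in\mathcal J_{L,S}$. For $|\mu|\le L$ write $x^\mu=\sum_{|\alpha|\le|\mu|}p_{\mu\alpha}T_\alpha$. The approximate expectation $\mathcal E_m$ is the linear functional on polynomials of degree $\le2L+2S$ given on monomials as follows. If $|\gamma|\le J$, write $\gamma=\gamma_1+\gamma_2+\gamma_3$ with $|\gamma_1|,|\gamma_2|\le L$, $|\gamma_3|\le S$ and put $\mathcal E_m[x^\gamma]=\sum_{\alpha,\beta,\nu}p_{\gamma_1\alpha}p_{\gamma_2\beta}p_{\gamma_3\nu}\Gamma_{\alpha\beta\nu}$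 (this equals $m_\gamma$). If $J<|\gamma|\le2L+2S$, fix a decomposition $\gamma=\gamma_1+\gamma_2+\gamma_3+\gamma_4$ with $|\gamma_1|,|\gamma_2|\le L$, $|\gamma_3|,|\gamma_4|\le S$ and put $\mathcal E_m[x^\gamma]=\sum_{|\nu|\le L}q^{(1)}_\nu q^{(2)}_\nu$, with $q^{(1)}_\nu=\sum_{\alpha,\beta}p_{\gamma_1\alpha}p_{\gamma_3\beta}\Gamma_{\alpha\beta\nu}$, $q^{(2)}_\nu=\sum_{\alpha,\beta}p_{\gamma_2\alpha}p_{\gamma_4\beta}\Gamma_{\alpha\beta\nu}$. One mRPC step maps $m$ to $m'=(m'_\gamma)_{|\gamma|\le J}$, where, with $p_b=p_b^{R,S}$, $p_\sigma=p_\sigma^{R,S}$, $$m'_\gamma=m_\gamma+h\sum_{i:\gamma_i\ge1}\gamma_i\,\mathcal E_m\big[x^{\gamma-e_i}p_b^{(i)}\big]+\frac h2\sum_{j=1}^m\sum_{i,l=1}^d\gamma_i(\gamma_l-\delta_{il})\,\mathcal E_m\big[x^{\gamma-e_i-e_l}p_\sigma^{(i,j)}p_\sigma^{(l,j)}\big]$$ (terms with zero coefficient are omitted; $\delta_{il}$ is the Kronecker delta). The mRPC moments are $m^{\mathrm{RPC}}_{0,\gamma}=\mathbb E[u_0^\gamma]$ and $\{m^{\mathrm{RPC}}_{k+1,\gamma}\}_{|\gamma|\le J}$ is the result of one mRPC step from $\{m^{\mathrm{RPC}}_{k,\gamma}\}_{|\gamma|\le J}$. For $J<|\gamma|\le2L+2S$,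 $m^{\mathrm{RPC}}_{k,\gamma}$ denotes $\mathcal E[x^\gamma]$ computed from $\{m^{\mathrm{RPC}}_{k,\gamma}\}_{|\gamma|\le J}$. mRPC stability assumption. (i) For every $0\le k\le n$ the Hankel matrix $(m^{\mathrm{RPC}}_{k,\alpha+\beta})_{|\alpha|,|\beta|\le L}$ is positive definite. (ii) There is a constant $C_\delta$, depending only on $K$ and $T$, with $\sup_{0\le k\le n}|m^{\mathrm{RPC}}_{k,\gamma}|\le C_\delta\sqrt{|\gamma|!}$ for all $|\gamma|\le2L+2S$.
   Formalization: The constants C_N and h_N may also depend on the other constants of the assumptions (η, r, C, R* and C_δ); uniformity in C and R* as literally claimed fails. *)

(* Defs.v *)
From HB Require Import structures.
From mathcomp Require Import all_boot all_order all_algebra.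
From mathcomp Require Import all_classical all_reals all_analysis.
(* Only the notations of mpoly are left out: they clash with those of
   MathComp-Analysis. *)
From mathcomp Require Export -(notations) mpoly.

Set Implicit Arguments.
Unset Strict Implicit.
Unset Printing Implicit Defensive.

Import Order.TTheory GRing.Theory Num.Theory.
Import numFieldNormedType.Exports.

Local Open Scope classical_set_scope.
Local Open Scope ring_scope.

(* Vectors are columns and multi-indices are [multinom d], of total degree
   [mdeg]; [bmultinom d n.+1] is the finite type of multi-indices of degree at
   most [n].  Polynomial maps are matrices over [mpoly d R]. *)

(* The norm registered on matrices by MathComp-Analysis is the sup norm.  On
   columns, [frob] is the Euclidean norm. *)
Definition frob (R : realType) (p q : nat) (A : 'M[R]_(p, q)) : R :=
  Num.sqrt (\tr (A *m A^T)).

Definition cube (R : realType) (d : nat) (rad : R) : set 'cV[R]_d :=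
  [set x | forall i, `|x i ord0| <= rad].

Definition monomial (R : realType) (d : nat) (g : multinom d) (x : 'cV[R]_d)
  : R := \prod_(i < d) x i ord0 ^+ g i.

Definition evalmx (R : realType) (d p q : nat) (A : 'M[mpoly d R]_(p, q))
  (x : 'cV[R]_d) : 'M[R]_(p, q) := map_mx (meval (fun i => x i ord0)) A.

Definition coefmx (R : realType) (d p q : nat) (a : multinom d)
  (A : 'M[mpoly d R]_(p, q)) : 'M[R]_(p, q) := map_mx (mcoeff a) A.

(* [msize] is one plus the degree, so the zero polynomial gets degree 0. *)
Definition degmx (R : realType) (d p q : nat) (A : 'M[mpoly d R]_(p, q))
  : nat := (\max_(i < p) \max_(j < q) (msize (A i j)).-1)%N.

Definition coef_mass (R : realType) (d p q : nat) (S B : nat)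
  (A : 'M[mpoly d R]_(p, q)) : R :=
  \sum_(a : bmultinom d S.+1) frob (coefmx a A) * B%:R ^+ mdeg a.

Definition cutoff (R : realType) (rad : R) (chi : R -> R) : Prop :=
  [/\ forall k x, derivable (derive1n k chi) x 1,
      forall s, chi (- s) = - chi s,
      forall s t, `|chi s - chi t| <= `|s - t|,
      forall s, `|s| <= rad / 3 -> chi s = s &
      forall s, rad <= `|s| -> chi s = 0].

Definition step (R : realType) (T : R) (n : nat) : R := T / n%:R.

Definition Lof (R : realType) (lam1 eta rad : R) : nat :=
  Num.truncn (lam1 * rad `^ eta).

Definition Sof (R : realType) (lam2 eta rad : R) : nat :=
  Num.truncn (lam2 * rad `^ eta).

(* The families [b] and [sigma] are indexed by the step size [h]; the
   approximating polynomials are indexed by [h], the radius and the degree.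
   Only the step sizes [T / n] matter. *)

Definition coef_growth (R : realType) (T K : R) (d m : nat)
  (b : R -> 'cV[R]_d -> 'cV[R]_d) (sigma : R -> 'cV[R]_d -> 'M[R]_(d, m))
  : Prop :=
  forall n, (0 < n)%N -> let h := step T n in
  [/\ forall x, frob (b h x) <= K * (frob x + 1),
      (ereal_sup [set (frob (sigma h x))%:E | x in [set: 'cV[R]_d]]
         < K%:E)%E,
      forall x y, frob (b h x - b h y) <= K * frob (x - y) &
      forall x y, frob (sigma h x - sigma h y) <= K * frob (x - y)].

Definition coef_approx (R : realType) (T r C : R) (d m : nat)
  (b : R -> 'cV[R]_d -> 'cV[R]_d) (sigma : R -> 'cV[R]_d -> 'M[R]_(d, m))
  (pb : R -> R -> nat -> 'cV[mpoly d R]_d)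
  (ps : R -> R -> nat -> 'M[mpoly d R]_(d, m)) : Prop :=
  forall n, (0 < n)%N -> let h := step T n in
  forall (rad : R) (S : nat), 0 < rad ->
    (maxn (degmx (pb h rad S)) (2 * degmx (ps h rad S)) <= S)%N /\
    (* [S ^ (- r)] is infinite at [S = 0], whereas [0 `^ (- r) = 0] here *)
    ((0 < S)%N ->
     (maxe (ereal_sup [set (frob (b h x - evalmx (pb h rad S) x))%:E
                      | x in cube rad])
           (ereal_sup [set (frob (sigma h x - evalmx (ps h rad S) x))%:E
                      | x in cube rad])
      <= (C * rad `^ r * S%:R `^ (- r))%:E)%E).

Definition coef_size (R : realType) (T Rstar lam1 lam2 eta Cbs : R)
  (d m : nat) (pb : R -> R -> nat -> 'cV[mpoly d R]_d)
  (ps : R -> R -> nat -> 'M[mpoly d R]_(d, m)) : Prop :=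
  forall n, (0 < n)%N -> let h := step T n in
  forall rad : R, Rstar < rad ->
    let L := Lof lam1 eta rad in
    let S := Sof lam2 eta rad in
    let Mb := coef_mass S (2 * L + 2 * S) (pb h rad S) in
    let Ms := coef_mass S (2 * L + 2 * S)
                (ps h rad S *m (ps h rad S)^T) in
    Mb + 2^-1 * Ms <= Cbs * rad `^ eta.

Definition coefficient_assumption (R : realType)
  (T K r C Rstar lam1 lam2 eta Cbs : R) (d m : nat)
  (b : R -> 'cV[R]_d -> 'cV[R]_d) (sigma : R -> 'cV[R]_d -> 'M[R]_(d, m))
  (pb : R -> R -> nat -> 'cV[mpoly d R]_d)
  (ps : R -> R -> nat -> 'M[mpoly d R]_(d, m)) : Prop :=
  [/\ coef_growth T K b sigma, coef_approx T r C b sigma pb ps &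
      coef_size T Rstar lam1 lam2 eta Cbs pb ps].

Definition indep_sigma (R : realType) (disp : measure_display)
  (Omega : measurableType disp) (P : probability Omega R) (I : eqType)
  (F : I -> set (set Omega)) : Prop :=
  forall (J : seq I) (A : I -> set Omega), uniq J ->
    (forall i, i \in J -> F i (A i)) ->
    P (\big[setI/setT]_(i <- J) A i) = (\prod_(i <- J) P (A i))%E.

(* Matrices carry no measurable structure, so random vectors are handled
   through their coordinates. *)
Definition random_vector (R : realType) (disp : measure_display)
  (Omega : measurableType disp) (q : nat) (X : Omega -> 'cV[R]_q) : Prop :=
  forall i, measurable_fun [set: Omega] (fun w => X w i ord0).

Definition sigma_vector (R : realType) (disp : measure_display)
  (Omega : measurableType disp) (q : nat) (X : Omega -> 'cV[R]_q)
  : set (set Omega) :=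
  <<s [set A | exists i (B : set R),
         measurable B /\ A = (fun w => X w i ord0) @^-1` B] >>.

Definition std_gaussian (R : realType) (disp : measure_display)
  (Omega : measurableType disp) (P : probability Omega R) (q : nat)
  (Z : Omega -> 'cV[R]_q) : Prop :=
  (forall (j : 'I_q) (B : set R), measurable B ->
     P ((fun w => Z w j ord0) @^-1` B) = normal_prob 0 1 B) /\
  indep_sigma P (fun j : 'I_q =>
    [set (fun w => Z w j ord0) @^-1` B
    | B in [set B : set R | measurable B]]).

(* Joint independence of [u0], [z 0], [z 1], ...: the index [None] stands for
   [u0]. *)
Definition driving_noise (R : realType) (disp : measure_display)
  (Omega : measurableType disp) (P : probability Omega R) (d m : nat)
  (u0 : Omega -> 'cV[R]_d) (z : nat -> Omega -> 'cV[R]_m) : Prop :=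
  [/\ random_vector u0,
      forall k, random_vector (z k),
      forall k, std_gaussian P (z k) &
      indep_sigma P (fun o : option nat =>
        if o is Some k then sigma_vector (z k) else sigma_vector u0)].

Definition initial_assumption (R : realType) (disp : measure_display)
  (Omega : measurableType disp) (P : probability Omega R) (d : nat)
  (delta0 : R) (u0 : Omega -> 'cV[R]_d) : Prop :=
  ('E_P[fun w => expR (delta0 * frob (u0 w) ^+ 2)] < +oo)%E.

Definition moment (R : realType) (disp : measure_display)
  (Omega : measurableType disp) (P : probability Omega R) (d : nat)
  (X : Omega -> 'cV[R]_d) (g : multinom d) : R :=
  fine 'E_P[fun w => monomial g (X w)].

Fixpoint projected (R : realType) (d m : nat) (chi : R -> R) (h : R)
  (pb : 'cV[mpoly d R]_d) (ps : 'M[mpoly d R]_(d, m)) (v0 : 'cV[R]_d)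
  (z : nat -> 'cV[R]_m) (k : nat) : 'cV[R]_d :=
  if k is k'.+1 then
    let v := projected chi h pb ps v0 z k' in
    map_mx chi (v + h *: evalmx pb v + Num.sqrt h *: (evalmx ps v *m z k'))
  else map_mx chi v0.

(* The choices left open by the algorithm: the degree-graded order of the
   monomials and the decompositions of the multi-indices. *)
Record rpc_choice (d L S : nat) := RpcChoice {
  rpc_order : seq (multinom d);
  rpc_order_uniq : uniq rpc_order;
  rpc_order_mem : forall a, (a \in rpc_order) = (mdeg a <= L)%N;
  rpc_order_graded :
    sorted (fun a b : multinom d => mdeg a <= mdeg b)%N rpc_order;
  split3 : multinom d -> multinom d * multinom d * multinom d;
  split3P : forall g, (mdeg g <= 2 * L + S)%N ->
    let: (g1, g2, g3) := split3 g in
    g = mnm_add (mnm_add g1 g2) g3 /\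
    [/\ mdeg g1 <= L, mdeg g2 <= L & mdeg g3 <= S]%N;
  split4 : multinom d -> multinom d * multinom d * multinom d * multinom d;
  split4P : forall g, (2 * L + S < mdeg g <= 2 * L + 2 * S)%N ->
    let: (g1, g2, g3, g4) := split4 g in
    g = mnm_add (mnm_add (mnm_add g1 g2) g3) g4 /\
    [/\ mdeg g1 <= L, mdeg g2 <= L, mdeg g3 <= S & mdeg g4 <= S]%N
}.

(* A moment sequence is a total function on multi-indices.  Its values above
   degree [J = 2 * L + S] are never used by the algorithm. *)

Definition extend_linear (R : realType) (d : nat) (mm : multinom d -> R)
  (p : mpoly d R) : R := \sum_(g <- msupp p) mcoeff g p * mm g.

Definition hankel_posdef (R : realType) (d L : nat) (mm : multinom d -> R)
  : Prop :=
  forall c : bmultinom d L.+1 -> R, (exists a, c a != 0) ->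
    0 < \sum_(a : bmultinom d L.+1) \sum_(a' : bmultinom d L.+1)
          c a * c a' * mm (mnm_add a a').

Definition gram_schmidt (R : realType) (d : nat) (Lam : mpoly d R -> R)
  (s : seq (mpoly d R)) : seq (mpoly d R) :=
  foldl (fun acc p =>
           let w := p - \sum_(t <- acc) Lam (p * t) *: t in
           rcons acc ((Num.sqrt (Lam (w * w)))^-1 *: w)) [::] s.

Definition rpc_basis (R : realType) (d L S : nat) (ch : rpc_choice d L S)
  (mm : multinom d -> R) (a : multinom d) : mpoly d R :=
  nth 0 (gram_schmidt (extend_linear mm)
           [seq mpolyX R g | g <- rpc_order ch]) (index a (rpc_order ch)).

Definition rpc_triple (R : realType) (d L S : nat) (ch : rpc_choice d L S)
  (mm : multinom d -> R) (a b c : multinom d) : R :=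
  extend_linear mm
    (rpc_basis ch mm a * rpc_basis ch mm b * rpc_basis ch mm c).

(* The coefficients [p mu a] in the expansion of the monomials on the
   orthonormal basis; they are determined for [mdeg a <= mdeg mu <= L] when the
   Hankel matrix is positive definite, and only those are used. *)
Definition rpc_expansion (R : realType) (d L S : nat) (ch : rpc_choice d L S)
  (mm : multinom d -> R) : multinom d -> multinom d -> R :=
  xget (fun _ _ => 0)
    [set p : multinom d -> multinom d -> R |
      forall mu, (mdeg mu <= L)%N ->
        mpolyX R mu =
          \sum_(a : bmultinom d (mdeg mu).+1) p mu a *: rpc_basis ch mm a].

Definition rpc_q (R : realType) (d L S : nat) (ch : rpc_choice d L S)
  (mm : multinom d -> R) (g g' nu : multinom d) : R :=
  \sum_(a : bmultinom d (mdeg g).+1) \sum_(b : bmultinom d (mdeg g').+1)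
    rpc_expansion ch mm g a * rpc_expansion ch mm g' b
    * rpc_triple ch mm a b nu.

Definition rpc_mono (R : realType) (d L S : nat) (ch : rpc_choice d L S)
  (mm : multinom d -> R) (g : multinom d) : R :=
  if (mdeg g <= 2 * L + S)%N then
    let: (g1, g2, g3) := split3 ch g in
    \sum_(a : bmultinom d (mdeg g1).+1) \sum_(b : bmultinom d (mdeg g2).+1)
      \sum_(c : bmultinom d (mdeg g3).+1)
        rpc_expansion ch mm g1 a * rpc_expansion ch mm g2 b
        * rpc_expansion ch mm g3 c * rpc_triple ch mm a b c
  else
    let: (g1, g2, g3, g4) := split4 ch g in
    \sum_(nu : bmultinom d L.+1) rpc_q ch mm g1 g3 nu * rpc_q ch mm g2 g4 nu.

Definition rpc_E (R : realType) (d L S : nat) (ch : rpc_choice d L S)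
  (mm : multinom d -> R) : mpoly d R -> R := extend_linear (rpc_mono ch mm).

Definition rpc_step (R : realType) (d m L S : nat) (ch : rpc_choice d L S)
  (h : R) (pb : 'cV[mpoly d R]_d) (ps : 'M[mpoly d R]_(d, m))
  (mm : multinom d -> R) (g : multinom d) : R :=
  mm g
  + h * \sum_(i < d | (0 < g i)%N)
      (g i)%:R * rpc_E ch mm (mpolyX R (mnm_sub g (mnm1 i)) * pb i ord0)
  + h / 2 * \sum_(j < m) \sum_(i < d) \sum_(l < d)
      (g i)%:R * ((g l)%:R - (i == l)%:R)
      * rpc_E ch mm (mpolyX R (mnm_sub (mnm_sub g (mnm1 i)) (mnm1 l))
                     * (ps i j * ps l j)).

Definition rpc_seq (R : realType) (d m L S : nat) (ch : rpc_choice d L S)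
  (h : R) (pb : 'cV[mpoly d R]_d) (ps : 'M[mpoly d R]_(d, m))
  (m0 : multinom d -> R) (k : nat) : multinom d -> R :=
  iter k (rpc_step ch h pb ps) m0.

Definition rpc_moment (R : realType) (d m L S : nat) (ch : rpc_choice d L S)
  (h : R) (pb : 'cV[mpoly d R]_d) (ps : 'M[mpoly d R]_(d, m))
  (m0 : multinom d -> R) (k : nat) (g : multinom d) : R :=
  let mk := rpc_seq ch h pb ps m0 k in
  if (mdeg g <= 2 * L + S)%N then mk g else rpc_mono ch mk g.

Definition rpc_stability (R : realType) (d m L S : nat)
  (ch : rpc_choice d L S) (h : R) (pb : 'cV[mpoly d R]_d)
  (ps : 'M[mpoly d R]_(d, m)) (m0 : multinom d -> R) (Cdelta : R) (n : nat)
  : Prop :=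
  (forall k, (k <= n)%N -> hankel_posdef L (rpc_moment ch h pb ps m0 k)) /\
  (forall k g, (k <= n)%N -> (mdeg g <= 2 * L + 2 * S)%N ->
     `|rpc_moment ch h pb ps m0 k g| <= Cdelta * Num.sqrt (mdeg g)`!%:R).

Definition moment_dist (R : realType) (d J : nat) (m1 m2 : multinom d -> R)
  : R :=
  \sum_(g : bmultinom d J.+1) `|m1 g - m2 g| / (mdeg g)`!%:R.

(* Main.v *)
(** On the event that [u0] lies in a cube of side proportional to [rad], the
    moments of the projected scheme satisfy the mRPC recursion up to a local error.
    Weight the moments by [1 / |g|!]: the generator then has norm at most
    [d ^ 2 M_{R,b,sigma} = O(rad ^ eta)], so discrete Gronwall over time [T] costs a
    factor [e ^ O(rad ^ eta)] only, and every error term is smaller than that.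
    - The moments of degree above [2 L] are of order [rad ^ n / n!] or
      [1 / sqrt n!] after weighting, which is superexponentially small in
      [rad ^ eta] because [eta > 1] and [n > 2 lambda_1 rad ^ eta - 2].
    - The Taylor remainder of one Euler step is [h ^ (3/2) e ^ O(rad)], and
      [h ^ (1/2) = e ^ (- delta rad ^ 2 / 4)] beats [e ^ O(rad ^ eta)] because
      [eta < 2].
    - The cut-off only acts outside the cube of radius [rad / 3].  The scheme has
      Gaussian moments [E e ^ (a |v_k| ^ 2)] with [a] depending on [K] and [T]
      only, so for [delta] proportional to [a] this happens with a probability
      that is small compared with [h].
    - The complement of the event is controlled by the moments of [u0] of degree
      [2 L], through the stability bound at time 0. *)

Require Import Defs.
From HB Require Import structures.
From mathcomp Require Import all_boot all_order all_algebra.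
From mathcomp Require Import all_classical all_reals all_analysis measurable_realfun.
From mathcomp Require Import ring lra zify.

Set Implicit Arguments.
Unset Strict Implicit.
Unset Printing Implicit Defensive.

Import Order.TTheory GRing.Theory Num.Theory.
Import numFieldNormedType.Exports.

Local Open Scope classical_set_scope.
Local Open Scope ring_scope.

(** * Linear functionals and the mRPC basis *)

(** The mRPC step is nonlinear in the moments, through Gram-Schmidt, yet the orthonormal basis is
    never perturbed. Up to degree [J] the approximate expectation returns the moment itself, so the
    recursion is linear there; above [J] the computed and the true moments are bounded separately,
    and their difference enters Gronwall only as a forcing term. Restricting [u0] to a box decouples
    [delta] from [delta0]: the Gaussian exponent [a] that survives up to time [T] may exceed
    [delta0]. Since [delta] is fixed before [d], the dependence on the dimension goes into the side
    of the box. The polynomials may grow fast outside the cube. Exponential moments are therefore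
    propagated from a state inside it, where the polynomials are within 1 of [b] and [sigma]; hence
    the growth constant [K + 1]. Independence of [z k] from the past is used only through a
    conditional Laplace transform, which yields the first two moments of the noise, the control of
    the Taylor remainder and the quadratic exponential moments; no conditional expectation is
    constructed. *)

Section ExtendLinear.
Variables (R : realType) (d : nat).
Implicit Types (mm : multinom d -> R) (p q : mpoly d R) (g : multinom d).

(** [extend_linear] sums over the support of its argument, whereas linearity needs several
    polynomials summed over one common list. *)
Lemma extend_linear_sub mm p (s : seq (multinom d)) :
  uniq s -> {subset msupp p <= s} ->
  extend_linear mm p = \sum_(g <- s) mcoeff g p * mm g.
Proof.
move=> us sub; rewrite /extend_linear [RHS](bigID (mem (msupp p))) /=.
rewrite [X in _ + X]big1 ?addr0; last first.
  by move=> g gp; rewrite memN_msupp_eq0// mul0r.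
rewrite -[RHS]big_filter; apply: perm_big; apply: uniq_perm.
- exact: msupp_uniq.
- exact: filter_uniq.
- by move=> g; rewrite mem_filter /=; case: (boolP (g \in msupp p)) => // /sub ->.
Qed.

Lemma extend_linear_is_linear mm : linear_for *%R (extend_linear mm).
Proof.
move=> c p q; pose s := undup (msupp p ++ msupp q ++ msupp (c *: p + q)).
have us : uniq s by exact: undup_uniq.
rewrite !(@extend_linear_sub _ _ s us).
- rewrite mulr_sumr -big_split /=; apply: eq_bigr => g _.
  by rewrite mcoeffD mcoeffZ mulrDl mulrA.
- by move=> g; rewrite mem_undup !mem_cat => ->; rewrite orbT.
- by move=> g; rewrite mem_undup !mem_cat => ->.
- by move=> g; rewrite mem_undup !mem_cat => ->; rewrite !orbT.
Qed.

HB.instance Definition _ mm := GRing.isLinear.Build R (mpoly d R) R *%R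
  (extend_linear mm) (@extend_linear_is_linear mm).

Lemma extend_linearX mm g : extend_linear mm (mpolyX R g) = mm g.
Proof. by rewrite /extend_linear msuppX big_seq1 mcoeffX eqxx mul1r. Qed.

Lemma mpolyE_bounded (n : nat) p : (forall g, g \in msupp p -> (mdeg g < n)%N) ->
  p = \sum_(g : bmultinom d n) mcoeff g p *: mpolyX R g.
Proof.
move=> H; apply: mpolywE; rewrite msizeE; apply/bigmax_leqP_seq => g gp _.
exact: H.
Qed.

Lemma extend_linearM mm p q (n : nat) :
  (forall g, g \in msupp p -> (mdeg g < n)%N) ->
  extend_linear mm (q * p) =
  \sum_(a : bmultinom d n) mcoeff a p * extend_linear mm (q * mpolyX R a).
Proof.
move=> H; rewrite {1}(mpolyE_bounded H) mulr_sumr linear_sum /=.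
by apply: eq_bigr => a _; rewrite -scalerAr linearZ.
Qed.

End ExtendLinear.

Section GramSchmidt.
Variables (R : realType) (d L : nat) (mm : multinom d -> R).
Hypothesis mm_posdef : hankel_posdef L mm.
Local Notation Lam := (extend_linear mm).

(** [Lam (w * w)] is the Hankel quadratic form at the coefficient vector of [w], whose leading entry
    is nonzero. *)
Lemma hankel_posdef_gt0 (w : mpoly d R) : w != 0 ->
  (forall g, g \in msupp w -> (mdeg g <= L)%N) -> 0 < Lam (w * w).
Proof.
move=> w0 sw; have sw' g : g \in msupp w -> (mdeg g < L.+1)%N by move=> /sw.
have -> : Lam (w * w) = \sum_(a : bmultinom d L.+1) \sum_(a' : bmultinom d L.+1)
    mcoeff a w * mcoeff a' w * mm (mnm_add a a').
  rewrite (extend_linearM _ _ sw'); apply: eq_bigr => a _.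
  rewrite (mulrC w) (extend_linearM _ _ sw') mulr_sumr; apply: eq_bigr => b _.
  by rewrite -mpolyXD extend_linearX mulrA.
apply: (mm_posdef (c := fun a : bmultinom d L.+1 => mcoeff a w)).
have : mlead w \in msupp w by rewrite mlead_supp.
move=> mw; exists (BMultinom (sw' _ mw)).
by rewrite /= -mcoeff_msupp.
Qed.

Definition gs_monomials (l : seq (multinom d)) :=
  gram_schmidt Lam [seq mpolyX R g | g <- l].

Lemma gs_monomials_rcons l g :
  exists2 w, w = mpolyX R g - \sum_(t <- gs_monomials l) Lam (mpolyX R g * t) *: t
    & gs_monomials (rcons l g) =
      rcons (gs_monomials l) ((Num.sqrt (Lam (w * w)))^-1 *: w).
Proof. by eexists; first reflexivity; rewrite /gs_monomials /gram_schmidt map_rcons foldl_rcons. Qed.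

Lemma size_gs_monomials l : size (gs_monomials l) = size l.
Proof.
elim/last_ind: l => [//|l g IH].
by have [w _ ->] := gs_monomials_rcons l g; rewrite !size_rcons IH.
Qed.

Lemma supp_gs_monomials l t g : t \in gs_monomials l -> g \in msupp t -> g \in l.
Proof.
elim/last_ind: l t => [//|l g' IH] t; have [w wE ->] := gs_monomials_rcons l g'.
rewrite !mem_rcons !inE => /predU1P[->|/IH H /H ->]; last by rewrite orbT.
move=> /msuppZ_le; rewrite wE => /msuppB_le; rewrite mem_cat msuppX mem_seq1.
move=> /orP[->//|/msupp_sum_le /flattenP [s /mapP[t']]].
rewrite filter_predT => tl -> /msuppZ_le /(IH _ tl) ->; exact: orbT.
Qed.

(** Gram-Schmidt is triangular: the residual keeps coefficient 1 on its own monomial, which no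
    earlier vector contains. It is thus nonzero and has positive norm, so the normalisation can be
    undone: the coefficients are the projections and, in last place, the norm. *)
Lemma gs_monomials_span l : uniq l -> (forall g, g \in l -> (mdeg g <= L)%N) ->
  forall i g0, (i < size l)%N -> exists c : nat -> R,
    mpolyX R (nth g0 l i) = \sum_(0 <= j < i.+1) c j *: nth 0 (gs_monomials l) j.
Proof.
elim/last_ind: l => [//|l g IH]; rewrite rcons_uniq => /andP[gl ul] sl i g0.
rewrite size_rcons ltnS leq_eqVlt => /predU1P[->|il].
  rewrite nth_rcons ltnn eqxx.
  have [w wE ->] := gs_monomials_rcons l g.
  have wg : mcoeff g w = 1.
    rewrite wE mcoeffB mcoeffX eqxx raddf_sum big_seq big1 ?subr0// => t tl.
    rewrite /= mcoeffZ memN_msupp_eq0 ?mulr0//.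
    by apply: contra gl; exact: supp_gs_monomials.
  have w0 : w != 0 by apply: contra_eq_neq wg => ->; rewrite mcoeff0 eq_sym oner_neq0.
  have sw g' : g' \in msupp w -> (mdeg g' <= L)%N.
    rewrite wE => /msuppB_le; rewrite mem_cat msuppX mem_seq1.
    move=> /orP[/eqP->|/msupp_sum_le /flattenP [s /mapP[t]]].
      by apply: sl; rewrite mem_rcons inE eqxx.
    rewrite filter_predT => tl -> /msuppZ_le /(supp_gs_monomials tl) g'l.
    by apply: sl; rewrite mem_rcons inE g'l orbT.
  have := hankel_posdef_gt0 w0 sw; rewrite -sqrtr_gt0.
  set r := Num.sqrt _ => r0.
  exists (fun j => if (j < size l)%N then Lam (mpolyX R g * nth 0 (gs_monomials l) j) else r).
  rewrite big_nat_recr //= ltnn nth_rcons size_gs_monomials ltnn eqxx scalerA.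
  rewrite divff ?gt_eqF// scale1r wE [X in _ = _ + (_ - X)](big_nth 0) size_gs_monomials.
  rewrite addrCA -[LHS]addr0; congr (_ + _); apply/esym/eqP; rewrite subr_eq0; apply/eqP.
  by apply: eq_big_nat => j /andP[_ jl]; rewrite nth_rcons size_gs_monomials jl.
have [|c cE] := IH ul _ i g0 il.
  by move=> g' g'l; apply: sl; rewrite mem_rcons inE g'l orbT.
exists c; rewrite nth_rcons il cE; have [w _ ->] := gs_monomials_rcons l g.
apply: eq_big_nat => j /andP[_ ji]; rewrite nth_rcons size_gs_monomials.
by rewrite (leq_ltn_trans _ il).
Qed.

End GramSchmidt.

Section RpcLow.
Variables (R : realType) (d L S : nat) (ch : rpc_choice d L S).
Variable (mm : multinom d -> R).
Hypothesis mm_posdef : hankel_posdef L mm.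

Lemma rpc_expansionP mu0 : (mdeg mu0 <= L)%N ->
  mpolyX R mu0 = \sum_(a : bmultinom d (mdeg mu0).+1)
     rpc_expansion ch mm mu0 a *: rpc_basis ch mm a.
Proof.
set spec := [set p : multinom d -> multinom d -> R | forall mu, (mdeg mu <= L)%N ->
  mpolyX R mu = \sum_(a : bmultinom d (mdeg mu).+1) p mu a *: rpc_basis ch mm a].
(* [xget] returns a solution as soon as one exists, which rules out the default zero family. *)
suff [p sp] : spec !=set0 by move: mu0; exact: (@xgetI _ (fun _ _ => 0) spec p sp).
have u := rpc_order_uniq ch; have mo := rpc_order_mem ch.
have ol g : g \in rpc_order ch -> (mdeg g <= L)%N by rewrite mo.
have /choice [c cE] : forall mu : multinom d, exists c : nat -> R, (mdeg mu <= L)%N ->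
    mpolyX R mu = \sum_(0 <= j < (index mu (rpc_order ch)).+1)
      c j *: nth 0 (gs_monomials mm (rpc_order ch)) j.
  move=> mu; have [muL|] := boolP (mdeg mu <= L)%N; last by exists (fun=> 0).
  have i_lt : (index mu (rpc_order ch) < size (rpc_order ch))%N by rewrite index_mem mo.
  have [c cE] := gs_monomials_span mm_posdef u ol (@mnm0 d) i_lt.
  by exists c => _; rewrite -cE nth_index// mo.
(* Elements of the same degree that come after [mu] in the order also occur in the target sum; they
   get coefficient 0. *)
exists (fun mu a => if (index a (rpc_order ch) <= index mu (rpc_order ch))%N
                 then c mu (index a (rpc_order ch)) else 0) => mu muL.
rewrite [LHS](cE _ muL).
set i := index mu _; set o := rpc_order ch in u mo ol i *.
have io : (i < size o)%N by rewrite index_mem mo.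
under [RHS]eq_bigr do rewrite (fun_if (fun x => x *: _)) scale0r.
rewrite -big_mkcond /=.
rewrite -(big_map (@bmnm d (mdeg mu).+1) (fun a => (index a o <= i)%N)
  (fun a => c mu (index a o) *: rpc_basis ch mm a)) /=.
rewrite -[RHS]big_filter.
transitivity (\sum_(a <- take i.+1 o) c mu (index a o) *: rpc_basis ch mm a).
  rewrite (big_nth (@mnm0 d)) size_take_min (minn_idPl _)//.
  apply: eq_big_nat => j /andP[_ ji]; rewrite nth_take//.
  by rewrite /rpc_basis index_uniq// (leq_trans ji).
apply: perm_big; apply: uniq_perm; first exact: take_uniq.
  by apply: filter_uniq; rewrite map_inj_uniq ?index_enum_uniq//; exact: val_inj.
move=> a; rewrite mem_filter.
have [ao|ao] := boolP (a \in o); last first.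
  rewrite (contraNF (@mem_take _ _ _ _) ao) memNindex// -ltnS.
  by rewrite ltnNge io.
rewrite in_take// ltnS; case: leqP => //= ai; apply/esym.
(* Gradedness of the order enters here: what precedes [mu] has at most its degree. *)
have deg_a : (mdeg a < (mdeg mu).+1)%N.
  have so := rpc_order_graded ch.
  have := sorted_leq_nth (leT := fun a b : multinom d => (mdeg a <= mdeg b)%N).
  move=> /(_ (fun b a c => @leq_trans _ _ _) (fun a => leqnn _) (@mnm0 d) _ so).
  move=> /(_ (index a o) i); rewrite !inE index_mem ao io => /(_ isT isT ai).
  by rewrite !nth_index// mo.
by apply/mapP; exists (BMultinom deg_a); rewrite ?mem_index_enum.
Qed.

(** Multiplying out the three expansions inside the linear functional undoes the change of basis, so
    the value depends neither on the decomposition nor on the basis. *)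
Lemma rpc_mono_low (SL : (S <= L)%N) g : (mdeg g <= 2 * L + S)%N ->
  rpc_mono ch mm g = mm g.
Proof.
move=> gJ; rewrite /rpc_mono gJ; have := split3P ch gJ.
case: (split3 ch g) => -[g1 g2] g3 [-> [g1L g2L g3S]].
rewrite -[RHS](@extend_linearX R) !mpolyXD (rpc_expansionP g1L) (rpc_expansionP g2L).
rewrite (rpc_expansionP (leq_trans g3S SL)) !mulr_suml linear_sum /=.
apply: eq_bigr => a _; rewrite [X in extend_linear mm (X * _)]mulr_sumr mulr_suml linear_sum /=;
    apply: eq_bigr => b _.
rewrite mulr_sumr linear_sum; apply: eq_bigr => c _ /=.
rewrite -[in RHS](scalerAr, scalerAl) -![in RHS](scalerAl, scalerAr) !linearZ /= /rpc_triple; ring.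
Qed.

End RpcLow.

(** * The generator in the weighted moment norm *)

Lemma frob_sqr (R : realType) (p q : nat) (A : 'M[R]_(p, q)) :
  frob A ^+ 2 = \sum_i \sum_j A i j ^+ 2.
Proof.
have E : \tr (A *m A^T) = \sum_i \sum_j A i j ^+ 2.
  by apply: eq_bigr => i _; rewrite mxE; apply: eq_bigr => j _; rewrite mxE expr2.
rewrite /frob sqr_sqrtr E//.
by apply: sumr_ge0 => i _; apply: sumr_ge0 => j _; exact: sqr_ge0.
Qed.

Lemma frob_ge0 (R : realType) (p q : nat) (A : 'M[R]_(p, q)) : 0 <= frob A.
Proof. exact: sqrtr_ge0. Qed.

Lemma row_le_frob (R : realType) (p q : nat) (A : 'M[R]_(p, q)) i :
  \sum_j A i j ^+ 2 <= frob A ^+ 2.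
Proof.
rewrite frob_sqr (bigD1 i)//= lerDl.
by apply: sumr_ge0 => ? _; apply: sumr_ge0 => ? _; exact: sqr_ge0.
Qed.

Lemma entry_le_frob (R : realType) (p q : nat) (A : 'M[R]_(p, q)) i j :
  `|A i j| <= frob A.
Proof.
rewrite -(@ler_pXn2r _ 2)// ?nnegrE ?frob_ge0// real_normK ?num_real//.
apply: le_trans (row_le_frob A i); rewrite (bigD1 j)//= lerDl.
by apply: sumr_ge0 => ? _; exact: sqr_ge0.
Qed.

Lemma fact_le_exp n k : ((n + k)`! <= n`! * (n + k) ^ k)%N.
Proof.
elim: k => [|k IH]; first by rewrite addn0 muln1.
rewrite addnS factS expnS mulnCA leq_mul2l /=.
rewrite (leq_trans IH)// leq_mul2l; apply/orP; right; case: k {IH} => // k.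
by rewrite leq_exp2r.
Qed.

Definition moment_norm (R : realType) (d n : nat) (e : multinom d -> R) : R :=
  \sum_(g : bmultinom d n.+1) `|e g| / (mdeg g)`!%:R.

Section GeneratorBound.
Variables (R : realType) (d : nat) (J S B : nat) (e : multinom d -> R).
Hypothesis JSB : (J + S <= B)%N.

(* Dividing by [|g|!] turns a shift of degree [|a| <= S] into the factor
   [B ^ |a|]; with [B = 2 L + 2 S] this is the weight appearing in [M_{R,b}] and
   [M_{R,sigma}]. *)
Lemma shifted_moment_norm (s a : multinom d) (c : multinom d -> R) :
  (mdeg a <= S)%N ->
  (forall g, 0 <= c g) ->
  (forall g, c g != 0 -> mpoly.lem s g) ->
  (forall g, c g * (mdeg g - mdeg s)`!%:R <= (mdeg g)`!%:R) ->
  \sum_(g : bmultinom d J.+1) c g * `|e (mnm_add (mnm_sub g s) a)| / (mdeg g)`!%:R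
  <= B%:R ^+ mdeg a * moment_norm B e.
Proof.
move=> aS c0 cs cle; rewrite /moment_norm mulr_sumr.
pose phi (g : bmultinom d J.+1) : multinom d := mnm_add (mnm_sub g s) a.
have phi_deg g : (mdeg (phi g) < B.+1)%N.
  rewrite mdegD ltnS (leq_trans _ JSB)// leq_add//.
  rewrite (leq_trans (_ : _ <= mdeg g)%N)//; last by rewrite -ltnS bmdeg.
  rewrite !mdegE; apply: leq_sum => i _; rewrite mnmBE; exact: leq_subr.
pose F (g : bmultinom d B.+1) : R := B%:R ^+ mdeg a * (`|e g| / (mdeg g)`!%:R).
have F0 g : 0 <= F g by rewrite mulr_ge0 ?exprn_ge0// divr_ge0.
pose psi g := BMultinom (phi_deg g).
(* Only multi-indices above [s] contribute, and on these [g |-> g - s + a] is injective, so the sum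
   can be reindexed into a part of the norm at degree [B]. *)
apply: (@le_trans _ _ (\sum_(g : bmultinom d J.+1 | mpoly.lem s g) F (psi g))).
  rewrite [leRHS]big_mkcond; apply: ler_sum => g _.
  case: ifPn => sg; last first.
    have -> : c g = 0 by apply/eqP; apply: contraNT sg; exact: cs.
    by rewrite !mul0r.
  rewrite /F /= mulrAC [leLHS]mulrC [leRHS]mulrCA ler_wpM2l//.
  rewrite ler_pdivrMr ?ltr0n ?fact_gt0//.
  rewrite -(@ler_pM2r _ (mdeg g - mdeg s)`!%:R) ?ltr0n ?fact_gt0//.
  rewrite (le_trans (cle g))//.
  have dE : mdeg (phi g) = (mdeg g - mdeg s + mdeg a)%N by rewrite mdegD -{2}(submK sg) mdegD addnK.
  rewrite mulrAC ler_peMl// mulrAC ler_pdivlMr ?ltr0n ?fact_gt0// mul1r.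
  rewrite -natrX -natrM ler_nat mulnC dE (leq_trans (fact_le_exp _ _))//.
  rewrite leq_mul2l; apply/orP; right; rewrite -dE.
  have := phi_deg g; rewrite ltnS; by case: (mdeg a) => // k ?; rewrite leq_exp2r.
set A := [pred g : bmultinom d J.+1 | mpoly.lem s g].
rewrite (eq_bigl (fun g => g \in A))//.
rewrite -(big_imset (h := psi) F (A := A)) /=.
  by rewrite [leLHS]big_mkcond /=; apply: ler_sum => g _; case: ifP.
move=> g1 g2; rewrite !inE => sg1 sg2 /(congr1 (@bmnm _ _)) /= /eqP.
rewrite /phi eqm_add2r => /eqP E; apply: val_inj => /=.
by rewrite -(submK sg1) -(submK sg2) E.
Qed.

End GeneratorBound.

Section Generator.
Variables (R : realType) (d m : nat).
Variables (pb : 'cV[mpoly d R]_d) (ps : 'M[mpoly d R]_(d, m)).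

(** [Lam] applied to the diffusion generator [pb . grad + 1/2 tr (ps ps^T Hess)] at the monomial of
    index [g]. *)
Definition generator (Lam : mpoly d R -> R) (g : multinom d) : R :=
  \sum_(i < d | (0 < g i)%N)
      (g i)%:R * Lam (mpolyX R (mnm_sub g (mnm1 i)) * pb i ord0)
  + 2^-1 * \sum_(j < m) \sum_(i < d) \sum_(l < d)
      (g i)%:R * ((g l)%:R - (i == l)%:R)
      * Lam (mpolyX R (mnm_sub (mnm_sub g (mnm1 i)) (mnm1 l))
             * (ps i j * ps l j)).

Lemma rpc_stepE L S (ch : rpc_choice d L S) h mm g :
  rpc_step ch h pb ps mm g = mm g + h * generator (rpc_E ch mm) g.
Proof. by rewrite /rpc_step /generator mulrDr mulrA addrA. Qed.

Lemma eq_generator (L1 L2 : mpoly d R -> R) g : L1 =1 L2 ->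
  generator L1 g = generator L2 g.
Proof.
move=> E; congr (_ + _ * _); first by apply: eq_bigr => i _; rewrite E.
by apply: eq_bigr => j _; apply: eq_bigr => i _; apply: eq_bigr => l _; rewrite E.
Qed.

Lemma generatorB (L1 L2 : mpoly d R -> R) g :
  generator L1 g - generator L2 g = generator (fun p => L1 p - L2 p) g.
Proof.
rewrite /generator opprD addrACA -mulrBr -!sumrB; congr (_ + _ * _).
  by apply: eq_bigr => i _; rewrite mulrBr.
apply: eq_bigr => j _; rewrite -sumrB; apply: eq_bigr => i _; rewrite -sumrB.
by apply: eq_bigr => l _; rewrite -mulrBr.
Qed.

Lemma extend_linear_subE (m1 m2 : multinom d -> R) p :
  extend_linear m1 p - extend_linear m2 p = extend_linear (fun g => m1 g - m2 g) p.
Proof. by rewrite /extend_linear -sumrB; apply: eq_bigr => g _; rewrite mulrBr. Qed.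

Lemma normr_extend_linearM e (n : nat) p g :
  (forall a, a \in msupp p -> (mdeg a < n)%N) ->
  `|extend_linear e (mpolyX R g * p)| <=
  \sum_(a : bmultinom d n) `|mcoeff a p| * `|e (mnm_add g a)|.
Proof.
move=> /extend_linearM ->; apply: le_trans (ler_norm_sum _ _ _) _.
by apply: ler_sum => a _; rewrite normrM -mpolyXD extend_linearX.
Qed.

Lemma degmx_supp p q (A : 'M[mpoly d R]_(p, q)) n i j a : (degmx A <= n)%N ->
  a \in msupp (A i j) -> (mdeg a <= n)%N.
Proof.
move=> An /msize_mdeg_lt; case E : (msize (A i j)) => [//|k]; rewrite ltnS => ak.
apply: leq_trans ak (leq_trans _ An); rewrite /degmx.
apply: leq_trans (leq_bigmax i); apply: leq_trans (leq_bigmax j).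
by rewrite E.
Qed.

Variables (J S B : nat) (e : multinom d -> R).
Hypothesis JSB : (J + S <= B)%N.
Hypothesis degb : (degmx pb <= S)%N.
Hypothesis degs : (2 * degmx ps <= S)%N.

(** The factors [g i] and [g i * (g l - delta_il)] produced by differentiation are at most [|g|] and
    [|g| * (|g| - 1)], exactly what turns [(|g| - 1)!] and [(|g| - 2)!] into [|g|!]. Every entry is
    bounded by the Frobenius norm, and there are [d] drift and [d ^ 2] diffusion entries. *)
Lemma generator_bound :
  moment_norm J (generator (extend_linear e)) <=
  (d ^ 2)%:R * (coef_mass S B pb + 2^-1 * coef_mass S B (ps *m ps^T)) * moment_norm B e.
Proof.
have N0 : 0 <= moment_norm B e by apply: sumr_ge0 => g _; rewrite divr_ge0.
pose gd (g : multinom d) i := (g i)%:R : R.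
pose ss i l := (ps *m ps^T) i l.
have sss i l a : a \in msupp (ss i l) -> (mdeg a < S.+1)%N.
  rewrite /ss mxE => /msupp_sum_le /flattenP [s /mapP[j]].
  rewrite filter_predT => _ -> /msuppM_le /allpairsP[[a1 a2] /=] [h1 h2 ->].
  rewrite mxE in h2; rewrite mdegD ltnS (leq_trans _ degs)// mul2n -addnn.
  by apply: leq_add; [exact: degmx_supp h1|exact: degmx_supp h2].
have bs i a : a \in msupp (pb i ord0) -> (mdeg a < S.+1)%N.
  by move=> /(degmx_supp degb).
pose t1 (g : multinom d) i := \sum_(a : bmultinom d S.+1) `|mcoeff a (pb i ord0)| *
   ((g i)%:R * `|e (mnm_add (mnm_sub g (mnm1 i)) a)| / (mdeg g)`!%:R).
pose t2 (g : multinom d) i l := \sum_(a : bmultinom d S.+1) `|mcoeff a (ss i l)| *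
   ((g i)%:R * ((g l) - (i == l))%:R
     * `|e (mnm_add (mnm_sub g (mnm_add (mnm1 i) (mnm1 l))) a)| / (mdeg g)`!%:R).
apply: (@le_trans _ _ (\sum_(g : bmultinom d J.+1)
    (\sum_i t1 g i + 2^-1 * \sum_i \sum_l t2 g i l))).
  apply: ler_sum => g _; rewrite ler_pdivrMr ?ltr0n ?fact_gt0//.
  rewrite (le_trans (ler_normD _ _))// mulrDl lerD//.
    rewrite (le_trans (ler_norm_sum _ _ _))// big_mkcond mulr_suml /=.
    apply: ler_sum => i _; case: ifPn => [gi|_]; last first.
      by rewrite mulr_ge0// sumr_ge0// => a _; rewrite !mulr_ge0// invr_ge0.
    rewrite normrM normr_nat /t1 mulr_suml.
    rewrite (le_trans (ler_wpM2l _ (normr_extend_linearM _ _ (bs i))))// mulr_sumr.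
    apply: ler_sum => a _; rewrite -!mulrA mulVf ?mulr1 ?pnatr_eq0 -?lt0n ?fact_gt0//.
    by rewrite mulrCA.
  rewrite normrM ger0_norm ?invr_ge0// -mulrA ler_wpM2l ?invr_ge0//.
  rewrite exchange_big /= (le_trans (ler_norm_sum _ _ _))// mulr_suml.
  apply: ler_sum => i _; rewrite exchange_big /= (le_trans (ler_norm_sum _ _ _))// mulr_suml.
  apply: ler_sum => l _.
  rewrite -mulr_sumr -linear_sum -mulr_sumr /=.
  have -> : \sum_j ps i j * ps l j = ss i l.
    by rewrite /ss mxE; apply: eq_bigr => j _; rewrite mxE.
  have -> : mnm_sub (mnm_sub g (mnm1 i)) (mnm1 l) = mnm_sub g (mnm_add (mnm1 i) (mnm1 l)).
    by apply/mnmP => k; rewrite !mnmBE mnmDE subnDA.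
  (* For [i = l] and [g i = 0] the truncated subtraction gives 0 instead of -1, but the prefactor
     vanishes. *)
  have -> : (g i)%:R * ((g l)%:R - (i == l)%:R) = (g i)%:R * ((g l) - (i == l))%:R :> R.
    case: eqVneq => [->|_]; last by rewrite subr0 subn0.
    by case: (g l) => [|k]; rewrite ?mul0r// natrB.
  rewrite normrM ger0_norm ?mulr_ge0// /t2 mulr_suml.
  rewrite (le_trans (ler_wpM2l _ (normr_extend_linearM _ _ (sss i l))))// ?mulr_ge0// mulr_sumr.
  apply: ler_sum => a _; rewrite -!mulrA mulVf ?mulr1 ?pnatr_eq0 -?lt0n ?fact_gt0//.
  by rewrite le_eqVlt; apply/orP; left; apply/eqP; ring.
rewrite big_split /= mulrDr mulrDl lerD//.
  rewrite exchange_big /= /coef_mass [leRHS]mulrAC [leRHS]mulr_sumr.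
  under eq_bigr do rewrite exchange_big /=.
  rewrite exchange_big /=; apply: ler_sum => a _.
  rewrite -mulrA [_ * (frob _ * _)]mulrC -mulrA.
  rewrite (le_trans (_ : _ <= \sum_(i < d) frob (coefmx a pb) * (B%:R ^+ mdeg a * moment_norm B e)))//.
    apply: ler_sum => i _; rewrite -mulr_sumr ler_pM//.
    - by apply: sumr_ge0 => g _; rewrite !mulr_ge0// invr_ge0.
    - by have := entry_le_frob (coefmx a pb) i ord0; rewrite mxE.
    apply: (shifted_moment_norm e JSB (c := fun g => (g i)%:R)) => //.
    + by rewrite -ltnS bmdeg.
    + by move=> g; rewrite pnatr_eq0 => gi; rewrite lep1mP.
    move=> g; rewrite mdeg1 -natrM ler_nat.
    have : (g i <= mdeg g)%N by rewrite mdegE (bigD1 i)//= leq_addr.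
    case: (mdeg g) => [|k] gk; last by rewrite subn1 /= factS leq_mul2r gk orbT.
    by move: gk; rewrite leqn0 => /eqP ->.
  rewrite sumr_const card_ord -[leLHS]mulr_natl ler_wpM2r//.
    by rewrite !mulr_ge0// ?frob_ge0 ?exprn_ge0.
  by rewrite ler_nat; case: (d) => // k; rewrite leq_pmulr.
rewrite -mulr_sumr mulrCA -mulrA ler_wpM2l ?invr_ge0//.
rewrite exchange_big /= /coef_mass [leRHS]mulrAC [leRHS]mulr_sumr.
under eq_bigr do rewrite exchange_big /=.
under eq_bigr => i _ do (under eq_bigr do rewrite exchange_big /=; rewrite exchange_big /=).
rewrite exchange_big /=; apply: ler_sum => a _.
rewrite -mulrA [_ * (frob _ * _)]mulrC -mulrA.
rewrite (le_trans (_ : _ <= \sum_(i < d) \sum_(l < d)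
    frob (coefmx a (ps *m ps^T)) * (B%:R ^+ mdeg a * moment_norm B e)))//; last first.
  rewrite !sumr_const !card_ord -mulrnA -[leLHS]mulr_natl ler_wpM2r//.
  by rewrite !mulr_ge0// ?frob_ge0 ?exprn_ge0.
apply: ler_sum => i _; apply: ler_sum => l _; rewrite -mulr_sumr ler_pM//.
- by apply: sumr_ge0 => g _; rewrite !mulr_ge0// invr_ge0.
- by have := entry_le_frob (coefmx a (ps *m ps^T)) i l; rewrite mxE.
apply: (shifted_moment_norm e JSB (c := fun g => (g i)%:R * ((g l) - (i == l))%:R)) => //.
- by rewrite -ltnS bmdeg.
- move=> g; rewrite -natrM pnatr_eq0 -lt0n muln_gt0 subn_gt0 => /andP[gi gl].
  apply/mnm_lepP => k; rewrite mnmDE !mnm1E.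
  case: (eqVneq i k) => [<-|_]; last first.
    case: (eqVneq l k) => [<-|_ //]; exact: leq_ltn_trans gl.
  by move: gl; rewrite eq_sym; case: (eqVneq l i) => [->|_] gl'; rewrite ?addn0 ?addn1 ?addn1//; lia.
move=> g; rewrite mdegD !mdeg1 -!natrM ler_nat.
have : (g i * (g l - (i == l)) <= mdeg g * (mdeg g).-1)%N.
  rewrite mdegE (bigD1 i)//=; have [<-|il] := eqVneq i l.
    by rewrite subn1 leq_mul ?leq_addr// -!subn1 leq_sub2r// leq_addr.
  rewrite (bigD1 l) 1?eq_sym//= subn0.
  have [->//|] := posnP (g i) => gi; nia.
case: (mdeg g) => [|[|k]] gk.
- by move: gk; rewrite mul0n leqn0 => /eqP ->.
- by move: gk; rewrite muln0 leqn0 => /eqP ->.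
by rewrite subn2 /= !factS mulnA leq_mul2r gk orbT.
Qed.

End Generator.

(** * Error propagation in the mRPC recursion *)

Lemma discrete_gronwall (R : realType) (D : nat -> R) (q e : R) (n : nat) :
  0 <= q -> 0 <= e -> 0 <= D 0 ->
  (forall k, (k < n)%N -> D k.+1 <= (1 + q) * D k + e) ->
  forall k, (k <= n)%N -> D k <= expR (k%:R * q) * (D 0 + k%:R * e).
Proof.
move=> q0 e0 D0 H; elim=> [|k IH] kn; first by rewrite !mul0r expR0 mul1r addr0.
apply: (le_trans (H k kn)).
apply: (@le_trans _ _ ((1 + q) * (expR (k%:R * q) * (D 0 + k%:R * e)) + e)).
  by rewrite lerD2r ler_wpM2l ?addr_ge0// IH// ltnW.
have E1 : 1 + q <= expR q by exact: expR_ge1Dx.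
have E2 : 1 <= expR (k.+1%:R * q) by rewrite -expR0 ler_expR mulr_ge0.
apply: (@le_trans _ _ (expR q * (expR (k%:R * q) * (D 0 + k%:R * e)) + expR (k.+1%:R * q) * e)).
  apply: lerD; last by rewrite ler_peMl.
  by rewrite ler_wpM2r// mulr_ge0 ?expR_ge0// addr_ge0// mulr_ge0.
have -> : k.+1%:R * q = q + k%:R * q by rewrite -natr1; ring.
by rewrite expRD -[k.+1%:R]natr1 le_eqVlt; apply/orP; left; apply/eqP; ring.
Qed.

Lemma card_bmultinom d n : (#|{: bmultinom d n.+1}| <= n.+1 ^ d)%N.
Proof.
have ub (g : bmultinom d n.+1) i : (g i < n.+1)%N.
  by apply: leq_ltn_trans (bmdeg g); rewrite mdegE (bigD1 i)//= leq_addr.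
have -> : (n.+1 ^ d)%N = #|{: {ffun 'I_d -> 'I_n.+1}}| by rewrite card_ffun !card_ord.
apply: (@leq_card _ _ (fun g : bmultinom d n.+1 => [ffun i => Ordinal (ub g i)])).
move=> g1 g2 /ffunP E; apply: val_inj; apply/mnmP => i.
by have := E i; rewrite !ffunE => /(congr1 val).
Qed.

Lemma coef_mass_ge0 (R : realType) (d p q S B : nat) (A : 'M[mpoly d R]_(p, q)) :
  0 <= coef_mass S B A.
Proof. by apply: sumr_ge0 => a _; rewrite mulr_ge0 ?frob_ge0 ?exprn_ge0. Qed.

Section MomentNorm.
Variables (R : realType) (d : nat).
Implicit Types e : multinom d -> R.

Lemma moment_norm_ge0 n e : 0 <= moment_norm n e.
Proof. by apply: sumr_ge0 => g _; rewrite divr_ge0. Qed.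

Lemma moment_normD n e1 e2 e3 : (forall g, `|e1 g| <= `|e2 g| + `|e3 g|) ->
  moment_norm n e1 <= moment_norm n e2 + moment_norm n e3.
Proof.
move=> H; rewrite /moment_norm -big_split /=; apply: ler_sum => g _.
by rewrite -mulrDl ler_wpM2r ?invr_ge0.
Qed.

Lemma moment_normZ n (c : R) e : 0 <= c ->
  moment_norm n (fun g => c * e g) = c * moment_norm n e.
Proof.
move=> c0; rewrite /moment_norm mulr_sumr; apply: eq_bigr => g _.
by rewrite normrM ger0_norm// mulrA.
Qed.

Lemma moment_norm_le n e (tau : R) : 0 <= tau ->
  (forall g, (mdeg g <= n)%N -> `|e g| <= (mdeg g)`!%:R * tau) ->
  moment_norm n e <= (n.+1)%:R ^+ d * tau.
Proof.
move=> t0 H; apply: (@le_trans _ _ (\sum_(g : bmultinom d n.+1) tau)).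
  apply: ler_sum => g _; rewrite ler_pdivrMr ?ltr0n ?fact_gt0// mulrC H//.
  by rewrite -ltnS bmdeg.
by rewrite sumr_const -[leLHS]mulr_natl ler_wpM2r// -natrX ler_nat card_bmultinom.
Qed.

Lemma moment_norm_split n b e (tau : R) : (n <= b)%N -> 0 <= tau ->
  (forall g, (n < mdeg g <= b)%N -> `|e g| <= (mdeg g)`!%:R * tau) ->
  moment_norm b e <= moment_norm n e + (b.+1)%:R ^+ d * tau.
Proof.
move=> nb t0 H.
pose e1 (g : multinom d) := if (mdeg g <= n)%N then e g else 0.
pose e2 (g : multinom d) := if (mdeg g <= n)%N then 0 else e g.
apply: (@le_trans _ _ (moment_norm b e1 + moment_norm b e2)).
  by apply: moment_normD => g; rewrite /e1 /e2; case: ifP; rewrite normr0 ?addr0 ?add0r.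
apply: lerD; last first.
  apply: moment_norm_le => // g gb; rewrite /e2; case: leqP => [_|ng].
    by rewrite normr0 mulr_ge0.
  by rewrite H// ng.
have wd (g : bmultinom d n.+1) : (mdeg g < b.+1)%N.
  by apply: leq_trans (bmdeg g) _; rewrite ltnS.
pose psi (g : bmultinom d n.+1) := BMultinom (wd g).
rewrite /moment_norm; pose F (g : bmultinom d b.+1) : R := `|e g| / (mdeg g)`!%:R.
rewrite -[leRHS](big_imset (h := psi) F (A := predT)) /=; last first.
  by move=> g1 g2 _ _ /(congr1 (@bmnm _ _)) /= E; exact: val_inj.
rewrite [leRHS]big_mkcond /=; apply: ler_sum => g _.
rewrite /e1; case: leqP => gn; last first.
  by rewrite normr0 mul0r; case: ifP => // _; rewrite divr_ge0.
case: ifPn => // /imsetP []; exists (BMultinom (gn : (mdeg g < n.+1)%N)) => //.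
exact: val_inj.
Qed.

End MomentNorm.

Section RpcError.
Variables (R : realType) (d m L S : nat) (ch : rpc_choice d L S) (h : R).
Variables (pb : 'cV[mpoly d R]_d) (ps : 'M[mpoly d R]_(d, m)).
Variables (m0 : multinom d -> R) (mu : nat -> multinom d -> R) (n : nat).
Variables (Q eps tau : R).
Local Notation J := (2 * L + S)%N.
Local Notation B := (2 * L + 2 * S)%N.
Local Notation mk := (rpc_moment ch h pb ps m0).
Hypothesis SL : (S <= L)%N.
Hypothesis h_ge0 : 0 <= h.
Hypothesis eps_ge0 : 0 <= eps.
Hypothesis tau_ge0 : 0 <= tau.
Hypothesis degb : (degmx pb <= S)%N.
Hypothesis degs : (2 * degmx ps <= S)%N.
Hypothesis massQ :
  (d ^ 2)%:R * (coef_mass S B pb + 2^-1 * coef_mass S B (ps *m ps^T)) <= Q.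
Hypothesis posdef : forall k, (k <= n)%N -> hankel_posdef L (mk k).
Hypothesis consistency : forall k, (k < n)%N ->
  moment_norm J (fun g => mu k.+1 g - mu k g - h * generator pb ps (extend_linear (mu k)) g)
  <= h * eps.
Hypothesis tail : forall k g, (k <= n)%N -> (J < mdeg g <= B)%N ->
  `|mu k g - mk k g| <= (mdeg g)`!%:R * tau.

Lemma rpc_seq_posdef k : (k <= n)%N -> hankel_posdef L (rpc_seq ch h pb ps m0 k).
Proof.
move=> kn c c0; have := posdef kn c0; congr (0 < _).
apply: eq_bigr => a _; apply: eq_bigr => a' _; rewrite /rpc_moment ifT//.
rewrite mdegD; have := bmdeg a; have := bmdeg a'; lia.
Qed.

Lemma rpc_monoE k : (k <= n)%N -> rpc_mono ch (rpc_seq ch h pb ps m0 k) =1 mk k.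
Proof.
move=> kn g; rewrite /rpc_moment; case: leqP => // gJ.
exact: rpc_mono_low (rpc_seq_posdef kn) SL _ gJ.
Qed.

(** The error satisfies [e' = r + e + h A e], where [A] maps degrees up to [B] to degrees up to [J].
    Degrees between [J] and [B] are not propagated by the recursion: they are replaced by their a
    priori bound [tau]. *)
Lemma rpc_error k : (k <= n)%N ->
  moment_norm J (fun g => mu k g - mk k g) <=
  expR (k%:R * (h * Q)) * (moment_norm J (fun g => mu 0%N g - mk 0 g)
     + k%:R * (h * Q * (B.+1%:R ^+ d * tau) + h * eps)).
Proof.
move=> kn; have Q0 : 0 <= Q.
  apply: le_trans massQ; rewrite mulr_ge0// addr_ge0 ?mulr_ge0 ?invr_ge0 ?coef_mass_ge0//.
have hQ0 : 0 <= h * Q by rewrite mulr_ge0.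
apply: (@discrete_gronwall R (fun k => moment_norm J
  (fun g => mu k g - mk k g)) _ _ n) => //; [|exact: moment_norm_ge0|].
  by rewrite addr_ge0// mulr_ge0// mulr_ge0 ?exprn_ge0.
move=> {kn}k kn; have kn' := ltnW kn.
pose e g := mu k g - mk k g.
pose r g := mu k.+1 g - mu k g - h * generator pb ps (extend_linear (mu k)) g.
have step g : (mdeg g <= J)%N -> mu k.+1 g - mk k.+1 g =
    r g + (e g + h * generator pb ps (extend_linear e) g).
  move=> gJ; rewrite {1}/rpc_moment gJ /rpc_seq iterS rpc_stepE -/(rpc_seq _ _ _ _ _ _).
  (* Both sides use the same numbers: [rpc_mono] is the moment itself up to degree [J], and above
     [J] it is the definition of the computed moment. *)
  have -> : generator pb ps (rpc_E ch (rpc_seq ch h pb ps m0 k)) g =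
      generator pb ps (extend_linear (mk k)) g.
    by apply: eq_generator => p; apply: eq_bigr => g' _; rewrite rpc_monoE.
  have -> : generator pb ps (extend_linear e) g =
      generator pb ps (extend_linear (mu k)) g - generator pb ps (extend_linear (mk k)) g.
    by rewrite generatorB; apply: eq_generator => p; rewrite extend_linear_subE.
  have -> : rpc_seq ch h pb ps m0 k g = mk k g by rewrite /rpc_moment gJ.
  rewrite /r /e; ring.
have JSB : (J + S <= B)%N by lia.
have gen := generator_bound e JSB degb degs.
have spl := moment_norm_split (_ : (J <= B)%N) tau_ge0 (fun g => @tail k g kn').
have {}spl : moment_norm B e <= moment_norm J e + B.+1%:R ^+ d * tau by apply: spl; lia.
have eB0 := moment_norm_ge0 B e.
apply: (@le_trans _ _ (moment_norm J r + (moment_norm J e +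
    h * moment_norm J (generator pb ps (extend_linear e))))).
  rewrite -moment_normZ//.
  apply: (@le_trans _ _ (moment_norm J r + moment_norm J
     (fun g => e g + h * generator pb ps (extend_linear e) g))).
    rewrite /moment_norm -big_split /=; apply: ler_sum => g _.
    by rewrite -mulrDl ler_wpM2r ?invr_ge0// step ?ler_normD// -ltnS bmdeg.
  by rewrite lerD2l; apply: moment_normD => g; exact: ler_normD.
have H1 : moment_norm J (generator pb ps (extend_linear e)) <=
    Q * (moment_norm J e + B.+1%:R ^+ d * tau).
  by apply: (le_trans gen); apply: ler_pM => //; rewrite mulr_ge0
      ?addr_ge0 ?mulr_ge0 ?invr_ge0 ?coef_mass_ge0.
have := ler_wpM2l h_ge0 H1; have := consistency kn; rewrite -/r -/e.
move: (moment_norm J r) (moment_norm J e) (moment_norm J _) (B.+1%:R ^+ d * tau).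
move=> a b c t; nra.
Qed.

End RpcError.

(** * Taylor expansion of monomials *)

Lemma exprn_fact_le_expR (R : realType) (x : R) n : 0 <= x ->
  x ^+ n <= n`!%:R * expR x.
Proof.
move=> x0; rewrite -ler_pdivrMl ?ltr0n ?fact_gt0//; case: n => [|n].
  by rewrite fact0 invr1 expr0 mul1r -expR0 ler_expR.
by apply: le_trans (expR_ge1Dxn n x0); rewrite mulrC lerDr.
Qed.

Lemma expR_taylor2 (R : realType) (x : R) :
  `|expR x - (1 + x + x ^+ 2 / 2)| <= `|x| ^+ 3 * expR `|x|.
Proof.
have cx := is_cvg_series_exp_coeff x.
have -> : expR x = limn (series (exp_coeff x)) by [].
have ub n : `|series (exp_coeff x) n.+3 - (1 + x + x ^+ 2 / 2)| <= `|x| ^+ 3 * expR `|x|.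
  rewrite /series /= (@big_cat_nat _ _ _ 3)//= 3?big_nat_recl// big_geq// addr0.
  rewrite !exp_coeffE /= fact0 !factS fact0 expr0 expr1 invr1 !mul1r.
  rewrite (_ : _ - _ = \sum_(3 <= i < n.+3) exp_coeff x i); last first.
    rewrite !muln1 (_ : \sum_(3 <= i < n.+3) exp_coeff x i =
        \sum_(3 <= i < n.+3) i`!%:R^-1 * x ^+ i);
        last by apply: eq_bigr => i _; rewrite exp_coeffE.
    by field.
  apply: le_trans (ler_norm_sum _ _ _) _.
  apply: (@le_trans _ _ (\sum_(0 <= i < n) `|x| ^+ 3 * exp_coeff `|x| i)).
    have -> : \sum_(3 <= i < n.+3) `|exp_coeff x i| = \sum_(0 <= i < n) `|exp_coeff x (i + 3)%N|.
      by rewrite -[in LHS](add0n 3%N) big_addn -[n.+3]addn3 addnK.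
    apply: ler_sum => i _; rewrite /exp_coeff /= normrM normrX normfV normr_nat.
    rewrite exprD [_ ^+ i * _]mulrC -mulrA ler_wpM2l ?exprn_ge0// ler_wpM2l ?exprn_ge0//.
    by rewrite lef_pV2 ?posrE ?ltr0n ?fact_gt0// ler_nat addn3 !factS !mulnA leq_pmull.
  rewrite -mulr_sumr ler_wpM2l ?exprn_ge0//.
  apply: (@nondecreasing_cvgn_le _ (series (exp_coeff `|x|)) _ _ n).
    apply: nondecreasing_series => k _ _; exact: exp_coeff_ge0.
  exact: is_cvg_series_exp_coeff.
rewrite ler_distl; apply/andP; split.
  apply: limr_ge => //; near=> n; have n3 : (3 <= n)%N by near: n; exists 3%N.
  by rewrite -(subnK n3) addn3; have := ub (n - 3)%N; rewrite ler_distl => /andP[].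
apply: limr_le => //; near=> n; have n3 : (3 <= n)%N by near: n; exists 3%N.
by rewrite -(subnK n3) addn3; have := ub (n - 3)%N; rewrite ler_distl => /andP[].
Unshelve. all: by end_near. Qed.

Section Taylor.
Variables (R : realType) (d : nat).
Implicit Types (p : mpoly d R) (v a : 'I_d -> R) (g : multinom d).

Definition taylor1 v a p := \sum_i meval v (mderiv i p) * a i.
Definition taylor2 v a p :=
  2^-1 * \sum_i \sum_l meval v (mderiv l (mderiv i p)) * (a i * a l).
Definition taylor_rem v a p :=
  meval (fun i => v i + a i) p - meval v p - taylor1 v a p - taylor2 v a p.

Let XU j : mpoly d R := mpolyX R (mnm1 j).

Let mderivXU i j : mderiv i (XU j) = (i == j)%:R.
Proof.
rewrite /XU mderivX mnm1E eq_sym; have [->|] := eqVneq i j.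
  by rewrite scale1r -[RHS]mpolyX0; congr mpolyX; apply/mnmP => k; rewrite mnmBE mnm0E subnn.
by rewrite scale0r.
Qed.

Let mevalXU v j : meval v (XU j) = v j.
Proof. exact: mevalXU. Qed.

Lemma taylor1_mulX v a p j :
  taylor1 v a (p * XU j) = taylor1 v a p * v j + meval v p * a j.
Proof.
rewrite /taylor1 mulr_suml.
under eq_bigr do rewrite mderivM mevalD !mevalM mevalXU mderivXU mulrDl.
rewrite big_split /=; congr (_ + _); first by apply: eq_bigr => i _; rewrite mulrAC.
rewrite (bigD1 j)//= eqxx meval1 mulr1 big1 ?addr0// => i /negbTE ->.
by rewrite meval0 mulr0 mul0r.
Qed.

Lemma taylor2_mulX v a p j :
  taylor2 v a (p * XU j) = taylor2 v a p * v j + taylor1 v a p * a j.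
Proof.
have E i l : mderiv l (mderiv i (p * XU j)) =
    mderiv l (mderiv i p) * XU j + mderiv i p * (l == j)%:R + mderiv l p * (i == j)%:R.
  rewrite mderivM mderivD mderivXU [mderiv l (p * _)]mderivM mderivM mderivXU.
  congr (_ + _).
  by case: (i == j); rewrite ?mderivC ?mulr0 ?addr0// -mpolyC1 mderivC mulr0 addr0.
rewrite /taylor2.
have -> : \sum_i \sum_l meval v (mderiv l (mderiv i (p * XU j))) * (a i * a l) =
    (\sum_i \sum_l meval v (mderiv l (mderiv i p)) * (a i * a l)) * v j
    + (taylor1 v a p * a j + taylor1 v a p * a j).
  have -> : taylor1 v a p * a j =
      \sum_i \sum_l meval v (mderiv i p) * (l == j)%:R * (a i * a l).
    rewrite /taylor1 mulr_suml; apply: eq_bigr => i _.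
    rewrite (bigD1 j)//= eqxx mulr1 big1 ?addr0 ?mulrA// => l /negbTE ->.
    by rewrite mulr0 mul0r.
  have -> : \sum_i \sum_l meval v (mderiv i p) * (l == j)%:R * (a i * a l) +
      \sum_i \sum_l meval v (mderiv i p) * (l == j)%:R * (a i * a l) =
      \sum_i \sum_l meval v (mderiv i p) * (l == j)%:R * (a i * a l) +
      \sum_i \sum_l meval v (mderiv l p) * (i == j)%:R * (a i * a l).
    congr (_ + _); rewrite exchange_big; apply: eq_bigr => i _; apply: eq_bigr => l _.
    by rewrite (mulrC (a i)).
  rewrite mulr_suml -!big_split /=; apply: eq_bigr => i _.
  rewrite mulr_suml -!big_split /=; apply: eq_bigr => l _.
  rewrite E !mevalD !mevalM mevalXU.
  have -> b : meval v (b%:R : mpoly d R) = b%:R :> R by rewrite mevalMn meval1.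
  ring.
by field.
Qed.

(** A product rule for the remainder: multiplying by a variable costs only the second-order term.
    Induction on the monomial then replaces a multivariate Taylor formula. *)
Lemma taylor_rem_mulX v a p j : taylor_rem v a (p * XU j) =
  taylor_rem v a p * (v j + a j) + taylor2 v a p * a j.
Proof. rewrite /taylor_rem taylor1_mulX taylor2_mulX !mevalM !mevalXU; ring. Qed.

Lemma multinom_ind (P : multinom d -> Prop) :
  P mnm0 -> (forall g j, P g -> P (mnm_add g (mnm1 j))) -> forall g, P g.
Proof.
move=> P0 PS g; move E : (mdeg g) => n; elim: n g E => [|n IH] g E.
  by move: E => /eqP; rewrite mdeg_eq0 => /eqP ->.
have [j gj] : exists j, g j != 0%N.
  apply/existsP; apply: contra_eqT E; rewrite negb_exists => /forallP g0.
  by rewrite mdegE big1// => i _; apply/eqP; rewrite -[_ == _]negbK g0.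
rewrite -(submK (_ : mpoly.lem (mnm1 j) g)); last by rewrite lep1mP.
apply: PS; apply: IH; have : mdeg g = (mdeg (mnm_sub g (mnm1 j)) + 1)%N.
  by rewrite -{1}(submK (_ : mpoly.lem (mnm1 j) g)) ?lep1mP// mdegD mdeg1.
by rewrite E addn1 => -[].
Qed.

(** Each order feeds on the one below through the product rules, so the four bounds are proved
    together. [1 <= V] makes the powers of [V + al] increasing, and [(n + 1) ^ j] leaves room for
    [n ^ j + n ^ (j - 1)]. *)
Lemma taylor_bounds v a (V al : R) g : 1 <= V ->
  (forall i, `|v i| <= V) -> (forall i, `|a i| <= al) -> 0 <= al ->
  [/\ `|meval v (mpolyX R g)| <= (V + al) ^+ mdeg g,
    `|taylor1 v a (mpolyX R g)| <= (mdeg g)%:R * (V + al) ^+ mdeg g * al,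
    `|taylor2 v a (mpolyX R g)| <= (mdeg g)%:R ^+ 2 * (V + al) ^+ mdeg g * al ^+ 2 &
    `|taylor_rem v a (mpolyX R g)| <= (mdeg g)%:R ^+ 3 * (V + al) ^+ mdeg g * al ^+ 3].
Proof.
move=> V1 vV aal al0; set W := V + al.
have W1 : 1 <= W by rewrite /W; lra.
have W0 : 0 <= W by lra.
elim/multinom_ind: g => [|g j [H0 H1 H2 H3]].
  have t1 : taylor1 v a 1 = 0.
    by rewrite /taylor1 big1// => i _; rewrite -mpolyC1 mderivC meval0 mul0r.
  have t2 : taylor2 v a 1 = 0.
    rewrite /taylor2 big1 ?mulr0// => i _; rewrite big1// => l _.
    by rewrite -mpolyC1 mderivC mderiv0 meval0 mul0r.
  rewrite mdeg0 mpolyX0 /taylor_rem t1 t2 !meval1 !subr0 subrr normr0 normr1.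
  by split=> //; rewrite ?mul0r// expr0n !mul0r.
rewrite mpolyXD mdegD mdeg1 -/(XU j) taylor1_mulX taylor2_mulX taylor_rem_mulX mevalM mevalXU.
rewrite addn1 -natr1.
have vW : `|v j| <= W by rewrite (le_trans (vV j))// /W lerDl.
have vaW : `|v j + a j| <= W by rewrite (le_trans (ler_normD _ _))// /W lerD.
have := aal j; move: H0 H1 H2 H3.
set X := (mdeg g)%:R : R; have X0 : 0 <= X by [].
rewrite [W ^+ (mdeg g).+1]exprSr; have : 0 <= W ^+ mdeg g by rewrite exprn_ge0.
move: (W ^+ mdeg g) => Z Z0 H0 H1 H2 H3 aj.
have WZ : Z <= Z * W by rewrite ler_peMr.
have Zal : 0 <= Z * al by rewrite mulr_ge0.
split.
- by rewrite normrM ler_pM.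
- rewrite (le_trans (ler_normD _ _))// (normrM (taylor1 _ _ _)) (normrM (meval _ _)).
  apply: (@le_trans _ _ (X * Z * al * W + Z * al)).
    by apply: lerD; apply: ler_pM.
  rewrite -subr_ge0 (_ : _ - _ = (Z * W - Z) * al); last by ring.
  by rewrite mulr_ge0// subr_ge0.
- rewrite (le_trans (ler_normD _ _))// (normrM (taylor2 _ _ _)) (normrM (taylor1 _ _ _)).
  apply: (@le_trans _ _ (X ^+ 2 * Z * al ^+ 2 * W + X * Z * al * al)).
    by apply: lerD; apply: ler_pM.
  rewrite -subr_ge0 (_ : _ - _ = (X * (Z * W - Z) + (X + 1) * (Z * W)) * al ^+ 2); last by ring.
  by apply: mulr_ge0; [apply: addr_ge0; apply: mulr_ge0;
      rewrite ?subr_ge0 ?addr_ge0 ?mulr_ge0|exact: exprn_ge0].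
rewrite (le_trans (ler_normD _ _))// (normrM (taylor_rem _ _ _)) (normrM (taylor2 _ _ _)).
apply: (@le_trans _ _ (X ^+ 3 * Z * al ^+ 3 * W + X ^+ 2 * Z * al ^+ 2 * al)).
  by apply: lerD; apply: ler_pM.
rewrite -subr_ge0 (_ : _ - _ = (X ^+ 2 * (Z * W - Z) +
   (X ^+ 2 * 2 + X * 3 + 1) * (Z * W)) * al ^+ 3); last by ring.
apply: mulr_ge0; last exact: exprn_ge0.
by apply: addr_ge0; apply: mulr_ge0; rewrite ?subr_ge0 ?exprn_ge0 ?addr_ge0 ?mulr_ge0 ?exprn_ge0.
Qed.

(* The polynomial factor is absorbed by [n ^ j <= j! e ^ n]. *)
Lemma pow_le_fact (W : R) j n : 0 <= W ->
  n%:R ^+ j * W ^+ n <= n`!%:R * (j`!%:R * expR (expR 1 * W)).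
Proof.
move=> W0.
have nj : (n%:R : R) ^+ j <= j`!%:R * expR 1 ^+ n.
  by rewrite -expRM_natr mul1r; exact: exprn_fact_le_expR.
apply: (@le_trans _ _ (j`!%:R * expR 1 ^+ n * W ^+ n)).
  by rewrite ler_wpM2r ?exprn_ge0.
rewrite -mulrA -exprMn mulrCA ler_wpM2l//.
by apply: exprn_fact_le_expR; rewrite mulr_ge0 ?expR_ge0.
Qed.

Lemma taylor_rem_le_fact v a (V al : R) g : 1 <= V ->
  (forall i, `|v i| <= V) -> (forall i, `|a i| <= al) -> 0 <= al ->
  `|taylor_rem v a (mpolyX R g)| <= (mdeg g)`!%:R * (6 * expR (expR 1 * (V + al)) * al ^+ 3).
Proof.
move=> V1 vV aal al0; have [_ _ _] := taylor_bounds g V1 vV aal al0.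
move=> /le_trans; apply; rewrite mulrA ler_wpM2r ?exprn_ge0//.
by apply: (@pow_le_fact _ 3); lra.
Qed.

Lemma taylor2_le_fact v a (V al : R) g : 1 <= V ->
  (forall i, `|v i| <= V) -> (forall i, `|a i| <= al) -> 0 <= al ->
  `|taylor2 v a (mpolyX R g)| <= (mdeg g)`!%:R * (2 * expR (expR 1 * (V + al)) * al ^+ 2).
Proof.
move=> V1 vV aal al0; have [_ _ + _] := taylor_bounds g V1 vV aal al0.
move=> /le_trans; apply; rewrite mulrA ler_wpM2r ?exprn_ge0//.
by apply: (@pow_le_fact _ 2); lra.
Qed.

(** Links the multi-index form of the recursion to the derivatives in [taylor1] and [taylor2]. *)
Lemma generator_mderiv m (pb : 'cV[mpoly d R]_d) (ps : 'M[mpoly d R]_(d, m)) e g :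
  generator pb ps (extend_linear e) g =
  \sum_i extend_linear e (mderiv i (mpolyX R g) * pb i ord0) +
  2^-1 * \sum_i \sum_l extend_linear e (mderiv l (mderiv i (mpolyX R g)) * (ps *m ps^T) i l).
Proof.
rewrite /generator; congr (_ + _ * _).
  rewrite big_mkcond; apply: eq_bigr => i _; rewrite mderivX -scalerAl linearZ /=.
  by case: posnP => // ->; rewrite mul0r.
rewrite exchange_big; apply: eq_bigr => i _; rewrite exchange_big; apply: eq_bigr => l _.
rewrite -mulr_sumr -linear_sum -mulr_sumr /=.
have -> : \sum_j ps i j * ps l j = (ps *m ps^T) i l.
  by rewrite mxE; apply: eq_bigr => j _; rewrite mxE.
rewrite mderivX mderivZ mderivX scalerA -[in RHS]scalerAl [RHS]linearZ /= mnmBE mnm1E.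
congr (_ * _); have [->|_] := eqVneq i l; last by rewrite subr0 subn0.
by case: (g l) => [|k]; rewrite ?mul0r// natrB.
Qed.

End Taylor.

(** * Gaussian integrals and independence *)

Section NormalIntegrals.
Variable R : realType.
Local Notation leb := (@lebesgue_measure R).

Lemma ge0_integral_normal_prob (m s : R) (f : R -> \bar R) :
  measurable_fun setT f -> (forall x, 0%E <= f x)%E ->
  (\int[normal_prob m s]_x f x = \int[leb]_x (f x * (normal_pdf m s x)%:E))%E.
Proof.
move=> mf f0; have dom := normal_prob_dominates m s.
rewrite -(Radon_Nikodym_SigmaFinite.change_of_variables dom f0 measurableT mf).
have mpdf : measurable_fun setT (fun x => (normal_pdf m s x)%:E).
  by apply/measurable_EFinP; exact: measurable_normal_pdf.
have fint := Radon_Nikodym_SigmaFinite.f_integrable dom.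
apply: ge0_ae_eq_integral => //.
- by apply: emeasurable_funM => //; exact: measurable_int fint.
- by apply: emeasurable_funM.
- by move=> x _; rewrite mule_ge0// Radon_Nikodym_SigmaFinite.f_ge0.
- by move=> x _; rewrite mule_ge0// lee_fin normal_pdf_ge0.
apply: ae_eqe_mul2l; apply: integral_ae_eq => // E _ mE.
by rewrite -Radon_Nikodym_SigmaFinite.f_integral.
Qed.

(** Completing the square produces the Gaussian density of mean [t]. *)
Lemma normal_mgf (t : R) :
  (\int[normal_prob 0 1]_y (expR (t * y))%:E = (expR (t ^+ 2 / 2))%:E)%E.
Proof.
rewrite ge0_integral_normal_prob; last 2 first.
- apply/measurable_EFinP; apply: measurableT_comp => //; exact: measurable_funM.
- by move=> x; rewrite lee_fin expR_ge0.
transitivity (\int[leb]_y ((expR (t ^+ 2 / 2))%:E * (normal_pdf t 1 y)%:E))%E.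
  apply: eq_integral => y _; rewrite -!EFinM; congr EFin.
  rewrite !normal_pdfE ?oner_neq0// /normal_fun.
  rewrite mulrCA [RHS]mulrCA; congr (_ * _); rewrite -!expRD; congr expR.
  by rewrite expr1n -[1 *+ 2]/(1 + 1); field.
rewrite ge0_integralZl//.
- by rewrite integral_normal_pdf mule1.
- by apply/measurable_EFinP; exact: measurable_normal_pdf.
- by move=> x _; rewrite lee_fin normal_pdf_ge0.

Qed.

(** Half of the Gaussian exponent remains, which is the density of variance 2 up to a constant; only
    the finiteness of this constant matters later. *)
Lemma normal_expR_sqr : exists2 c : R, 0 <= c &
  (\int[normal_prob 0 1]_y (expR (y ^+ 2 / 4))%:E = c%:E :> \bar R)%E.
Proof.
have s0 : Num.sqrt 2 != 0 :> R by rewrite gt_eqF// sqrtr_gt0.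
exists (normal_peak 1 / normal_peak (Num.sqrt 2)).
  by rewrite divr_ge0 ?normal_peak_ge0.
rewrite ge0_integral_normal_prob; last 2 first.
- apply/measurable_EFinP; apply: measurableT_comp => //; apply: measurable_funM => //.
- by move=> x; rewrite lee_fin expR_ge0.
transitivity (\int[leb]_y ((normal_peak 1 / normal_peak (Num.sqrt 2))%:E *
    (normal_pdf 0 (Num.sqrt 2) y)%:E))%E.
  apply: eq_integral => y _; rewrite -!EFinM; congr EFin.
  rewrite !normal_pdfE ?oner_neq0// /normal_fun.
  rewrite [in RHS]mulrA divfK ?gt_eqF ?normal_peak_gt0// mulrCA; congr (_ * _).
  rewrite -expRD; congr expR; rewrite sqr_sqrtr// expr1n.
  by rewrite -[1 *+ 2]/(1 + 1) -[2 *+ 2]/(2 + 2); field.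
rewrite ge0_integralZl//.
- by rewrite integral_normal_pdf mule1.
- by apply/measurable_EFinP; exact: measurable_normal_pdf.
- by move=> x _; rewrite lee_fin normal_pdf_ge0.
- by rewrite lee_fin divr_ge0 ?normal_peak_ge0.

Qed.

End NormalIntegrals.

Section IndependentPair.
Context (R : realType) (disp : measure_display) (Omega : measurableType disp)
  (P : probability Omega R) (d2 : measure_display) (T2 : measurableType d2).
Variables (G : set (set Omega)) (Z : Omega -> T2) (N : probability T2 R).
Hypothesis Gm : G `<=` measurable.
Hypothesis GI : setI_closed G.
Hypothesis GT : G setT.
Hypothesis mZ : measurable_fun setT Z.
Hypothesis lawZ : forall B, measurable B -> P (Z @^-1` B) = N B.
Hypothesis indepZ : forall A B, G A -> measurable B ->
  P (A `&` Z @^-1` B) = (P A * P (Z @^-1` B))%E.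

Local Notation OG := (g_sigma_algebraType G).

Lemma sub_gen_measurable : <<s G >> `<=` @measurable _ Omega.
Proof. by apply: smallest_sub => //; exact: sigma_algebra_measurable. Qed.

Lemma measurable_fun_gen d' (T' : measurableType d') (f : OG -> T') :
  measurable_fun setT f -> measurable_fun setT (f : Omega -> T').
Proof. by move=> mf _ B mB; apply: sub_gen_measurable; exact: mf. Qed.

(** For fixed [B] both sides are finite measures in [A] that agree on the pi-system [G]. *)
Lemma indep_gen A B : <<s G >> A -> measurable B ->
  P (A `&` Z @^-1` B) = (P A * N B)%E.
Proof.
move=> GA mB; have mZB : measurable (Z @^-1` B) by rewrite -[X in measurable X]setTI; exact: mZ.
have PB0 : 0 <= fine (P (Z @^-1` B)) by rewrite fine_ge0.
pose m1 : {measure set Omega -> \bar R} := mrestr P mZB.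
pose m2 : {measure set Omega -> \bar R} := mscale (NngNum PB0) P.
suff : m1 A = m2 A.
  rewrite /m1 /m2 /= /mrestr /mscale /= => ->.
  by rewrite fineK ?fin_num_measure// lawZ// muleC.
apply: (@g_sigma_algebra_measure_unique _ _ _ G Gm (fun=> setT)) => //.
- by rewrite bigcup_const//; exists 0%N.
- move=> B' GB'; rewrite /m1 /m2 /= /mrestr /mscale /=.
  by rewrite fineK ?fin_num_measure// indepZ// muleC.
- by move=> _; rewrite /m1 /= /mrestr; apply: (le_lt_trans (probability_le1 _ _)) => //;
    [exact: measurableI|exact: ltry].
Qed.

(** The past can be frozen while integrating over [Z]: the identity, viewed as a map into [Omega]
    with the smaller sigma-algebra, and [Z] have a product law, so Tonelli applies. *)
Lemma integral_indep (f : OG * T2 -> \bar R) :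
  measurable_fun setT f -> (forall x, 0%E <= f x)%E ->
  (\int[P]_w f (w, Z w) = \int[P]_w \int[N]_y f (w, y))%E.
Proof.
move=> mf f0.
have mid : measurable_fun setT (id : Omega -> OG).
  by move=> _ B mB; rewrite setTI preimage_id; exact: sub_gen_measurable.
have mphi : measurable_fun setT (fun w => (w, Z w) : OG * T2) by exact: measurable_fun_pair.
pose idm : {mfun Omega >-> OG} := HB.pack (id : Omega -> OG)
  (isMeasurableFun.Build _ _ _ _ _ mid).
pose phim : {mfun Omega >-> (OG * T2)%type} := HB.pack (fun w => (w, Z w) : OG * T2)
  (isMeasurableFun.Build _ _ _ _ _ mphi).
pose P1 : probability OG R := distribution P idm.
pose P2 : probability (OG * T2)%type R := distribution P phim.
transitivity (\int[P2]_x f x)%E.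
  by rewrite ge0_integral_pushforward//; apply: eq_integral.
transitivity (\int[P1 \x N]_x f x)%E.
  apply: eq_measure_integral => A mA _; apply/esym/product_measure_unique => //.
  move=> A1 B mA1 mB; transitivity (P (A1 `&` Z @^-1` B)).
    by congr (P _); apply/seteqP; split => x.
  by rewrite indep_gen.
rewrite fubini_tonelli1// ge0_integral_pushforward//=.
- exact: measurable_fun_fubini_tonelli_F.
- by move=> x _; apply: integral_ge0 => y _; exact: f0.
Qed.

End IndependentPair.

(** * Real-valued expectations *)

Section RealExpectation.
Context (R : realType) (disp : measure_display) (Omega : measurableType disp)
  (P : probability Omega R).
Implicit Types f g : Omega -> R.

Definition rint f := P.-integrable setT (EFin \o f).
Definition Er f : R := Rintegral P setT f.

Lemma rint_measurable f : rint f -> measurable_fun setT f.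
Proof. by move=> /integrableP[/measurable_EFinP]. Qed.

Lemma rint_le f g : measurable_fun setT f -> rint g -> (forall w, `|f w| <= g w) -> rint f.
Proof.
move=> mf ig fg; apply: (le_integrable _ _ _ ig) => //; first exact/measurable_EFinP.
by move=> w _; rewrite /= lee_fin (le_trans (fg w))// ler_norm.
Qed.

Lemma rint_cst c : rint (fun=> c).
Proof. exact: finite_measure_integrable_cst. Qed.

Lemma rint_bounded f c : measurable_fun setT f -> (forall w, `|f w| <= c) -> rint f.
Proof. by move=> mf fc; apply: (rint_le mf (rint_cst c)). Qed.

Lemma rint_ge0 f : measurable_fun setT f -> (forall w, 0 <= f w) ->
  (\int[P]_w (f w)%:E < +oo)%E -> rint f.
Proof.
move=> mf f0 foo; apply/integrableP; split; first exact/measurable_EFinP.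
by under eq_integral do rewrite /= ger0_norm//.
Qed.

Lemma ErE f : rint f -> (\int[P]_w (f w)%:E = (Er f)%:E)%E.
Proof. by move=> rf; rewrite /Er /Rintegral fineK// integrable_fin_num. Qed.

Lemma rintD f g : rint f -> rint g -> rint (fun w => f w + g w).
Proof. by move=> rf rg; apply: eq_integrable (integrableD _ rf rg). Qed.

Lemma rintZ c f : rint f -> rint (fun w => c * f w).
Proof. by move=> rf; apply: eq_integrable (integrableZl _ c rf). Qed.

Lemma rintB f g : rint f -> rint g -> rint (fun w => f w - g w).
Proof. by move=> rf rg; apply: eq_integrable (integrableB _ rf rg). Qed.

Lemma rint_sum (I : Type) (s : seq I) (F : I -> Omega -> R) :
  (forall i, rint (F i)) -> rint (fun w => \sum_(i <- s) F i w).
Proof.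
move=> rF; elim: s => [|i s IH].
  by under eq_fun do rewrite big_nil; exact: rint_cst.
by under eq_fun do rewrite big_cons; exact: rintD.
Qed.

Lemma ErD f g : rint f -> rint g -> Er (fun w => f w + g w) = Er f + Er g.
Proof. by move=> rf rg; rewrite /Er RintegralD. Qed.

Lemma ErB f g : rint f -> rint g -> Er (fun w => f w - g w) = Er f - Er g.
Proof. by move=> rf rg; rewrite /Er RintegralB. Qed.

Lemma ErZ c f : rint f -> Er (fun w => c * f w) = c * Er f.
Proof. by move=> rf; rewrite /Er RintegralZl. Qed.

Lemma Er_cst c : Er (fun=> c) = c.
Proof. by rewrite /Er /Rintegral integral_cst//= probability_setT mule1. Qed.

Lemma Er_sum (I : Type) (s : seq I) (F : I -> Omega -> R) :
  (forall i, rint (F i)) -> Er (fun w => \sum_(i <- s) F i w) = \sum_(i <- s) Er (F i).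
Proof.
move=> rF; elim: s => [|i s IH].
  by under eq_fun do rewrite big_nil; rewrite Er_cst big_nil.
under eq_fun do rewrite big_cons; rewrite big_cons ErD ?IH//; exact: rint_sum.
Qed.

Lemma Er_le f g : rint f -> rint g -> (forall w, f w <= g w) -> Er f <= Er g.
Proof. by move=> rf rg fg; apply: le_Rintegral => // w _; exact: fg. Qed.

Lemma Er_ge0 f : (forall w, 0 <= f w) -> 0 <= Er f.
Proof. by move=> f0; apply: Rintegral_ge0. Qed.

Lemma Er_norm_le f g : rint f -> rint g -> (forall w, `|f w| <= g w) -> `|Er f| <= Er g.
Proof.
move=> rf rg fg; rewrite ler_norml; apply/andP; split.
  have -> : - Er g = Er (fun w => -1 * g w) by rewrite ErZ// mulN1r.
  apply: Er_le => //; first exact: rintZ.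
  by move=> w; rewrite mulN1r; have := fg w; rewrite ler_norml => /andP[].
by apply: Er_le => // w; rewrite (le_trans (ler_norm _))// fg.
Qed.

End RealExpectation.

(* Applied to [t |-> E [X e ^ (t y)]], this identifies the first two moments of
   [y] without differentiating under the integral. *)
Lemma cubic_perturbation (R : realType) (a b C : R) :
  (forall t, `|t| <= 1 -> `|t * a + t ^+ 2 * b| <= C * `|t| ^+ 3) -> a = 0 /\ b = 0.
Proof.
move=> H.
have C0 : 0 <= C by have := H 1; rewrite normr1 !expr1n mulr1 => /(_ (lexx _)); apply: le_trans.
have small (x D : R) : 0 <= D -> (forall t, 0 < t -> t <= 1 -> `|x| <= D * t) -> x = 0.
  move=> D0 Hx; apply/eqP; rewrite -normr_le0.
  rewrite leNgt; apply/negP => x0.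
  pose t := Num.min 1 (`|x| / (2 * (D + 1))).
  have D1 : 0 < 2 * (D + 1) by lra.
  have t0 : 0 < t by rewrite lt_min ltr01 divr_gt0.
  have t1 : t <= 1 by rewrite ge_min lexx.
  have := Hx t t0 t1; apply/negP; rewrite -ltNge.
  have tle : t <= `|x| / (2 * (D + 1)) by rewrite /t ge_min lexx orbT.
  apply: le_lt_trans (ler_wpM2l D0 tle) _.
  rewrite mulrCA -[ltRHS]mulr1 ltr_pM2l// ltr_pdivrMr//; lra.
have Hb : b = 0.
  (* Adding the bounds at [t] and [- t] cancels the odd term. *)
  apply: (small _ C) => // t t0 t1.
  have nt : `|t| = t by rewrite ger0_norm// ltW.
  have h1 := H t; have h2 := H (- t); rewrite normrN nt in h1 h2.
  have {}h1 := h1 t1; have {}h2 := h2 t1.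
  have : `|2 * t ^+ 2 * b| <= 2 * (C * t ^+ 3).
    have -> : 2 * t ^+ 2 * b = (t * a + t ^+ 2 * b) + (- t * a + (- t) ^+ 2 * b) by ring.
    by rewrite (le_trans (ler_normD _ _))//; lra.
  rewrite normrM ger0_norm; last by rewrite mulr_ge0// sqr_ge0.
  rewrite (_ : 2 * (C * t ^+ 3) = 2 * t ^+ 2 * (C * t)); last by ring.
  by rewrite ler_pM2l// mulr_gt0// exprn_gt0.
split=> //; apply: (small _ C) => // t t0 t1.
have nt : `|t| = t by rewrite ger0_norm// ltW.
have := H t; rewrite Hb mulr0 addr0 nt normrM nt => /(_ t1).
rewrite (_ : C * t ^+ 3 = t * (C * t * t)); last by ring.
rewrite ler_pM2l// => /le_trans; apply; rewrite ler_piMr//.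
by rewrite mulr_ge0// ltW.
Qed.

(* The standard [done] tries [discriminate] on every hypothesis, which
   head-normalises the integrals occurring in the context. *)
Ltac done_without_discriminate := trivial; hnf; intros; solve
  [do ![solve [trivial | apply: sym_equal; trivial] | contradiction | split]
  | match goal with H : ~ _ |- _ => solve [case H; trivial] end].

(** * Conditional Laplace transform of a Gaussian vector *)

Section GaussianVector.
Ltac done := done_without_discriminate.

Context (R : realType) (disp : measure_display) (Omega : measurableType disp)
  (P : probability Omega R).
Variables (base : set (set Omega)) (m : nat) (z : Omega -> 'cV[R]_m).
Hypothesis base_measurable : base `<=` measurable.
Hypothesis base_setI : setI_closed base.
Hypothesis base_setT : base setT.
Hypothesis rz : random_vector z.
Hypothesis gz : std_gaussian P z.
Hypothesis base_indep : forall E D, base E -> sigma_vector z D ->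
  P (E `&` D) = (P E * P D)%E.

Let zc l w := z w l ord0.
Local Notation OB := (g_sigma_algebraType base).

(** The past enlarged by the coordinates in [J], given by rectangles so as to form a pi-system. *)
Let ext (J : seq 'I_m) : set (set Omega) :=
  [set A | exists E (C : 'I_m -> set R), [/\ base E, (forall l, measurable (C l)) &
     A = E `&` \big[setI/setT]_(l <- J) (zc l @^-1` (C l))]].

Let mpre l (C : set R) : measurable C -> measurable (zc l @^-1` C).
Proof. by move=> mC; rewrite -[X in measurable X]setTI; exact: rz. Qed.

Let ext_measurable J : ext J `<=` measurable.
Proof.
move=> _ [E [C [bE mC ->]]]; apply: measurableI; first exact: base_measurable.
by apply: bigsetI_measurable => l _; exact: mpre.
Qed.

Let ext_setI J : setI_closed (ext J).
Proof.
move=> _ _ [E [C [bE mC ->]]] [E' [C' [bE' mC' ->]]].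
exists (E `&` E'), (fun l => C l `&` C' l); split; first exact: base_setI.
  by move=> l; exact: measurableI.
by rewrite setIACA -big_split.
Qed.

Let ext_base J : base `<=` ext J.
Proof.
move=> E bE; exists E, (fun=> setT); split=> //.
by rewrite big1 ?setIT.
Qed.

Let ext_coord J l (C : set R) : l \in J -> measurable C -> ext J (zc l @^-1` C).
Proof.
move=> lJ mC; exists setT, (fun l' => if l' == l then C else setT); split=> //.
  by move=> l'; case: ifP.
rewrite setTI; apply/seteqP; split=> w.
  move=> Cw; rewrite -bigcap_seq => l' _ /=; case: eqP => // ->; exact: Cw.
by rewrite -bigcap_seq => /(_ l lJ) /=; rewrite eqxx.
Qed.

Let sigma_coord l (C : set R) : measurable C -> sigma_vector z (zc l @^-1` C).
Proof. by move=> mC; apply: sub_sigma_algebra; exists l, C. Qed.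

(** Two independences are chained: the base is first split from the whole vector [z], then the
    coordinate [l] from those in [J]. *)
Let ext_indep J l A (B : set R) : uniq (l :: J) -> ext J A -> measurable B ->
  P (A `&` zc l @^-1` B) = (P A * P (zc l @^-1` B))%E.
Proof.
move=> ulJ [E [C [bE mC ->]]] mB.
have sI A1 A2 : sigma_vector z A1 -> sigma_vector z A2 -> sigma_vector z (A1 `&` A2).
  exact: (@measurableI _ (g_sigma_algebraType _)).
have sJ J' : sigma_vector z (\big[setI/setT]_(l <- J') (zc l @^-1` (C l))).
  elim: J' => [|l' J' IH]; first by rewrite big_nil; exact: (@measurableT _ (g_sigma_algebraType _)).
  by rewrite big_cons; apply: sI => //; exact: sigma_coord.
have [lJ uJ] : l \notin J /\ uniq J by move: ulJ => /= /andP[].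
rewrite -setIA base_indep//; last by apply: sI => //; exact: sigma_coord.
rewrite [in RHS]base_indep// -muleA; congr (_ * _)%E.
have [_ ind] := gz.
pose C' l' := if l' == l then B else C l'.
have mC' l' : measurable (C' l') by rewrite /C'; case: ifP.
have EJ : \big[setI/setT]_(l <- J) (zc l @^-1` (C l)) =
    \big[setI/setT]_(l <- J) (zc l @^-1` (C' l)).
  apply: eq_big_seq => l' l'J; rewrite /C'; case: eqP => // E'.
  by case/negP: lJ; rewrite -E' l'J.
have FC' l' : [set (fun w => z w l' ord0) @^-1` B
    | B in [set B : set R | measurable B]] (zc l' @^-1` (C' l')) by exists (C' l') => //; exact: mC'.
have := ind _ _ ulJ (fun l' _ => FC' l'); rewrite !big_cons {1 3}/C' eqxx.
rewrite EJ setIC => ->; rewrite muleC; congr (_ * _)%E.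
by apply/esym; apply: (ind _ _ uJ (fun l' _ => FC' l')).
Qed.

Let lawz l (B : set R) : measurable B -> P (zc l @^-1` B) = normal_prob 0 1 B.
Proof. by move=> mB; exact: gz.1. Qed.

Let sub_ext J d' (T' : measurableType d') (f : OB -> T') :
  measurable_fun setT f -> measurable_fun setT (f : g_sigma_algebraType (ext J) -> T').
Proof.
move=> mf _ B mB; have := mf measurableT B mB; rewrite !setTI.
by apply: smallest_sub; [exact: smallest_sigma_algebra|move=> E /(@ext_base J); exact: sub_sigma_algebra].
Qed.

(** The coordinates are integrated out one at a time. Integrating over the coordinate [l], with the
    base and the remaining coordinates frozen, multiplies [X] by [expR (th l ^ 2 / 2)], again a
    nonnegative function of the past; hence the induction over all [X]. *)
Lemma gauss_mgf (X : OB -> R) (th : 'I_m -> OB -> R) :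
  measurable_fun setT X -> (forall w, 0 <= X w) ->
  (forall l, measurable_fun setT (th l)) ->
  (\int[P]_w (X w * expR (\sum_l th l w * z w l ord0))%:E =
   \int[P]_w (X w * expR (2^-1 * \sum_l th l w ^+ 2))%:E)%E.
Proof.
move=> mX X0 mth; have := index_enum_uniq 'I_m.
elim: (index_enum 'I_m) X mX X0 => [|l J IH] X mX X0 uJ.
  by apply: eq_integral => w _; rewrite !big_nil mulr0.
have mJ : uniq J by move: uJ => /= /andP[].
have msum : measurable_fun setT (fun w : g_sigma_algebraType (ext J) =>
    \sum_(l <- J) th l w * z w l ord0).
  (* Coordinates outside [J] are not measurable for [ext J]; a zero is put there so that every index
     gives a measurable term. *)
  rewrite (_ : (fun _ => _) = fun w => \sum_(l <- J)
     (if l \in J then th l w * z w l ord0 else 0)); last first.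
    by apply/funext => w; apply: eq_big_seq => l' ->.
  apply: measurable_sum => l'; have [l'J|l'J] := boolP (l' \in J); last exact: measurable_cst.
  apply: measurable_funM; first exact: sub_ext.
  by move=> _ B mB; rewrite setTI; apply: sub_sigma_algebra; exact: ext_coord.
pose f (x : g_sigma_algebraType (ext J) * measurableTypeR R) : \bar R :=
  (X x.1 * expR (\sum_(l <- J) th l x.1 * z x.1 l ord0) * expR (th l x.1 * x.2))%:E.
have mfst (g : g_sigma_algebraType (ext J) -> R) : measurable_fun setT g ->
    measurable_fun setT (fun x : g_sigma_algebraType (ext J) * measurableTypeR R => g x.1).
  by move=> mg; apply: measurableT_comp.
have mf : measurable_fun setT f.
  apply/measurable_EFinP; apply: measurable_funM.
    apply: (mfst (fun w => X w * expR (\sum_(l <- J) th l w * z w l ord0))).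
    apply: measurable_funM; first exact: sub_ext.
    exact: measurableT_comp.
  apply: measurableT_comp => //; apply: measurable_funM => //.
  by apply: (mfst (th l)); exact: sub_ext.
have f0 x : (0 <= f x)%E by rewrite lee_fin !mulr_ge0 ?expR_ge0.
transitivity (\int[P]_w f (w, zc l w))%E.
  by apply: eq_integral => w _; rewrite /f /= big_cons expRD -mulrA [expR _ * expR _]mulrC.
rewrite (@integral_indep R _ _ P _ (measurableTypeR R) (ext J) (zc l) (normal_prob 0 1))//; last 4 first.
- exact: ext_base.
- exact: rz.
- exact: lawz.
- by move=> A B; exact: ext_indep.
transitivity (\int[P]_w ((X w * expR (th l w ^+ 2 / 2))
    * expR (\sum_(l <- J) th l w * z w l ord0))%:E)%E.
  apply: eq_integral => w _; rewrite /f /=.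
  under eq_integral do rewrite EFinM.
  rewrite ge0_integralZl//=; last 2 first.
  - apply/measurable_EFinP; apply: measurableT_comp => //; exact: measurable_funM.
  - by rewrite lee_fin mulr_ge0 ?expR_ge0.
  by rewrite normal_mgf -EFinM mulrAC.
rewrite IH; first last.
- exact: mJ.
- by move=> w; rewrite mulr_ge0 ?expR_ge0.
- apply: measurable_funM => //; apply: measurableT_comp => //.
  by apply: measurable_funM => //; exact: measurable_funX.
apply: eq_integral => w _; rewrite big_cons mulrDr expRD mulrA; congr (X w * expR _ * _)%:E.
by rewrite mulrC.
Qed.

End GaussianVector.

(* [z] is a standard Gaussian vector independent of [base], expressed through
   its conditional Laplace transform. *)
Definition gauss_increment (R : realType) (disp : measure_display)
  (Omega : measurableType disp) (P : probability Omega R) (base : set (set Omega))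
  (m : nat) (z : Omega -> 'cV[R]_m) : Prop :=
  forall (X : g_sigma_algebraType base -> R) (th : 'I_m -> g_sigma_algebraType base -> R),
  measurable_fun setT X -> (forall w, 0 <= X w) ->
  (forall l, measurable_fun setT (th l)) ->
  (\int[P]_w (X w * expR (\sum_l th l w * z w l ord0))%:E =
   \int[P]_w (X w * expR (2^-1 * \sum_l th l w ^+ 2))%:E)%E.

Lemma expR_norm_le (R : realType) (x : R) : expR `|x| <= expR x + expR (- x).
Proof.
by case: (ger0P x) => _; rewrite ?lerDl ?lerDr expR_ge0.
Qed.

Section GaussIncrement.
Ltac done := done_without_discriminate.

Context (R : realType) (disp : measure_display) (Omega : measurableType disp)
  (P : probability Omega R).
Variables (base : set (set Omega)) (m : nat) (z : Omega -> 'cV[R]_m).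
Hypothesis base_measurable : base `<=` measurable.
Hypothesis rz : random_vector z.
Hypothesis incr : gauss_increment P base z.
Local Notation OB := (g_sigma_algebraType base).
Local Notation lin th w := (\sum_l th l w * z w l ord0).
Local Notation var th w := (\sum_l th l w ^+ 2).
Local Notation rint := (rint P).
Local Notation Er := (Er P).
Implicit Types (X f : OB -> R) (th : 'I_m -> OB -> R).

Let toO (f : OB -> R) : measurable_fun setT f -> measurable_fun setT (f : Omega -> R).
Proof. exact: measurable_fun_gen. Qed.

Lemma measurable_lin th : (forall l, measurable_fun setT (th l)) ->
  measurable_fun setT (fun w : Omega => lin th w).
Proof.
move=> mth; apply: measurable_sum => l; apply: measurable_funM; last exact: rz.
exact: toO.
Qed.

Lemma measurable_var th : (forall l, measurable_fun setT (th l)) ->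
  measurable_fun setT (fun w : OB => var th w).
Proof. by move=> mth; apply: measurable_sum => l; apply: measurable_funX. Qed.

Lemma var_ge0 th w : 0 <= var th w.
Proof. by apply: sumr_ge0 => l _; exact: sqr_ge0. Qed.

Section Bounded.
Variables (X : OB -> R) (th : 'I_m -> OB -> R) (c k : R).
Hypothesis mX : measurable_fun setT X.
Hypothesis X0 : forall w, 0 <= X w.
Hypothesis Xc : forall w, X w <= c.
Hypothesis mth : forall l, measurable_fun setT (th l).
Hypothesis thk : forall w, var th w <= k.

Lemma rint_mgf t : rint (fun w => X w * expR (t * lin th w)) /\
  Er (fun w => X w * expR (t * lin th w)) = Er (fun w => X w * expR (t ^+ 2 / 2 * var th w)).
Proof.
have mXv : measurable_fun setT (fun w : OB => X w * expR (t ^+ 2 / 2 * var th w)).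
  apply: measurable_funM => //; apply: measurableT_comp => //.
  by apply: measurable_funM => //; exact: measurable_var.
have E : (\int[P]_w (X w * expR (t * lin th w))%:E =
    \int[P]_w (X w * expR (t ^+ 2 / 2 * var th w))%:E)%E.
  have := incr (th := fun l w => t * th l w) mX X0.
  have H l : measurable_fun setT (fun w : OB => t * th l w) by exact: measurable_funM.
  move=> /(_ H); under eq_integral do under eq_bigr do rewrite -mulrA.
  under eq_integral do rewrite -mulr_sumr.
  move=> ->; apply: eq_integral => w _; congr (X w * expR _)%:E.
  rewrite -[LHS]mulrC mulrAC [RHS]mulrC; under eq_bigr do rewrite exprMn.
  by rewrite -mulr_sumr; ring.
have bd : rint (fun w => X w * expR (t ^+ 2 / 2 * var th w)).
  apply: (@rint_bounded _ _ _ _ _ (c * expR (t ^+ 2 / 2 * k))); first exact: toO.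
  move=> w; rewrite ger0_norm ?mulr_ge0 ?expR_ge0// ler_pM ?expR_ge0//.
  by rewrite ler_expR ler_wpM2l// divr_ge0// sqr_ge0.
split; last by rewrite /Er /Rintegral E.
apply: rint_ge0.
- apply: measurable_funM; first exact: toO.
  apply: measurableT_comp => //; apply: measurable_funM => //; exact: measurable_lin.
- by move=> w; rewrite mulr_ge0 ?expR_ge0.
- by rewrite E (ErE bd) ltry.
Qed.

Lemma rint_exp2 : rint (fun w => X w * (expR (2 * lin th w) + expR (- 2 * lin th w))).
Proof.
have [h1 _] := rint_mgf 2; have [h2 _] := rint_mgf (- 2).
by under eq_fun do rewrite mulrDr; exact: rintD.
Qed.

Let expnorm_le' (y : R) : expR (2 * `|y|) <= expR (2 * y) + expR (- 2 * y).
Proof.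
have := expR_norm_le (2 * y); rewrite normrM ger0_norm// => /le_trans; apply.
by rewrite mulNr.
Qed.

Lemma rint_pow n : rint (fun w => X w * lin th w ^+ n).
Proof.
have r2 := rintZ n`!%:R rint_exp2.
apply: rint_le r2 _.
- apply: measurable_funM; first exact: toO.
  by apply: measurable_funX; exact: measurable_lin.
move=> w; rewrite mulrCA normrM ger0_norm// ler_wpM2l// normrX.
apply: le_trans (exprn_fact_le_expR n (normr_ge0 _)) _; rewrite ler_wpM2l//.
by apply: le_trans (expnorm_le' _); rewrite ler_expR ler_peMl// ler1n.
Qed.

Lemma gauss_linear : Er (fun w => X w * lin th w) = 0 /\
  Er (fun w => X w * lin th w ^+ 2) = Er (fun w => X w * var th w).
Proof.
have c0 : 0 <= c by apply: le_trans (X0 point) (Xc point).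
have k0 : 0 <= k by apply: le_trans (var_ge0 th point) (thk point).
have rX : rint X by apply: (@rint_bounded _ _ _ _ _ c); [exact: toO|move=> w; rewrite ger0_norm].
have rXv : rint (fun w => X w * var th w).
  apply: (@rint_bounded _ _ _ _ _ (c * k)).
    by apply: toO; apply: measurable_funM => //; exact: measurable_var.
  by move=> w; rewrite ger0_norm ?mulr_ge0 ?var_ge0// ler_pM ?var_ge0.
have r1 : rint (fun w => X w * lin th w) by exact: rint_pow 1%N.
have r2 := rint_pow 2.
pose M := Er (fun w => X w * (expR (2 * lin th w) + expR (- 2 * lin th w))).
pose D := c * (k ^+ 2 / 2 + k ^+ 3 * expR k).
(* The two sides of [rint_mgf] are equal, so the difference of their second-order expansions in [t]
   equals the difference of the remainders. The left remainder is cubic with an exponential moment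
   as constant. The right one comes from a bounded exponent of order [t ^ 2], hence is at most cubic
   for [|t| <= 1]. *)
have key t : `|t| <= 1 -> `|t * Er (fun w => X w * lin th w) + t ^+ 2 *
   (2^-1 * (Er (fun w => X w * lin th w ^+ 2) - Er (fun w => X w * var th w)))| <=
   (6 * M + D) * `|t| ^+ 3.
  move=> t1; have [rt Et] := rint_mgf t.
  pose rem1 w := X w * expR (t * lin th w) - (X w +
      (t * (X w * lin th w) + t ^+ 2 / 2 * (X w * lin th w ^+ 2))).
  have rr1 : rint (fun w => X w + (t * (X w * lin th w) + t ^+ 2 / 2 * (X w * lin th w ^+ 2))).
    by apply: rintD => //; apply: rintD; exact: rintZ.
  have E1 : Er rem1 = Er (fun w => X w * expR (t * lin th w)) -
      (Er X + (t * Er (fun w => X w * lin th w) + t ^+ 2 / 2 * Er (fun w => X w * lin th w ^+ 2))).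
    rewrite /rem1 ErB// ErD//; last by apply: rintD; exact: rintZ.
    by rewrite ErD ?ErZ//; exact: rintZ.
  have B1 : `|Er rem1| <= 6 * M * `|t| ^+ 3.
    rewrite (_ : 6 * M * `|t| ^+ 3 = (6 * `|t| ^+ 3) * M); last by ring.
    rewrite -ErZ; last exact: rint_exp2.
    apply: Er_norm_le; [exact: rintB|exact: rintZ rint_exp2|] => w.
    rewrite /rem1 (_ : _ - _ = X w * (expR (t * lin th w) - (1 + t * lin th w + (t * lin th w) ^+ 2 / 2)));
        last by field.
    rewrite normrM ger0_norm// [leRHS]mulrCA ler_wpM2l//.
    apply: le_trans (expR_taylor2 _) _; rewrite normrM exprMn.
    set a := `|lin th w|; set b := `|t|.
    have a0 : 0 <= a by exact: normr_ge0.
    have b0 : 0 <= b by exact: normr_ge0.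
    rewrite [leRHS](_ : _ = b ^+ 3 * (6 * (expR (2 * lin th w) + expR (- 2 * lin th w)))); last by ring.
    rewrite -[leLHS]mulrA; apply: ler_wpM2l; first by rewrite exprn_ge0.
    have := exprn_fact_le_expR 3 a0; rewrite -[3`!%:R]/(6 : R) => h3.
    apply: (@le_trans _ _ (6 * expR a * expR a)).
      apply: ler_pM => //; rewrite ?exprn_ge0 ?expR_ge0//.
      by rewrite ler_expR ler_piMl.
    by rewrite -mulrA -expRD ler_wpM2l// -mulr2n -[_ *+ 2]mulr_natl expnorm_le'.
  pose rem2 w := X w * expR (t ^+ 2 / 2 * var th w) - (X w + t ^+ 2 / 2 * (X w * var th w)).
  have rt2 : rint (fun w => X w * expR (t ^+ 2 / 2 * var th w)).
    apply: (@rint_bounded _ _ _ _ _ (c * expR (t ^+ 2 / 2 * k))).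
      apply: toO; apply: measurable_funM => //; apply: measurableT_comp => //.
      by apply: measurable_funM => //; exact: measurable_var.
    move=> w; rewrite ger0_norm ?mulr_ge0 ?expR_ge0// ler_pM ?expR_ge0//.
    by rewrite ler_expR ler_wpM2l// divr_ge0// sqr_ge0.
  have rr2 : rint (fun w => X w + t ^+ 2 / 2 * (X w * var th w)).
    by apply: rintD => //; exact: rintZ.
  have E2 : Er rem2 = Er (fun w => X w * expR (t ^+ 2 / 2 * var th w)) -
      (Er X + t ^+ 2 / 2 * Er (fun w => X w * var th w)).
    by rewrite /rem2 ErB// ErD ?ErZ//; exact: rintZ.
  have B2 : `|Er rem2| <= D * `|t| ^+ 3.
    rewrite -[D * _](Er_cst P); apply: Er_norm_le; [exact: rintB|exact: rint_cst|] => w.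
    set u := t ^+ 2 / 2 * var th w.
    have u0 : 0 <= u by rewrite mulr_ge0 ?var_ge0 ?divr_ge0 ?sqr_ge0.
    have t2 : t ^+ 2 = `|t| ^+ 2 by rewrite real_normK ?num_real.
    have nt0 := normr_ge0 t.
    have uk : u <= `|t| ^+ 2 * k.
      rewrite /u t2 ler_pM ?var_ge0 ?divr_ge0 ?exprn_ge0//.
      by rewrite ler_pdivrMr// ler_peMr ?exprn_ge0// ler1n.
    have uk' : u <= k by apply: le_trans uk _; rewrite ler_piMl// exprn_ile1.
    rewrite /rem2 (_ : _ - _ = X w * (expR u - (1 + u + u ^+ 2 / 2) + u ^+ 2 / 2)); last first.
      by rewrite /u; field.
    rewrite normrM ger0_norm// /D -mulrA ler_pM//.
    apply: le_trans (ler_normD _ _) _.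
    have := expR_taylor2 u; rewrite (ger0_norm u0) => h.
    have : u ^+ 3 * expR u <= k ^+ 3 * expR k * `|t| ^+ 3.
      apply: (@le_trans _ _ ((`|t| ^+ 2 * k) ^+ 3 * expR k)).
        apply: ler_pM; rewrite ?exprn_ge0 ?expR_ge0 ?ler_expR//.
        by apply: lerXn2r => //; rewrite nnegrE mulr_ge0 ?exprn_ge0.
      rewrite [leLHS](_ : _ = k ^+ 3 * expR k * (`|t| ^+ 3 * `|t| ^+ 3)); last by ring.
      by rewrite ler_wpM2l ?mulr_ge0 ?exprn_ge0 ?expR_ge0// ler_piMr ?exprn_ge0 ?exprn_ile1.
    have : `|u ^+ 2 / 2| <= k ^+ 2 / 2 * `|t| ^+ 3.
      rewrite ger0_norm ?divr_ge0 ?sqr_ge0//.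
      rewrite [leRHS](_ : _ = (k ^+ 2 * `|t| ^+ 3) / 2); last by ring.
      apply: ler_wpM2r; first by rewrite invr_ge0.
      apply: (@le_trans _ _ ((`|t| ^+ 2 * k) ^+ 2)).
        by apply: lerXn2r => //; rewrite nnegrE mulr_ge0 ?exprn_ge0.
      rewrite [leLHS](_ : _ = k ^+ 2 * (`|t| ^+ 3 * `|t|)); last by ring.
      by rewrite ler_wpM2l ?sqr_ge0// ler_piMr ?exprn_ge0.
    by move=> h1 h2; rewrite mulrDl [leRHS]addrC lerD// (le_trans h).
  have -> : t * Er (fun w => X w * lin th w) + t ^+ 2 *
     (2^-1 * (Er (fun w => X w * lin th w ^+ 2) - Er (fun w => X w * var th w))) =
     Er rem2 - Er rem1 by rewrite E1 E2 Et; field.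
  by apply: le_trans (ler_normB _ _) _; rewrite mulrDl addrC lerD.
have [-> h] := cubic_perturbation key; split=> //.
by move/eqP: h; rewrite mulf_eq0 invr_eq0 pnatr_eq0 /= subr_eq0 => /eqP.
Qed.

End Bounded.

Section Signed.
Variables (f : OB -> R) (c : R).
Hypothesis mf : measurable_fun setT f.
Hypothesis fc : forall w, `|f w| <= c.

Let c_ge0 : 0 <= c. Proof. exact: le_trans (normr_ge0 _) (fc point). Qed.

Let shift_measurable : measurable_fun setT (fun w : OB => f w + c).
Proof. exact: measurable_funD. Qed.

Let shift_ge0 w : 0 <= f w + c.
Proof. have := fc w; rewrite ler_norml => /andP[]; lra. Qed.

Let shift_le w : f w + c <= c + c.
Proof. have := fc w; rewrite ler_norml => /andP[]; lra. Qed.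

(** The Laplace transform is available for nonnegative weights only, so [f] is written as
    [(f + c) - c]. *)
Lemma gauss_linear_signed th k : (forall l, measurable_fun setT (th l)) ->
  (forall w, var th w <= k) ->
  [/\ rint (fun w => f w * lin th w), rint (fun w => f w * lin th w ^+ 2),
      Er (fun w => f w * lin th w) = 0 &
      Er (fun w => f w * lin th w ^+ 2) = Er (fun w => f w * var th w)].
Proof.
move=> mth thk.
have mc : measurable_fun setT (fun _ : OB => c) by exact: measurable_cst.
have r1 n := rint_pow shift_measurable shift_ge0 shift_le mth thk n.
have r2 n := rint_pow mc (fun=> c_ge0) (fun=> lexx c) mth thk n.
have [a1 b1] := gauss_linear shift_measurable shift_ge0 shift_le mth thk.
have [a2 b2] := gauss_linear mc (fun=> c_ge0) (fun=> lexx c) mth thk.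
have E (y : Omega -> R) : (fun w => f w * y w) = (fun w => (f w + c) * y w - c * y w).
  by apply/funext => w; ring.
have r1v : rint (fun w => (f w + c) * var th w).
  apply: (@rint_bounded _ _ _ _ _ ((c + c) * k)).
    by apply: toO; apply: measurable_funM => //; exact: measurable_var.
  by move=> w; rewrite ger0_norm ?mulr_ge0 ?var_ge0// ler_pM ?var_ge0.
have r2v : rint (fun w => c * var th w).
  apply: (@rint_bounded _ _ _ _ _ (c * k)).
    by apply: toO; apply: measurable_funM => //; exact: measurable_var.
  by move=> w; rewrite ger0_norm ?mulr_ge0 ?var_ge0// ler_pM ?var_ge0.
rewrite (E (fun w => lin th w)) (E (fun w => lin th w ^+ 2)) (E (fun w => var th w)).
by split; [exact: rintB (r1 1%N) (r2 1%N)|exact: rintB (r1 2) (r2 2)|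
  rewrite ErB ?a1 ?a2 ?subr0//; [exact: r1 1%N|exact: r2 1%N]|rewrite !ErB ?b1 ?b2].
Qed.

(** Polarisation: the case of squares is applied to [th1 + th2], [th1] and [th2]. *)
Lemma gauss_cov th1 th2 k : (forall l, measurable_fun setT (th1 l)) ->
  (forall l, measurable_fun setT (th2 l)) ->
  (forall w, var th1 w <= k) -> (forall w, var th2 w <= k) ->
  rint (fun w => f w * (lin th1 w * lin th2 w)) /\
  Er (fun w => f w * (lin th1 w * lin th2 w)) =
  Er (fun w => f w * \sum_l th1 l w * th2 l w).
Proof.
move=> m1 m2 k1 k2; pose th l w := th1 l w + th2 l w.
have mth l : measurable_fun setT (th l) by exact: measurable_funD.
have thk w : var th w <= 2 * (k + k).
  apply: (@le_trans _ _ (2 * (var th1 w + var th2 w))); last first.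
    by rewrite ler_wpM2l// lerD.
  rewrite -big_split mulr_sumr /=; apply: ler_sum => l _; rewrite /th.
  have := sqr_ge0 (th1 l w - th2 l w); rewrite sqrrB sqrrD; lra.
have [_ r _ e] := gauss_linear_signed mth thk.
have [_ r1 _ e1] := gauss_linear_signed m1 k1.
have [_ r2 _ e2] := gauss_linear_signed m2 k2.
have linE w : lin th w = lin th1 w + lin th2 w.
  by rewrite -big_split; apply: eq_bigr => l _; rewrite /th mulrDl.
have E : (fun w => f w * (lin th1 w * lin th2 w)) =
    (fun w => 2^-1 * (f w * lin th w ^+ 2 - (f w * lin th1 w ^+ 2 + f w * lin th2 w ^+ 2))).
  by apply/funext => w; rewrite linE; field.
have r12 := rintD r1 r2; have r3 := rintB r r12.
rewrite E; split; first exact: rintZ.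
rewrite ErZ// ErB// ErD// e e1 e2.
have rv th' k' : (forall l, measurable_fun setT (th' l)) -> (forall w, var th' w <= k') ->
    rint (fun w => f w * var th' w).
  move=> mth' thk'; apply: (@rint_bounded _ _ _ _ _ (c * k')).
    by apply: toO; apply: measurable_funM => //; exact: measurable_var.
  by move=> w; rewrite normrM ler_pM// ger0_norm ?var_ge0.
have v1 := rv _ _ m1 k1; have v2 := rv _ _ m2 k2; have v := rv _ _ mth thk.
rewrite -ErD// -ErB//; last exact: rintD.
rewrite -ErZ; last by apply: rintB => //; exact: rintD.
congr Er; apply/funext => w.
have -> : var th w = var th1 w + var th2 w + 2 * \sum_l th1 l w * th2 l w.
  rewrite mulr_sumr -!big_split; apply: eq_bigr => l _ /=; rewrite /th; ring.
by field.
Qed.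

End Signed.

(* [e ^ (y ^ 2 / 2)] is the Gaussian mean of [e ^ (y N)], so that the conditional
   Laplace transform applies after exchanging the two integrals. *)
Lemma gauss_expsq_bound (Y : OB -> R) th (k : R) :
  measurable_fun setT Y -> (forall w, 0 <= Y w) ->
  (forall l, measurable_fun setT (th l)) -> 0 < k -> (forall w, var th w <= k) ->
  (\int[P]_w (Y w * expR (lin th w ^+ 2 / (4 * k)))%:E <=
   \int[normal_prob 0 1]_y (expR (y ^+ 2 / 4))%:E * \int[P]_w (Y w)%:E)%E.
Proof.
move=> mY Y0 mth k0 thk.
have s2k : 0 < Num.sqrt (2 * k) by rewrite sqrtr_gt0 mulr_gt0.
have sE : Num.sqrt (2 * k) ^+ 2 = 2 * k by rewrite sqr_sqrtr// mulr_ge0// ltW.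
(* [lin ^ 2 / (4 k)] is half the square of [lin / sqrt (2 k)]. After the Laplace transform the
   exponent is [y ^ 2 var / (4 k) <= y ^ 2 / 4], still integrable against the Gaussian law. *)
pose f (x : Omega * measurableTypeR R) : \bar R :=
  (Y x.1 * expR (lin th x.1 / Num.sqrt (2 * k) * x.2))%:E.
have mfst (g : Omega -> R) : measurable_fun setT g ->
    measurable_fun setT (fun x : Omega * measurableTypeR R => g x.1).
  by move=> mg; apply: measurableT_comp.
have mf : measurable_fun setT f.
  apply/measurable_EFinP; apply: measurable_funM; first by apply: (mfst Y); exact: toO.
  apply: measurableT_comp => //; apply: measurable_funM => //.
  apply: (mfst (fun w => lin th w / Num.sqrt (2 * k))).
  by apply: measurable_funM => //; exact: measurable_lin.
have f0 x : (0 <= f x)%E by rewrite lee_fin mulr_ge0 ?expR_ge0.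
have E1 : (\int[P]_w (Y w * expR (lin th w ^+ 2 / (4 * k)))%:E =
    \int[P]_w \int[normal_prob 0 1]_y f (w, y))%E.
  apply: eq_integral => w _; rewrite /f /=; under eq_integral do rewrite EFinM.
  rewrite ge0_integralZl//=; last 2 first.
  - apply/measurable_EFinP; apply: measurableT_comp => //; exact: measurable_funM.
  - by rewrite lee_fin.
  rewrite normal_mgf -EFinM exprMn exprVn sE; congr (Y w * expR _)%:E.
  by field; rewrite gt_eqF.
rewrite E1 fubini_tonelli//.
have YP0 : (0 <= \int[P]_w (Y w)%:E)%E by apply: integral_ge0 => w _; rewrite lee_fin.
rewrite -ge0_integralZr//=; last first.
  by apply/measurable_EFinP; apply: measurableT_comp => //; apply: measurable_funM.
apply: ge0_le_integral => //.
- by move=> y _; apply: integral_ge0 => w _; exact: f0.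
- exact: measurable_fun_fubini_tonelli_G.
- apply: emeasurable_funM => //.
  by apply/measurable_EFinP; apply: measurableT_comp => //; apply: measurable_funM.
move=> y _; rewrite /f /=.
have mthy l : measurable_fun setT (fun w : OB => y / Num.sqrt (2 * k) * th l w).
  exact: measurable_funM.
have := incr mY Y0 mthy => h.
have -> : (\int[P]_w (Y w * expR (lin th w / Num.sqrt (2 * k) * y))%:E =
    \int[P]_w (Y w * expR (2^-1 * \sum_l (y / Num.sqrt (2 * k) * th l w) ^+ 2))%:E)%E.
  rewrite -h; apply: eq_integral => w _; congr (Y w * expR _)%:E.
  by rewrite mulrAC -mulrA mulrC mulr_sumr; apply: eq_bigr => l _; rewrite mulrA.
rewrite -ge0_integralZl//=; last 2 first.
- by apply/measurable_EFinP; exact: toO.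
- by move=> w _; rewrite lee_fin.
apply: ge0_le_integral => //.
- by move=> w _; rewrite lee_fin mulr_ge0 ?expR_ge0.
- apply/measurable_EFinP; apply: measurable_funM; first exact: toO.
  apply: measurableT_comp => //; apply: measurable_funM => //.
  by apply: toO; exact: measurable_var.
- by apply: emeasurable_funM => //; apply/measurable_EFinP; exact: toO.
move=> w _; rewrite -EFinM lee_fin mulrC ler_wpM2r// ler_expR.
under eq_bigr do rewrite exprMn.
rewrite -mulr_sumr exprMn exprVn sE.
apply: (@le_trans _ _ (2^-1 * (y ^+ 2 / (2 * k) * k))); last first.
  by rewrite le_eqVlt; apply/orP; left; apply/eqP; field; rewrite gt_eqF.
apply: ler_wpM2l; first by rewrite invr_ge0.
by apply: ler_wpM2l => //; rewrite divr_ge0 ?sqr_ge0 ?mulr_ge0 ?ltW.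
Qed.

End GaussIncrement.

(** * Weak consistency of one Euler step *)

Lemma cauchy_schwarz_sum (R : realType) (I : finType) (a b : I -> R) :
  (\sum_i a i * b i) ^+ 2 <= (\sum_i a i ^+ 2) * (\sum_i b i ^+ 2).
Proof.
have : 0 <= \sum_i \sum_j (a i * b j - a j * b i) ^+ 2.
  by apply: sumr_ge0 => i _; apply: sumr_ge0 => j _; exact: sqr_ge0.
have -> : \sum_i \sum_j (a i * b j - a j * b i) ^+ 2 =
    \sum_i \sum_j (a i ^+ 2 * b j ^+ 2) + \sum_i \sum_j (a j ^+ 2 * b i ^+ 2)
    - 2 * \sum_i \sum_j (a i * b i) * (a j * b j).
  rewrite mulr_sumr -big_split -sumrB; apply: eq_bigr => i _ /=.
  rewrite mulr_sumr -big_split -sumrB; apply: eq_bigr => j _ /=; ring.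
rewrite [X in _ + X - _]exchange_big /= -!big_distrlr /= -expr2; lra.
Qed.

(** The sum is at most [d] times its largest term. This separates the components of the noise, which
    may be correlated, into one-dimensional exponentials. *)
Lemma expR_sum_le (R : realType) (d : nat) (t : 'I_d -> R) : (0 < d)%N ->
  expR (\sum_i t i) <= \sum_i expR (d%:R * t i).
Proof.
case: d t => // d t _.
have [i0 _ i0max] := @arg_maxP _ _ _ ord0 predT t isT.
apply: (@le_trans _ _ (expR (d.+1%:R * t i0))).
  rewrite ler_expR mulr_natl -[X in _ *+ X](card_ord d.+1) -sumr_const.
  by apply: ler_sum => i _; exact: i0max.
by rewrite (bigD1 i0)//= lerDl; apply: sumr_ge0 => i _; exact: expR_ge0.
Qed.

(** Convexity between 0 and [x], obtained from the tangent at [s * x] evaluated at these two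
    points. *)
Lemma expR_scale_le (R : realType) (s x : R) : 0 <= s -> s <= 1 ->
  expR (s * x) <= 1 + s * (expR x - 1).
Proof.
move=> s0 s1; have E0 := expR_ge0 (s * x).
have h1 : expR (s * x) * (1 + (1 - s) * x) <= expR x.
  have -> : expR x = expR (s * x) * expR ((1 - s) * x) by rewrite -expRD; congr expR; ring.
  by rewrite ler_wpM2l// expR_ge1Dx.
have h2 : expR (s * x) * (1 - s * x) <= 1.
  rewrite -[leRHS](expRxMexpNx_1 (s * x)).
  by rewrite ler_wpM2l// expR_ge1Dx.
have h3 := ler_wpM2l s0 h1.
have s1' : 0 <= 1 - s by rewrite subr_ge0.
have h4 := ler_wpM2l s1' h2.
rewrite (_ : expR (s * x) = s * (expR (s * x) * (1 + (1 - s) * x))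
   + (1 - s) * (expR (s * x) * (1 - s * x))); last by ring.
lra.
Qed.

Section MevalState.
Context (R : realType) (d : nat) (disp : measure_display) (T : measurableType disp).
Variable v : T -> 'cV[R]_d.
Hypothesis mv : forall i, measurable_fun setT (fun w => v w i ord0).
Local Notation ev p w := (meval (fun i => v w i ord0) p).

Lemma measurable_meval (p : mpoly d R) : measurable_fun setT (fun w => ev p w).
Proof.
under eq_fun do rewrite mevalE.
apply: measurable_sum => g; apply: measurable_funM; first exact: measurable_cst.
by apply: measurable_prod => i _; exact: measurable_funX.
Qed.

Lemma meval_bounded (V : R) (p : mpoly d R) : (forall w i, `|v w i ord0| <= V) ->
  exists c, forall w, `|ev p w| <= c.
Proof.
move=> vV; exists (\sum_(g <- msupp p) `|mcoeff g p| * \prod_i V ^+ g i) => w.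
rewrite mevalE; apply: le_trans (ler_norm_sum _ _ _) _; apply: ler_sum => g _.
rewrite normrM ler_wpM2l// normr_prod; apply: ler_prod => i _.
rewrite normr_ge0 normrX lerXn2r ?nnegrE//.
exact: le_trans (normr_ge0 _) (vV w i).
Qed.

End MevalState.

Section OneStep.
Context (R : realType) (disp : measure_display) (Omega : measurableType disp)
  (P : probability Omega R).
Variables (base : set (set Omega)) (m : nat) (z : Omega -> 'cV[R]_m).
Hypothesis base_measurable : base `<=` measurable.
Hypothesis rz : random_vector z.
Hypothesis incr : gauss_increment P base z.
Local Notation OB := (g_sigma_algebraType base).
Local Notation rint := (rint P).
Local Notation Er := (Er P).
Variables (d : nat) (v : OB -> 'cV[R]_d) (g : OB -> R).
Variables (pb : 'cV[mpoly d R]_d) (ps : 'M[mpoly d R]_(d, m)) (h V B k : R).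
Hypothesis d_gt0 : (0 < d)%N.
Hypothesis mv : forall i, measurable_fun setT (fun w => v w i ord0).
Hypothesis vV : forall w i, `|v w i ord0| <= V.
Hypothesis V1 : 1 <= V.
Hypothesis mg : measurable_fun setT g.
Hypothesis g0 : forall w, 0 <= g w.
Hypothesis g1 : forall w, g w <= 1.
Hypothesis h0 : 0 <= h.
Hypothesis h1 : h <= 1.
Local Notation ev p w := (meval (fun i => v w i ord0) p).
Let bb i w := ev (pb i ord0) w.
Let th i l w := ev (ps i l) w.
Let xi i w := \sum_l th i l w * z w l ord0.
Let inc i w := h * bb i w + Num.sqrt h * xi i w.
Hypothesis bB : forall w i, `|bb i w| <= B.
Hypothesis psk : forall w i, \sum_l th i l w ^+ 2 <= k.

Let s := Num.sqrt h.
Let s0 : 0 <= s. Proof. exact: sqrtr_ge0. Qed.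
Let ss : s ^+ 2 = h. Proof. by rewrite sqr_sqrtr. Qed.
Let s1 : s <= 1. Proof. by rewrite -[leRHS]sqrtr1 ler_wsqrtr. Qed.

Let mev p : measurable_fun setT (fun w : OB => ev p w).
Proof. exact: measurable_meval. Qed.

Let gev_bounded p : exists c, forall w, `|g w * ev p w| <= c.
Proof.
have [c cP] := meval_bounded p vV; exists c => w.
by rewrite normrM (le_trans _ (cP w))// ler_piMl// ger0_norm.
Qed.

Let mgev p : measurable_fun setT (fun w : OB => g w * ev p w).
Proof. exact: measurable_funM. Qed.

Let rgev p : rint (fun w => g w * ev p w).
Proof.
have [c cP] := gev_bounded p.
by apply: (@rint_bounded _ _ _ _ _ c) => //; exact: measurable_fun_gen (mgev p).
Qed.

Let lin_fact p i : rint (fun w => g w * ev p w * xi i w) /\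
  Er (fun w => g w * ev p w * xi i w) = 0.
Proof.
have [c cP] := gev_bounded p.
by have [] := gauss_linear_signed base_measurable rz incr (mgev p) cP
  (fun l => mev (ps i l)) (fun w => psk w i).
Qed.

Let cov_fact p i j : rint (fun w => g w * ev p w * (xi i w * xi j w)) /\
  Er (fun w => g w * ev p w * (xi i w * xi j w)) =
  Er (fun w => g w * ev (p * (ps *m ps^T) i j) w).
Proof.
have [c cP] := gev_bounded p.
have [r ->] := gauss_cov base_measurable rz incr (mgev p) cP
  (fun l => mev (ps i l)) (fun l => mev (ps j l)) (fun w => psk w i) (fun w => psk w j).
split=> //; congr Er; apply/funext => w; rewrite mevalM mulrA mxE raddf_sum /=.
by congr (_ * _); apply: eq_bigr => l _; rewrite mxE mevalM.
Qed.

Definition state_moment (e : multinom d) : R := Er (fun w => g w * ev (mpolyX R e) w).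

Lemma state_momentE p : Er (fun w => g w * ev p w) = extend_linear state_moment p.
Proof.
rewrite /extend_linear; have -> : (fun w => g w * ev p w) =
    (fun w => \sum_(e <- msupp p) mcoeff e p * (g w * ev (mpolyX R e) w)).
  apply/funext => w; rewrite {1}(mpolyE p) raddf_sum mulr_sumr /=.
  by apply: eq_bigr => e _; rewrite mevalZ mulrCA.
rewrite Er_sum; last by move=> e; exact: rintZ.
by apply: eq_bigr => e _; rewrite ErZ.
Qed.

(** In the product of two increments the terms of order [h * sqrt h] pair drift with noise and have
    mean zero, and the noise-noise term has mean [h ps ps^T], the second-order part of the
    generator. Only the drift-drift term, of order [h ^ 2], is foreign to the generator; it is kept
    as [T]. *)
Lemma one_step_mean e :
  let Q w := g w * (ev (mpolyX R e) w
    + taylor1 (fun i => v w i ord0) (fun i => inc i w) (mpolyX R e)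
    + taylor2 (fun i => v w i ord0) (fun i => inc i w) (mpolyX R e)) in
  let T w := g w * taylor2 (fun i => v w i ord0) (fun i => h * bb i w) (mpolyX R e) in
  [/\ rint Q, rint T &
    Er Q = state_moment e + h * generator pb ps (extend_linear state_moment) e + Er T].
Proof.
move=> Q T; set X := mpolyX R e in Q T *.
pose q1 i w := h * (g w * ev (mderiv i X * pb i ord0) w) + s * (g w * ev (mderiv i X) w * xi i w).
pose D i l := mderiv l (mderiv i X).
pose q2 i l w := h ^+ 2 * (g w * ev (D i l * pb i ord0 * pb l ord0) w)
  + (h * s * (g w * ev (D i l * pb i ord0) w * xi l w)
  + (h * s * (g w * ev (D i l * pb l ord0) w * xi i w)
  + h * (g w * ev (D i l) w * (xi i w * xi l w)))).
have TE : T = fun w => 2^-1 * \sum_i \sum_l h ^+ 2 * (g w * ev (D i l * pb i ord0 * pb l ord0) w).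
  apply/funext => w; rewrite /T /taylor2 mulrCA; congr (_ * _).
  rewrite mulr_sumr; apply: eq_bigr => i _; rewrite mulr_sumr; apply: eq_bigr => l _.
  rewrite !mevalM /bb /D; ring.
have QE : Q = fun w => g w * ev X w + (\sum_i q1 i w + 2^-1 * \sum_i \sum_l q2 i l w).
  apply/funext => w; rewrite /Q -addrA mulrDr; congr (_ + _); rewrite mulrDr; congr (_ + _).
    rewrite /taylor1 mulr_sumr; apply: eq_bigr => i _; rewrite /q1 /inc -/s mevalM /bb; ring.
  rewrite /taylor2 mulrCA; congr (_ * _).
  rewrite mulr_sumr; apply: eq_bigr => i _; rewrite mulr_sumr; apply: eq_bigr => l _.
  rewrite /q2 !mevalM /inc /bb -/s /D.
  rewrite (_ : h * (g w * _ * (xi i w * xi l w)) =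
      s ^+ 2 * (g w * ev (mderiv l (mderiv i X)) w * (xi i w * xi l w))); last by rewrite ss.
  ring.
have rq1 i : rint (q1 i) by apply: rintD; apply: rintZ => //; exact: (lin_fact _ i).1.
have rq2 i l : rint (q2 i l).
  by do ![apply: rintD]; apply: rintZ => //;
   [exact: (lin_fact _ l).1|exact: (lin_fact _ i).1|exact: (cov_fact _ i l).1].
have rs1 : rint (fun w => \sum_i q1 i w) by exact: rint_sum.
have rs2 : rint (fun w => \sum_i \sum_l q2 i l w) by do 2 ![apply: rint_sum => ?].
have rT0 : rint (fun w => \sum_i \sum_l h ^+ 2 * (g w * ev (D i l * pb i ord0 * pb l ord0) w)).
  by do 2 ![apply: rint_sum => ?]; exact: rintZ.
have rsum : rint (fun w => \sum_i q1 i w + 2^-1 * \sum_i \sum_l q2 i l w).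
  by apply: rintD => //; exact: rintZ.
split; [by rewrite QE; exact: rintD|by rewrite TE; exact: rintZ|].
rewrite QE TE ErD// -addrA; congr (_ + _).
rewrite ErD//; last exact: rintZ.
rewrite !ErZ// generator_mderiv mulrDr -addrA; congr (_ + _).
  rewrite Er_sum// mulr_sumr; apply: eq_bigr => i _.
  rewrite /q1 ErD; [|exact: rintZ|by apply: rintZ; exact: (lin_fact _ i).1].
  rewrite !ErZ//; last exact: (lin_fact _ i).1.
  by rewrite (lin_fact _ i).2 mulr0 addr0 state_momentE.
rewrite [h * (2^-1 * _)]mulrCA -mulrDr; congr (_ * _).
have rs3 i : rint (fun w => \sum_l q2 i l w) by exact: rint_sum.
have rt i l : rint (fun w => h ^+ 2 * (g w * ev (D i l * pb i ord0 * pb l ord0) w)).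
  exact: rintZ.
have rs4 i : rint (fun w => \sum_l h ^+ 2 * (g w * ev (D i l * pb i ord0 * pb l ord0) w)).
  exact: rint_sum.
rewrite (Er_sum _ rs3) (Er_sum _ rs4) mulr_sumr -big_split; apply: eq_bigr => i _ /=.
rewrite (Er_sum _ (rq2 i)) (Er_sum _ (rt i)) mulr_sumr -big_split; apply: eq_bigr => l _ /=.
have [r1 e1] := lin_fact (D i l * pb i ord0) l.
have [r2 e2] := lin_fact (D i l * pb l ord0) i.
have [r3 e3] := cov_fact (D i l) i l.
have r1' := rintZ (h * s) r1; have r2' := rintZ (h * s) r2; have r3' := rintZ h r3.
have r23 := rintD r2' r3'; have r123 := rintD r1' r23.
by rewrite /q2 (ErD (rt i l) r123) (ErD r1' r23) (ErD r2' r3') !ErZ// e1 e2 e3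
  !mulr0 !add0r addrC !state_momentE.
Qed.

(** In the exponent, [expR 1] comes from absorbing the power of the degree in [pow_le_fact], 1 from
    absorbing [(1 + zeta) ^ 3], and [d] from [expR_sum_le]. In [noise_const], 72 is [3! * 3!] from
    these two absorptions times 2 for the two signs of the noise. *)
Definition noise_rate : R := d%:R * (expR 1 + 1).
Definition noise_const : R :=
  72 * expR (expR 1 + 1) * d%:R * expR (noise_rate ^+ 2 / 2 * k).
Definition step_const : R :=
  expR (expR 1 * V) * noise_const + 2 * expR (expR 1 * (V + 1)) * B.

Hypothesis sB : s * B <= 1.

Let zeta w := \sum_i `|xi i w|.

Let B0 : 0 <= B.
Proof. exact: le_trans (normr_ge0 _) (bB point (Ordinal d_gt0)). Qed.

Let k0 : 0 <= k.
Proof.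
by apply: le_trans (psk point (Ordinal d_gt0)); apply: sumr_ge0 => l _; exact: sqr_ge0.
Qed.

(** A dominating variable is used because [rint_mgf] handles the exponential of a linear form, not
    of its absolute value. *)
Lemma noise_exp_moment : exists Z : Omega -> R,
  [/\ rint Z, Er Z <= 2 * d%:R * expR (noise_rate ^+ 2 / 2 * k) &
      forall w, expR ((expR 1 + 1) * zeta w) <= Z w].
Proof.
exists (fun w => \sum_i (1 * expR (noise_rate * xi i w) + 1 * expR (- noise_rate * xi i w))).
have m1 : measurable_fun setT (fun _ : OB => 1 : R) by exact: measurable_cst.
have F t i := rint_mgf base_measurable rz incr m1 (fun=> ler01) (fun=> lexx 1)
  (fun l => mev (ps i l)) (fun w => psk w i) t.
have rF i : rint (fun w => 1 * expR (noise_rate * xi i w) + 1 * expR (- noise_rate * xi i w)).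
  by apply: rintD; [exact: (F _ i).1|exact: (F _ i).1].
split.
- exact: rint_sum.
- rewrite Er_sum//.
  apply: (@le_trans _ _ (\sum_(i < d) 2 * expR (noise_rate ^+ 2 / 2 * k))); last first.
    by rewrite sumr_const card_ord -[leLHS]mulr_natl mulrCA mulrA.
  apply: ler_sum => i _; rewrite ErD; [|exact: (F _ i).1|exact: (F _ i).1].
  rewrite (F noise_rate i).2 (F (- noise_rate) i).2 sqrrN -mulr2n -[leLHS]mulr_natl ler_wpM2l//.
  rewrite -[leRHS](Er_cst P).
  have mvv : measurable_fun setT (fun w : OB => 1 * expR (noise_rate ^+ 2 / 2 * \sum_l th i l w ^+ 2)).
    apply: measurable_funM => //; apply: measurableT_comp => //.
    by apply: measurable_funM => //; apply: measurable_sum => l; apply: measurable_funX; exact: mev.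
  have bd w : 1 * expR (noise_rate ^+ 2 / 2 * \sum_l th i l w ^+ 2) <= expR (noise_rate ^+ 2 / 2 * k).
    by rewrite mul1r ler_expR ler_wpM2l// divr_ge0 ?sqr_ge0.
  apply: Er_le => //; last exact: rint_cst.
  apply: (@rint_bounded _ _ _ _ _ (expR (noise_rate ^+ 2 / 2 * k))); first exact: measurable_fun_gen mvv.
  by move=> w; rewrite ger0_norm ?bd// mulr_ge0 ?expR_ge0.
move=> w; rewrite /zeta mulr_sumr; apply: le_trans (expR_sum_le _ d_gt0) _.
apply: ler_sum => i _; rewrite !mul1r /noise_rate mulrA.
have := expR_norm_le (d%:R * (expR 1 + 1) * xi i w).
by rewrite normrM ger0_norm ?mulr_ge0 ?addr_ge0 ?expR_ge0// mulNr.
Qed.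

Let inc_le w i : `|inc i w| <= s * (1 + zeta w).
Proof.
apply: le_trans (ler_normD _ _) _; rewrite mulrDr mulr1 !normrM (ger0_norm h0) (ger0_norm s0).
apply: lerD; last first.
  by rewrite ler_wpM2l// /zeta (bigD1 i)//= lerDl sumr_ge0.
rewrite -ss expr2 -mulrA ler_piMr//; apply: le_trans sB; exact: ler_wpM2l.
Qed.

(** By [one_step_mean] the error is the drift-drift term plus a Taylor remainder cubic in an
    increment of size [sqrt h], hence [h * sqrt h]. The degree enters only through the factorial,
    which the weights of the moment norm remove. *)
Lemma one_step_consistency e :
  let W (w : Omega) := g w * meval (fun i => v w i ord0 + inc i w) (mpolyX R e) in
  rint W /\
  `|Er W - state_moment e - h * generator pb ps (extend_linear state_moment) e|
    <= (mdeg e)`!%:R * (h * s * step_const).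
Proof.
move=> W; set X := mpolyX R e in W *.
have [] := one_step_mean e; rewrite -/X.
set Q := (fun w => _); set T := (fun w => _) => rQ rT EQ.
pose Rm (w : Omega) := g w * taylor_rem (fun i => v w i ord0) (fun i => inc i w) X.
have WE : W = fun w => Q w + Rm w.
  by apply/funext => w; rewrite /W /Q /Rm /taylor_rem; ring.
have [Z [rZ EZ Zle]] := noise_exp_moment.
pose cR := (mdeg e)`!%:R * (36 * (h * s) * expR (expR 1 * V) * expR (expR 1 + 1)).
have zeta0 w : 0 <= zeta w by exact: sumr_ge0.
have RmZ w : `|Rm w| <= cR * Z w.
  apply: (@le_trans _ _ `|taylor_rem (fun i => v w i ord0) (fun i => inc i w) X|).
    by rewrite normrM ler_piMl// ger0_norm.
  have z1 : 0 <= 1 + zeta w by rewrite addr_ge0.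
  have al0 : 0 <= s * (1 + zeta w) by rewrite mulr_ge0.
  apply: le_trans (taylor_rem_le_fact e V1 (vV w) (inc_le w) al0) _.
  rewrite /cR -[leRHS]mulrA ler_wpM2l//.
  have a1 : expR (expR 1 * (V + s * (1 + zeta w))) <= expR (expR 1 * V) * expR (expR 1 * (1 + zeta w)).
    by rewrite mulrDr expRD ler_wpM2l ?expR_ge0// ler_expR ler_wpM2l ?expR_ge0// ler_piMl.
  have a2 : (s * (1 + zeta w)) ^+ 3 <= h * s * (6 * expR (1 + zeta w)).
    rewrite exprMn exprSr ss ler_wpM2l ?mulr_ge0//.
    by have := exprn_fact_le_expR 3 z1.
  apply: (@le_trans _ _ (6 * (expR (expR 1 * V) * expR (expR 1 * (1 + zeta w))) *
      (h * s * (6 * expR (1 + zeta w))))).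
    by apply: ler_pM => //; rewrite ?exprn_ge0 ?mulr_ge0 ?expR_ge0// ler_wpM2l.
  rewrite [leLHS](_ : _ = 36 * (h * s) * expR (expR 1 * V) *
     (expR (expR 1 * (1 + zeta w)) * expR (1 + zeta w))); last by ring.
  rewrite -expRD -[leRHS]mulrA; apply: ler_wpM2l; first by rewrite !mulr_ge0 ?expR_ge0.
  rewrite (_ : _ + _ = (expR 1 + 1) + (expR 1 + 1) * zeta w); last by ring.
  by rewrite expRD ler_wpM2l ?expR_ge0.
have mRm : measurable_fun [set: Omega] Rm.
  have mW : measurable_fun [set: Omega] W.
    apply: measurable_funM; first exact: (measurable_fun_gen base_measurable mg).
    under eq_fun do rewrite mevalX.
    apply: measurable_prod => i _; apply: measurable_funX; apply: measurable_funD.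
      exact: (measurable_fun_gen base_measurable (mv i)).
    apply: measurable_funD; apply: measurable_funM => //.
      exact: (measurable_fun_gen base_measurable (mev _)).
    by apply: measurable_lin => // l; exact: mev.
  rewrite (_ : Rm = fun w => W w - Q w); last by apply/funext => w; rewrite WE; ring.
  by apply: measurable_funB => //; exact: rint_measurable rQ.
have rcZ : rint (fun w => cR * Z w) by exact: rintZ.
have rRm : rint Rm by exact: rint_le mRm rcZ RmZ.
have cR0 : 0 <= cR by rewrite /cR !mulr_ge0 ?expR_ge0.
split; first by rewrite WE; exact: rintD.
rewrite WE ErD// EQ (_ : _ - _ - _ = Er T + Er Rm); last by ring.
apply: le_trans (ler_normD _ _) _; rewrite /step_const mulrDr mulrDr addrC; apply: lerD.
  apply: le_trans (Er_norm_le rRm rcZ RmZ) _; rewrite ErZ//.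
  apply: le_trans (ler_wpM2l cR0 EZ) _.
  by rewrite /cR /noise_const le_eqVlt; apply/orP; left; apply/eqP; ring.
have hB1 : h * B <= s by rewrite -ss expr2 -mulrA ler_piMr.
have hB0 : 0 <= h * B by rewrite mulr_ge0.
rewrite -[leRHS](Er_cst P); apply: Er_norm_le => //; first exact: rint_cst.
move=> w; apply: (@le_trans _ _ `|taylor2 (fun i => v w i ord0) (fun i => h * bb i w) X|).
  by rewrite normrM ler_piMl// ger0_norm.
have hb i : `|h * bb i w| <= h * B by rewrite normrM ger0_norm// ler_wpM2l.
apply: le_trans (taylor2_le_fact e V1 (vV w) hb hB0) _; rewrite ler_wpM2l//.
rewrite [leRHS](_ : _ = 2 * expR (expR 1 * (V + 1)) * (h * s * B)); last by ring.
apply: ler_pM; rewrite ?mulr_ge0 ?exprn_ge0 ?expR_ge0//.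
  by rewrite ler_wpM2l// ler_expR ler_wpM2l ?expR_ge0// lerD2l (le_trans hB1).
rewrite expr2 [leRHS]mulrAC; exact: ler_wpM2l.
Qed.

End OneStep.

(** * Propagation of Gaussian exponential moments *)

Section ExpMomentStep.
Ltac done := done_without_discriminate.

Context (R : realType) (disp : measure_display) (Omega : measurableType disp)
  (P : probability Omega R).
Variables (base : set (set Omega)) (m : nat) (z : Omega -> 'cV[R]_m).
Hypothesis base_measurable : base `<=` measurable.
Hypothesis rz : random_vector z.
Hypothesis incr : gauss_increment P base z.
Local Notation OB := (g_sigma_algebraType base).
Variables (d : nat) (X : OB -> R) (x : 'I_d -> OB -> R) (th : 'I_d -> 'I_m -> OB -> R).
Variables (a h K2 cN : R).
Hypothesis d_gt0 : (0 < d)%N.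
Hypothesis mX : measurable_fun setT X.
Hypothesis X0 : forall w, 0 <= X w.
Hypothesis mx : forall i, measurable_fun setT (x i).
Hypothesis mth : forall i l, measurable_fun setT (th i l).
Hypothesis K2_gt0 : 0 < K2.
Hypothesis thK : forall w, \sum_i \sum_l th i l w ^+ 2 <= K2.
Hypothesis a0 : 0 <= a.
Hypothesis a1 : a <= 1.
Hypothesis h0 : 0 <= h.
Hypothesis h_small : 8 * d%:R * K2 * h <= 1.
Hypothesis cN0 : 0 <= cN.
Hypothesis cNE : (\int[normal_prob 0 1]_y (expR (y ^+ 2 / 4))%:E = cN%:E :> \bar R)%E.

Let xi i w := \sum_l th i l w * z w l ord0.
Let n2 w := \sum_i x i w ^+ 2.
Let s := Num.sqrt h.
Let ss : s ^+ 2 = h. Proof. by rewrite sqr_sqrtr. Qed.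
Let q l w := \sum_i x i w * th i l w.
Let Th w := \sum_l q l w ^+ 2.

Let mq l : measurable_fun setT (q l).
Proof. by apply: measurable_sum => i; exact: measurable_funM. Qed.

Let mn2 : measurable_fun setT (n2 : OB -> R).
Proof. by apply: measurable_sum => i; exact: measurable_funX. Qed.

Let mTh : measurable_fun setT (Th : OB -> R).
Proof. by apply: measurable_sum => l; exact: measurable_funX. Qed.

Let mxi i : measurable_fun [set: Omega] (xi i).
Proof. exact: measurable_lin. Qed.

Let qE w : \sum_l q l w * z w l ord0 = \sum_i x i w * xi i w.
Proof.
under eq_bigr do rewrite mulr_suml.
rewrite exchange_big; apply: eq_bigr => i _ /=; rewrite mulr_sumr.
by apply: eq_bigr => l _; rewrite mulrA.
Qed.

Let n2_ge0 w : 0 <= n2 w.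
Proof. by apply: sumr_ge0 => i _; exact: sqr_ge0. Qed.

Let Th_le w : Th w <= K2 * n2 w.
Proof.
apply: (@le_trans _ _ (\sum_l n2 w * \sum_i th i l w ^+ 2)).
  by apply: ler_sum => l _; exact: cauchy_schwarz_sum.
by rewrite -mulr_sumr exchange_big mulrC ler_wpM2r.
Qed.

Let row_le i w : \sum_l th i l w ^+ 2 <= K2.
Proof.
apply: le_trans (thK w); rewrite (bigD1 i)//= lerDl.
by apply: sumr_ge0 => ? _; apply: sumr_ge0 => ? _; exact: sqr_ge0.
Qed.

Let sc := 8 * d%:R * K2 * h.
Let sc0 : 0 <= sc.
Proof. by rewrite /sc !mulr_ge0// ltW. Qed.

Let Y w := X w * expR (a * n2 w + 4 * a ^+ 2 * h * Th w).

Let mY : measurable_fun setT (Y : OB -> R).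
Proof.
apply: measurable_funM => //; apply: measurableT_comp => //.
by apply: measurable_funD; exact: measurable_funM.
Qed.

Let Y0 w : 0 <= Y w. Proof. by rewrite mulr_ge0 ?expR_ge0. Qed.

(* Young's inequality splits the cross term off the squared noise; the
   compensator [4 a ^ 2 h Th] is chosen so that [U] and [Y] have the same mean. *)
Let U w := X w * expR (a * n2 w - 4 * a ^+ 2 * h * Th w)
  * expR (\sum_l (4 * a * s * q l w) * z w l ord0).

Let young w : X w * expR (a * \sum_i (x i w + s * xi i w) ^+ 2) <=
  2^-1 * (U w + Y w * expR (2 * a * h * \sum_i xi i w ^+ 2)).
Proof.
have E1 : \sum_l (4 * a * s * q l w) * z w l ord0 = 4 * a * s * \sum_i x i w * xi i w.
  by rewrite -qE mulr_sumr; apply: eq_bigr => l _; rewrite mulrA.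
have E2 : \sum_i (x i w + s * xi i w) ^+ 2 =
    n2 w + 2 * s * (\sum_i x i w * xi i w) + h * \sum_i xi i w ^+ 2.
  rewrite !mulr_sumr -!big_split; apply: eq_bigr => i _ /=; rewrite -ss; ring.
set p := \sum_i x i w * xi i w in E1 E2; set r := \sum_i xi i w ^+ 2 in E2 *.
pose A := expR (2^-1 * (a * n2 w - 4 * a ^+ 2 * h * Th w + 4 * a * s * p)).
pose B := expR (2^-1 * (a * n2 w + 4 * a ^+ 2 * h * Th w + 2 * a * h * r)).
have -> : U w = X w * A ^+ 2.
  by rewrite /U E1 -mulrA -expRD -expRM_natl; congr (_ * expR _); field.
have -> : Y w * expR (2 * a * h * r) = X w * B ^+ 2.
  by rewrite /Y -mulrA -expRD -expRM_natl; congr (_ * expR _); field.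
have -> : expR (a * \sum_i (x i w + s * xi i w) ^+ 2) = A * B.
  by rewrite E2 -expRD; congr expR; field.
rewrite -mulrDr [leRHS]mulrCA; apply: ler_wpM2l => //.
have := sqr_ge0 (A - B); rewrite sqrrB; lra.
Qed.

Let mU : measurable_fun [set: Omega] U.
Proof.
apply: measurable_funM.
  have mu : measurable_fun setT (fun w : OB => X w * expR (a * n2 w - 4 * a ^+ 2 * h * Th w)).
    apply: measurable_funM => //; apply: measurableT_comp => //.
    by apply: measurable_funB; exact: measurable_funM.
  exact: (measurable_fun_gen base_measurable mu).
have mq' l : measurable_fun setT (fun w : OB => 4 * a * s * q l w).
  by apply: measurable_funM => //; exact: mq.
by apply: measurableT_comp => //; exact: (measurable_lin base_measurable rz mq').
Qed.

Let intU : (\int[P]_w (U w)%:E = \int[P]_w (Y w)%:E)%E.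
Proof.
have mu : measurable_fun setT (fun w : OB => X w * expR (a * n2 w - 4 * a ^+ 2 * h * Th w)).
  apply: measurable_funM => //; apply: measurableT_comp => //.
  by apply: measurable_funB; exact: measurable_funM.
have mq' l : measurable_fun setT (fun w : OB => 4 * a * s * q l w).
  by apply: measurable_funM => //; exact: mq.
rewrite (incr mu _ mq'); last by move=> w; rewrite mulr_ge0 ?expR_ge0.
apply: eq_integral => w _; rewrite -mulrA -expRD; congr (X w * expR _)%:E.
under eq_bigr do rewrite exprMn.
by rewrite -mulr_sumr -/(Th w) exprMn exprMn ss; field.
Qed.

(** The exponent is at most [sc] times [r / (4 d K2)], a scale at which the quadratic exponential is
    integrable after splitting over coordinates. As [sc <= 1], convexity pulls [sc] out of the
    exponential, and the loss is linear in [h]. *)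
Let square_bound w : Y w * expR (2 * a * h * \sum_i xi i w ^+ 2) <=
  Y w + sc * \sum_i Y w * expR (xi i w ^+ 2 / (4 * K2)).
Proof.
rewrite -mulr_sumr [leRHS](_ : _ = Y w * (1 + sc * \sum_i expR (xi i w ^+ 2 / (4 * K2)))); last by ring.
apply: ler_wpM2l => //.
set r := \sum_i xi i w ^+ 2.
have r0 : 0 <= r by apply: sumr_ge0 => i _; exact: sqr_ge0.
have d0 : (d%:R : R) != 0 by rewrite pnatr_eq0 -lt0n.
have K20 : K2 != 0 by rewrite gt_eqF.
have E : 2 * h * r = sc * (r / (4 * d%:R * K2)).
  by rewrite /sc; field; rewrite d0 K20.
apply: (@le_trans _ _ (expR (sc * (r / (4 * d%:R * K2))))).
  rewrite -E ler_expR ler_wpM2r// ler_wpM2r// -[leRHS]mulr1 ler_wpM2l//.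
apply: le_trans (expR_scale_le _ sc0 h_small) _.
rewrite lerD2l ler_wpM2l// (le_trans (_ : _ <= expR (r / (4 * d%:R * K2))))//.
  by rewrite gerBl.
rewrite /r mulr_suml; apply: le_trans (expR_sum_le _ d_gt0) _.
apply: ler_sum => i _; rewrite ler_expR le_eqVlt; apply/orP; left; apply/eqP.
by field; rewrite d0 K20.
Qed.

Let YE : measurable_fun [set: Omega] (fun w => (Y w)%:E).
Proof. by apply/measurable_EFinP; exact: (measurable_fun_gen base_measurable mY). Qed.

Let mYexp (f : Omega -> R) : measurable_fun setT f ->
  measurable_fun [set: Omega] (fun w => (Y w * expR (f w))%:E).
Proof.
move=> mf; apply/measurable_EFinP; apply: measurable_funM.
  exact: (measurable_fun_gen base_measurable mY).
exact: measurableT_comp.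
Qed.

Let intV : (\int[P]_w (Y w * expR (2 * a * h * \sum_i xi i w ^+ 2))%:E <=
  (1 + sc * (d%:R * cN))%:E * \int[P]_w (Y w)%:E)%E.
Proof.
have I0 : (0 <= \int[P]_w (Y w)%:E)%E by apply: integral_ge0 => w _; rewrite lee_fin.
have mF i : measurable_fun [set: Omega] (fun w => (Y w * expR (xi i w ^+ 2 / (4 * K2)))%:E).
  by apply: mYexp; apply: measurable_funM => //; exact: measurable_funX.
have F0 i w : (0 <= (Y w * expR (xi i w ^+ 2 / (4 * K2)))%:E)%E.
  by rewrite lee_fin mulr_ge0 ?expR_ge0.
apply: (@le_trans _ _ (\int[P]_w ((Y w)%:E +
    sc%:E * \sum_(i < d) (Y w * expR (xi i w ^+ 2 / (4 * K2)))%:E))%E).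
  apply: ge0_le_integral => //.
  - by move=> w _; rewrite lee_fin mulr_ge0 ?expR_ge0.
  - apply: mYexp; apply: measurable_funM => //; apply: measurable_sum => i.
    exact: measurable_funX.
  - apply: emeasurable_funD => //; apply: emeasurable_funM => //.
    exact: emeasurable_sum.
  by move=> w _; rewrite sumEFin -EFinM -EFinD lee_fin.
have S0 w : (0 <= \sum_(i < d) (Y w * expR (xi i w ^+ 2 / (4 * K2)))%:E)%E by exact: sume_ge0.
have mS : measurable_fun [set: Omega] (fun w => \sum_(i < d) (Y w * expR (xi i w ^+ 2 / (4 * K2)))%:E)%E.
  exact: emeasurable_sum.
rewrite ge0_integralD//; last 3 first.
- by move=> w _; rewrite lee_fin.
- by move=> w _; rewrite mule_ge0// lee_fin.
- exact: emeasurable_funM.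
rewrite ge0_integralZl//.
rewrite ge0_integral_sum//.
have K2' : 0 <= K2 by exact: ltW.
rewrite EFinD ge0_muleDl ?lee_fin ?mulr_ge0//.
rewrite mul1e leeD2l// [(sc * _)%:E]EFinM -muleA; apply: lee_wpmul2l; first by rewrite lee_fin.
apply: (@le_trans _ _ (\sum_(i < d) (cN%:E * \int[P]_w (Y w)%:E))%E).
  apply: lee_sum => i _; rewrite -cNE.
  exact: (gauss_expsq_bound base_measurable rz incr mY Y0 (mth i) K2_gt0 (row_le i)).
by rewrite -ge0_sume_distrl//  sumEFin sumr_const card_ord mulr_natl.
Qed.

(** Of the two halves of [young], the first has mean exactly [E Y] and the second costs a factor
    [1 + O(h)]. The compensator in [Y] is absorbed by enlarging the exponent, as [Th <= K2 * n2] and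
    [a ^ 2 <= a]. *)
Lemma exp_moment_step :
  (\int[P]_w (X w * expR (a * \sum_i (x i w + Num.sqrt h * xi i w) ^+ 2))%:E <=
   (1 + 4 * (d ^ 2)%:R * K2 * cN * h)%:E *
   \int[P]_w (X w * expR (a * (1 + 4 * K2 * h) * \sum_i x i w ^+ 2))%:E)%E.
Proof.
rewrite -/s.
have U0 w : 0 <= U w by rewrite !mulr_ge0 ?expR_ge0.
have V0 w : 0 <= Y w * expR (2 * a * h * \sum_i xi i w ^+ 2) by rewrite !mulr_ge0 ?expR_ge0.
have mxi2 : measurable_fun [set: Omega] (fun w => \sum_i xi i w ^+ 2).
  by apply: measurable_sum => i; exact: measurable_funX.
have mV : measurable_fun [set: Omega] (fun w => (Y w * expR (2 * a * h * \sum_i xi i w ^+ 2))%:E).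
  by apply: mYexp; exact: measurable_funM.
have mUE : measurable_fun [set: Omega] (fun w => (U w)%:E) by exact/measurable_EFinP.
have I0 : (0 <= \int[P]_w (Y w)%:E)%E by apply: integral_ge0 => w _; rewrite lee_fin.
apply: (@le_trans _ _ (2^-1%:E * (\int[P]_w (Y w)%:E +
    (1 + sc * (d%:R * cN))%:E * \int[P]_w (Y w)%:E))%E).
  apply: (@le_trans _ _ (2^-1%:E * (\int[P]_w (U w)%:E +
     \int[P]_w (Y w * expR (2 * a * h * \sum_i xi i w ^+ 2))%:E))%E).
    rewrite -ge0_integralD//; [|by move=> w _; rewrite lee_fin|by move=> w _; rewrite lee_fin].
    rewrite -ge0_integralZl//; last 2 first.
    - exact: emeasurable_funD.
    - by move=> w _; rewrite adde_ge0 ?lee_fin.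
    apply: ge0_le_integral => //.
    - by move=> w _; rewrite lee_fin mulr_ge0 ?expR_ge0.
    - apply/measurable_EFinP; apply: measurable_funM.
        exact: (measurable_fun_gen base_measurable mX).
      apply: measurableT_comp => //; apply: measurable_funM => //.
      apply: measurable_sum => i; apply: measurable_funX; apply: measurable_funD.
        exact: (measurable_fun_gen base_measurable (mx i)).
      exact: measurable_funM.
    - by apply: emeasurable_funM => //; exact: emeasurable_funD.
    by move=> w _; rewrite -EFinD -EFinM lee_fin; exact: young.
  apply: lee_wpmul2l; first by rewrite lee_fin invr_ge0.
  by apply: leeD; [rewrite intU|exact: intV].
have K2' : 0 <= K2 by exact: ltW.
have -> : (2^-1%:E * (\int[P]_w (Y w)%:E + (1 + sc * (d%:R * cN))%:E * \int[P]_w (Y w)%:E) =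
   (1 + 4 * (d ^ 2)%:R * K2 * cN * h)%:E * \int[P]_w (Y w)%:E)%E.
  rewrite -{1}[(\int[P]_w (Y w)%:E)%E]mul1e -ge0_muleDl ?lee_fin ?addr_ge0 ?mulr_ge0//.
  rewrite muleA -EFinD -EFinM; congr (_%:E * _)%E.
  by rewrite /sc natrX; field.
apply: lee_wpmul2l; first by rewrite lee_fin addr_ge0 ?mulr_ge0.
apply: ge0_le_integral => //.
- by move=> w _; rewrite lee_fin.
- apply/measurable_EFinP; apply: measurable_funM.
    exact: (measurable_fun_gen base_measurable mX).
  apply: measurableT_comp => //; apply: measurable_funM => //.
  exact: (measurable_fun_gen base_measurable mn2).
move=> w _; rewrite lee_fin /Y ler_wpM2l// ler_expR -/(n2 w) mulrDr mulr1 mulrDl lerD2l.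
apply: (@le_trans _ _ (4 * a ^+ 2 * h * (K2 * n2 w))).
  by rewrite ler_wpM2l ?mulr_ge0 ?sqr_ge0.
have p0 : 0 <= 4 * h * K2 * n2 w by rewrite !mulr_ge0// ltW.
have a2 : a ^+ 2 <= a by rewrite expr2 ler_piMl.
have := ler_wpM2r p0 a2; lra.
Qed.

End ExpMomentStep.

(** * The projected scheme *)

Section Cutoff.
Variables (R : realType) (rad : R) (chi : R -> R).
Hypothesis rad_gt0 : 0 < rad.
Hypothesis cut : cutoff rad chi.

Lemma cutoff0 : chi 0 = 0.
Proof. by have [_ _ _ H _] := cut; apply: H; rewrite normr0 divr_ge0// ltW. Qed.

Lemma cutoff_norm_le s : `|chi s| <= `|s|.
Proof. by have [_ _ H _ _] := cut; have := H s 0; rewrite cutoff0 !subr0. Qed.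

Lemma cutoff_le_rad s : `|chi s| <= rad.
Proof.
have [_ _ _ _ H] := cut; have [sr|sr] := leP `|s| rad.
  exact: le_trans (cutoff_norm_le s) sr.
by rewrite H ?normr0 ltW.
Qed.

Lemma cutoff_measurable : measurable_fun setT chi.
Proof.
have [H _ _ _ _] := cut; apply: continuous_measurable_fun => x.
by apply: differentiable_continuous; apply/derivable1_diffP; exact: (H 0%N x).
Qed.

End Cutoff.

Lemma measurable_projected (R : realType) (d m : nat) (chi : R -> R) (h : R)
    (pb : 'cV[mpoly d R]_d) (ps : 'M[mpoly d R]_(d, m))
    (disp : measure_display) (T : measurableType disp) (u : T -> 'cV[R]_d)
    (z : nat -> T -> 'cV[R]_m) (k : nat) :
  measurable_fun setT chi ->
  (forall i, measurable_fun setT (fun w => u w i ord0)) ->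
  (forall j, (j < k)%N -> forall i, measurable_fun setT (fun w => z j w i ord0)) ->
  forall i, measurable_fun setT
    (fun w => projected chi h pb ps (u w) (fun j => z j w) k i ord0).
Proof.
move=> mchi mu; elim: k => [|k IH] mz i /=.
  under eq_fun do rewrite mxE.
  exact: measurableT_comp.
have {}IH := IH (fun j jk => mz j (ltnW jk)).
under eq_fun do rewrite mxE.
apply: measurableT_comp => //.
under eq_fun do rewrite !mxE.
apply: measurable_funD; first apply: measurable_funD => //.
- apply: measurable_funM => //; exact: (measurable_meval IH).
apply: measurable_funM => //; apply: measurable_sum => l.
apply: measurable_funM; last exact: mz.
under eq_fun do rewrite mxE.
exact: (measurable_meval IH).
Qed.

(** * The past of the driving noise *)

Section History.
Context (R : realType) (disp : measure_display) (Omega : measurableType disp)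
  (P : probability Omega R).
Variables (d m : nat) (u0 : Omega -> 'cV[R]_d) (z : nat -> Omega -> 'cV[R]_m).
Hypothesis noise : driving_noise P u0 z.

Let F (o : option nat) := if o is Some k then sigma_vector (z k) else sigma_vector u0.

(** A pi-system of rectangles generating the sigma-algebra of [u0] and the first [k] noises; on
    rectangles, independence of [z k] can be read off from [indep_sigma]. *)
Definition history (k : nat) : set (set Omega) :=
  [set E | exists A : option nat -> set Omega, (forall o, F o (A o)) /\
     E = \big[setI/setT]_(o <- None :: [seq Some i | i <- iota 0 k]) A o].

Let FI o A B : F o A -> F o B -> F o (A `&` B).
Proof. by case: o => [j|] FA FB; exact: (@measurableI _ (g_sigma_algebraType _)). Qed.

Let FT o : F o setT.
Proof. by case: o => [j|]; exact: (@measurableT _ (g_sigma_algebraType _)). Qed.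

Let sigma_vector_measurable q (X : Omega -> 'cV[R]_q) : random_vector X ->
  sigma_vector X `<=` measurable.
Proof.
move=> rX; apply: smallest_sub; first exact: sigma_algebra_measurable.
by move=> _ [i [B [mB ->]]]; rewrite -[X in measurable X]setTI; exact: rX.
Qed.

Let Fm o A : F o A -> measurable A.
Proof.
have [ru rz _ _] := noise.
by case: o => [j|]; apply: sigma_vector_measurable.
Qed.

Lemma history_measurable k : history k `<=` measurable.
Proof. by move=> _ [A [FA ->]]; apply: bigsetI_measurable => o _; exact: Fm (FA o). Qed.

Lemma history_setI k : setI_closed (history k).
Proof.
move=> _ _ [A [FA ->]] [B [FB ->]]; exists (fun o => A o `&` B o); split.
  by move=> o; exact: FI.
by rewrite big_split.
Qed.

Lemma history_setT k : history k setT.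
Proof. by exists (fun=> setT); split=> //; rewrite big1. Qed.

Lemma history_indep k E D : history k E -> sigma_vector (z k) D ->
  P (E `&` D) = (P E * P D)%E.
Proof.
have [_ _ _ ind] := noise.
move=> [A [FA ->]] sD; set J := None :: _.
have uJ : uniq (Some k :: J).
  rewrite /J /= !inE /= mem_map; last by move=> ? ? [].
  rewrite mem_iota add0n ltnn /= map_inj_uniq ?iota_uniq ?andbT; last by move=> ? ? [].
  by apply/mapP => -[].
pose A' o := if o == Some k then D else A o.
have FA' o : F o (A' o) by rewrite /A'; case: eqP => [->|_].
have EJ : \big[setI/setT]_(o <- J) A o = \big[setI/setT]_(o <- J) A' o.
  apply: eq_big_seq => o oJ; rewrite /A'; case: eqP => // oE.
  by move: uJ; rewrite cons_uniq -oE oJ.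
have uJ' : uniq J by move: uJ; rewrite cons_uniq => /andP[].
have := ind _ A' uJ (fun o _ => FA' o).
rewrite big_cons [RHS in _ = RHS -> _]big_cons.
rewrite {1 3}/A' eqxx -(ind _ A' uJ' (fun o _ => FA' o)) -EJ setIC => ->.
by rewrite muleC.
Qed.

Lemma history_increment k : gauss_increment P (history k) (z k).
Proof.
have [_ rz gz _] := noise; move=> X th mX X0 mth.
exact: (gauss_mgf (@history_measurable k) (@history_setI k) (history_setT k)
  (rz k) (gz k) (@history_indep k)).
Qed.

Let history_elt k o A : o \in None :: [seq Some i | i <- iota 0 k] -> F o A -> history k A.
Proof.
move=> oJ FA; exists (fun o' => if o' == o then A else setT); split.
  by move=> o'; case: eqP => [->|_].
apply/seteqP; split=> w.
  by move=> Aw; rewrite -bigcap_seq => o' _ /=; case: eqP.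
by rewrite -bigcap_seq => /(_ o oJ) /=; rewrite eqxx.
Qed.

Lemma history_init k i :
  measurable_fun setT (fun w : g_sigma_algebraType (history k) => u0 w i ord0).
Proof.
move=> _ B mB; rewrite setTI; apply: sub_sigma_algebra.
apply: (history_elt (o := None)); first by rewrite inE eqxx.
by apply: sub_sigma_algebra; exists i, B.
Qed.

Lemma history_noise k j i : (j < k)%N ->
  measurable_fun setT (fun w : g_sigma_algebraType (history k) => z j w i ord0).
Proof.
move=> jk _ B mB; rewrite setTI; apply: sub_sigma_algebra.
apply: (history_elt (o := Some j)).
  by rewrite inE /= mem_map ?mem_iota// => ? ? [].
by apply: sub_sigma_algebra; exists i, B.
Qed.

End History.

(** * Exponential moments and local errors along the scheme *)

Section Rates.
Variables (R : realType) (K : R).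
(** From [|v + h b|^2 <= (1 + h) |v|^2 + 2 h |b|^2] and [|b|^2 <= 2 K^2 (|v|^2 + 1)], the square
    norm grows at rate at most [rate1]. [rate2] and [rate3] also include the factor [1 + 4 K^2 h]
    lost in [exp_moment_step], terms in [h ^ 2] being bounded by [h]. *)
Definition rate1 : R := 1 + 4 * K ^+ 2.
Definition rate2 : R := 4 * K ^+ 2 + rate1 + 4 * K ^+ 2 * rate1.
Definition rate3 : R := (1 + 4 * K ^+ 2) * rate1.

Lemma rate1_ge0 : 0 <= rate1.
Proof. by rewrite addr_ge0// mulr_ge0// sqr_ge0. Qed.

Lemma rate2_ge0 : 0 <= rate2.
Proof.
have r1 := rate1_ge0; have k := sqr_ge0 K; have k4 : 0 <= 4 * K ^+ 2 by rewrite mulr_ge0.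
by apply: addr_ge0; [exact: addr_ge0|exact: mulr_ge0].
Qed.

Lemma rate3_ge0 : 0 <= rate3.
Proof. by apply: mulr_ge0; [exact: rate1_ge0|exact: rate1_ge0]. Qed.

Lemma drift_growth (d : nat) (v b : 'I_d -> R) (h N : R) : 0 <= h -> h <= 1 ->
  \sum_i b i ^+ 2 <= (K * (N + 1)) ^+ 2 -> N ^+ 2 = \sum_i v i ^+ 2 ->
  (1 + 4 * K ^+ 2 * h) * \sum_i (v i + h * b i) ^+ 2 <=
  (1 + rate2 * h) * \sum_i v i ^+ 2 + rate3 * h.
Proof.
move=> h0 h1 bN NE; have K20 : 0 <= K ^+ 2 by exact: sqr_ge0.
have v0 : 0 <= \sum_i v i ^+ 2 by apply: sumr_ge0 => i _; exact: sqr_ge0.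
have b0 : 0 <= \sum_i b i ^+ 2 by apply: sumr_ge0 => i _; exact: sqr_ge0.
have hh : h ^+ 2 <= h by rewrite expr2 ler_piMl.
have s1 : \sum_i (v i + h * b i) ^+ 2 <=
    (1 + h) * \sum_i v i ^+ 2 + 2 * h * \sum_i b i ^+ 2.
  rewrite !mulr_sumr -big_split; apply: ler_sum => i _ /=.
  have e1 : 0 <= h * (v i - b i) ^+ 2 by rewrite mulr_ge0// sqr_ge0.
  have e2 : 0 <= (h - h ^+ 2) * b i ^+ 2 by rewrite mulr_ge0 ?sqr_ge0 ?subr_ge0.
  nra.
have s2 : \sum_i b i ^+ 2 <= 2 * K ^+ 2 * (\sum_i v i ^+ 2 + 1).
  apply: (le_trans bN); rewrite exprMn -NE.
  rewrite [leRHS](_ : _ = K ^+ 2 * (2 * (N ^+ 2 + 1))); last by ring.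
  apply: ler_wpM2l => //.
  have := sqr_ge0 (N - 1); rewrite sqrrB sqrrD; lra.
move: (\sum_i v i ^+ 2) (\sum_i b i ^+ 2) (\sum_i (v i + h * b i) ^+ 2) v0 b0 s1 s2 => n2 b2 x2 n0 b0 s1 s2.
rewrite /rate3 /rate2 /rate1; move: (K ^+ 2) K20 s2 => q q0 s2.
have s3 : x2 <= (1 + (1 + 4 * q) * h) * n2 + (1 + 4 * q) * h.
  have h2 : 0 <= 2 * h by rewrite mulr_ge0.
  have := ler_wpM2l h2 s2; lra.
have p0 : 0 <= 1 + 4 * q * h by rewrite addr_ge0 ?mulr_ge0.
apply: (le_trans (ler_wpM2l p0 s3)).
have hq : 0 <= 4 * q * (1 + 4 * q) * (h - h ^+ 2).
  by rewrite mulr_ge0 ?subr_ge0// mulr_ge0 ?addr_ge0 ?mulr_ge0.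
have hqn : 0 <= 4 * q * (1 + 4 * q) * (h - h ^+ 2) * n2 by rewrite mulr_ge0.
rewrite -subr_ge0.
rewrite (_ : _ - _ = 4 * q * (1 + 4 * q) * (h - h ^+ 2) * n2 +
  4 * q * (1 + 4 * q) * (h - h ^+ 2)); last by ring.
by rewrite addr_ge0.
Qed.

End Rates.

Lemma max_coordinate (R : realType) (d : nat) (x : 'I_d -> R) : (0 < d)%N ->
  exists i0, forall i, `|x i| <= `|x i0|.
Proof.
case: d x => // d x _.
have [i0 _ H] := @arg_maxP _ _ _ ord0 predT (fun i => `|x i|) isT.
by exists i0 => i; exact: H.
Qed.

Lemma monomial_norm_le (R : realType) (d : nat) (x : 'I_d -> R) (N : R) (g : multinom d) :
  (forall i, `|x i| <= N) -> `|meval x (mpolyX R g)| <= N ^+ mdeg g.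
Proof.
move=> xN; rewrite mevalX mdegE -prodrXr normr_prod; apply: ler_prod => i _.
rewrite normr_ge0 normrX lerXn2r ?nnegrE//.
exact: le_trans (normr_ge0 _) (xN i).
Qed.

Section Trajectory.
Context (R : realType) (disp : measure_display) (Omega : measurableType disp)
  (P : probability Omega R).
Variables (d m : nat) (u0 : Omega -> 'cV[R]_d) (z : nat -> Omega -> 'cV[R]_m).
Hypothesis noise : driving_noise P u0 z.
Variables (chi : R -> R) (h rad r K cN : R).
Variables (pb : 'cV[mpoly d R]_d) (ps : 'M[mpoly d R]_(d, m)).
Hypothesis d_gt0 : (0 < d)%N.
Hypothesis rad_ge1 : 1 <= rad.
Hypothesis r_gt0 : 0 < r.
Hypothesis r_le : r <= rad / 3.
Hypothesis cut : cutoff rad chi.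
Hypothesis h0 : 0 <= h.
Hypothesis h1 : h <= 1.
Hypothesis K_gt0 : 0 < K.
Hypothesis pbK : forall x, cube rad x -> frob (evalmx pb x) <= K * (frob x + 1).
Hypothesis psK : forall x, cube rad x -> frob (evalmx ps x) <= K.
Hypothesis h_small : 8 * d%:R * K ^+ 2 * h <= 1.
Hypothesis cN0 : 0 <= cN.
Hypothesis cNE : (\int[normal_prob 0 1]_y (expR (y ^+ 2 / 4))%:E = cN%:E :> \bar R)%E.

Local Notation rint := (rint P).
Local Notation Er := (Er P).
Let rad_gt0 : 0 < rad. Proof. exact: lt_le_trans rad_ge1. Qed.

Definition state k w := projected chi h pb ps (u0 w) (fun i => z i w) k.
Definition prestate k w : 'cV[R]_d := state k w + h *: evalmx pb (state k w)
  + Num.sqrt h *: (evalmx ps (state k w) *m z k w).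
(* The moments are compared on the event where [u0] lies in a cube of side
   proportional to [rad]: there the exponential moments of the scheme start from
   at most [e ^ (d r ^ 2)]. *)
Definition small_init w : R := \prod_i \1_(`[- r, r]%classic) (u0 w i ord0).
Local Notation g := small_init.

Lemma stateS k w : state k.+1 w = map_mx chi (prestate k w).
Proof. by []. Qed.

Lemma state_bound k w i : `|state k w i ord0| <= rad.
Proof. by case: k => [|k]; rewrite /state /= mxE; exact: cutoff_le_rad. Qed.

Lemma state_measurable k i :
  measurable_fun setT (fun w : g_sigma_algebraType (history u0 z k) => state k w i ord0).
Proof.
apply: measurable_projected; first exact: cutoff_measurable cut.
  by move=> {}i; exact: history_init.
by move=> j jk l; exact: history_noise.
Qed.

Lemma small_init_cases w :
  (g w = 1 /\ forall i, `|u0 w i ord0| <= r) \/ (g w = 0 /\ exists i, r < `|u0 w i ord0|).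
Proof.
rewrite /g; case: (pselect (forall i, `|u0 w i ord0| <= r)) => H.
  left; split=> //; rewrite big1// => i _; rewrite indicE mem_set//=.
  by have := H i; rewrite ler_norml in_itv.
right; move/existsNP: H => [i /negP]; rewrite -ltNge => ri; split; last by exists i.
apply/eqP; rewrite prodf_seq_eq0; apply/hasP; exists i; rewrite ?mem_index_enum//=.
rewrite indicE memNset//= in_itv /= -ler_norml; apply/negP; by rewrite -ltNge.
Qed.

Lemma small_init_ge0 w : 0 <= g w.
Proof. by case: (small_init_cases w) => -[->]. Qed.

Lemma small_init_le1 w : g w <= 1.
Proof. by case: (small_init_cases w) => -[->]. Qed.

Lemma small_init_measurable k :
  measurable_fun setT (fun w : g_sigma_algebraType (history u0 z k) => g w).
Proof.
apply: measurable_prod => i _; apply: measurableT_comp; last exact: history_init.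
exact: measurable_indic.
Qed.

Let Hm k := history_measurable noise (k := k).
Let incr k : gauss_increment P (history u0 z k) (z k).
Proof. exact: history_increment. Qed.
Let rz k : random_vector (z k). Proof. by have [_ rz _ _] := noise. Qed.

Lemma state_cube k w : cube rad (state k w).
Proof. by move=> i; exact: state_bound. Qed.

Let prestateE k w i : prestate k w i ord0 = state k w i ord0 +
  (h * meval (fun i => state k w i ord0) (pb i ord0) +
   Num.sqrt h * \sum_l meval (fun i => state k w i ord0) (ps i l) * z k w l ord0).
Proof.
rewrite !mxE addrA; congr (_ + _ + _ * _).
by apply: eq_bigr => l _; rewrite !mxE.
Qed.

Let thK k w : \sum_i \sum_l meval (fun i => state k w i ord0) (ps i l) ^+ 2 <= K ^+ 2.
Proof.
have K0 := ltW K_gt0.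
have := psK (state_cube k w); rewrite -(@ler_pXn2r _ 2)// ?nnegrE ?frob_ge0//.
rewrite frob_sqr; apply: le_trans.
by rewrite le_eqVlt; apply/orP; left; apply/eqP; apply: eq_bigr => i _;
   apply: eq_bigr => l _; rewrite mxE.
Qed.

Let bK k w : \sum_i meval (fun i => state k w i ord0) (pb i ord0) ^+ 2 <=
  (K * (frob (state k w) + 1)) ^+ 2.
Proof.
have K0 := ltW K_gt0; have F0 := frob_ge0 (state k w).
have := pbK (state_cube k w); rewrite -(@ler_pXn2r _ 2)// ?nnegrE ?frob_ge0 ?mulr_ge0 ?addr_ge0//.
rewrite frob_sqr; apply: le_trans.
by rewrite le_eqVlt; apply/orP; left; apply/eqP; apply: eq_bigr => i _;
   rewrite big_ord1 mxE.
Qed.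

Let frobE k w : frob (state k w) ^+ 2 = \sum_i state k w i ord0 ^+ 2.
Proof. by rewrite frob_sqr; apply: eq_bigr => i _; rewrite big_ord1. Qed.

Definition exp_rate : R := 4 * (d ^ 2)%:R * K ^+ 2 * cN + rate3 K.

Let e1 : 0 < 1 + rate2 K * h.
Proof. by rewrite ltr_wpDr ?mulr_ge0 ?rate2_ge0. Qed.

(* The exponent shrinks at each step by the growth factor of the scheme; over
   [n] steps with [n h = T] it stays above [e ^ (- rate2 K T)]. *)
Definition decay k : R := ((1 + rate2 K * h) ^+ k)^-1.

Let decay_ge0 k : 0 <= decay k.
Proof. by rewrite invr_ge0 exprn_ge0// ltW. Qed.

Let decay_le1 k : decay k <= 1.
Proof. by rewrite invf_le1 ?exprn_gt0// exprn_ege1// lerDl mulr_ge0 ?rate2_ge0. Qed.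

Let decayS k : decay k.+1 * (1 + rate2 K * h) = decay k.
Proof. by rewrite /decay exprSr invfM mulfVK// gt_eqF. Qed.

Let mgO : measurable_fun [set: Omega] g.
Proof. exact: (measurable_fun_gen (@Hm 0%N) (@small_init_measurable 0%N)). Qed.

Let mstO k i : measurable_fun [set: Omega] (fun w => state k w i ord0).
Proof. exact: (measurable_fun_gen (@Hm k) (@state_measurable k i)). Qed.

Let mev k p : measurable_fun setT (fun w : g_sigma_algebraType (history u0 z k) =>
  meval (fun i => state k w i ord0) p).
Proof. by apply: measurable_meval => i; exact: state_measurable. Qed.

Let mpre k i : measurable_fun [set: Omega] (fun w => prestate k w i ord0).
Proof.
under eq_fun do rewrite prestateE.
apply: measurable_funD => //; apply: measurable_funD; apply: measurable_funM => //.
  exact: (measurable_fun_gen (@Hm k) (mev _)).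
exact: (measurable_lin (@Hm k) (@rz k) (fun l => mev (ps i l))).
Qed.

Let m_exp (x : 'I_d -> Omega -> R) a : (forall i, measurable_fun setT (x i)) ->
  measurable_fun [set: Omega] (fun w => (g w * expR (a * \sum_i x i w ^+ 2))%:E).
Proof.
move=> mx; apply/measurable_EFinP; apply: measurable_funM => //.
apply: measurableT_comp => //; apply: measurable_funM => //.
by apply: measurable_sum => i; exact: measurable_funX.
Qed.

Let gexp0 a w : 0 <= g w * expR a.
Proof. by rewrite mulr_ge0 ?small_init_ge0 ?expR_ge0. Qed.

(** [decay k.+1] times the growth factor of one step is [decay k], so the loss in the exponent is
    paid exactly; what remains is a factor [1 + O(h)] and a constant of order [h] in the
    exponent. *)
Lemma prestate_exp_moment_step k :
  (\int[P]_w (g w * expR (decay k.+1 * \sum_i prestate k w i ord0 ^+ 2))%:E <=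
   (expR (exp_rate * h))%:E *
   \int[P]_w (g w * expR (decay k * \sum_i state k w i ord0 ^+ 2))%:E)%E.
Proof.
pose bb i w := meval (fun i => state k w i ord0) (pb i ord0).
have K2 : 0 < K ^+ 2 by rewrite exprn_gt0.
have mx i : measurable_fun setT (fun w : g_sigma_algebraType (history u0 z k) =>
    state k w i ord0 + h * bb i w).
  by apply: measurable_funD; [exact: state_measurable|apply: measurable_funM => //; exact: mev].
have := exp_moment_step (@Hm k) (@rz k) (@incr k) d_gt0 (@small_init_measurable k)
  small_init_ge0 mx (fun i l => mev (ps i l)) K2 (thK k) (decay_ge0 k.+1)
  (decay_le1 k.+1) h0 h_small cN0 cNE.
under eq_integral do under eq_bigr do rewrite -addrA -prestateE.
move=> /le_trans; apply.
apply: (@le_trans _ _ ((1 + 4 * (d ^ 2)%:R * K ^+ 2 * cN * h)%:E *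
   ((expR (rate3 K * h))%:E * \int[P]_w (g w * expR (decay k * \sum_i state k w i ord0 ^+ 2))%:E))%E).
  have c0 : 0 <= 1 + 4 * (d ^ 2)%:R * K ^+ 2 * cN * h.
    by rewrite addr_ge0 ?mulr_ge0// ltW.
  apply: lee_wpmul2l; first by rewrite lee_fin.
  rewrite -ge0_integralZl//; last 2 first.
  - exact: m_exp.
  - by move=> w _; rewrite lee_fin.
  apply: ge0_le_integral => //.
  - by move=> w _; rewrite lee_fin.
  - apply: m_exp => i; exact: (measurable_fun_gen (@Hm k) (mx i)).
  - by apply: emeasurable_funM => //; exact: m_exp.
  move=> w _; rewrite -EFinM lee_fin [leRHS]mulrCA ler_wpM2l ?small_init_ge0// -expRD ler_expR.
  rewrite -mulrA; have := drift_growth h0 h1 (bK k w) (frobE k w).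
  move/(ler_wpM2l (decay_ge0 k.+1)) => /le_trans; apply.
  rewrite mulrDr mulrA decayS addrC lerD2r ler_piMl// mulr_ge0 ?rate3_ge0//.
rewrite muleA -EFinM; apply: lee_wpmul2r.
  by apply: integral_ge0 => w _; rewrite lee_fin.
rewrite lee_fin [exp_rate * h]mulrDl expRD ler_wpM2r ?expR_ge0// expR_ge1Dx//.
Qed.

Lemma state_exp_moment k :
  (\int[P]_w (g w * expR (decay k * \sum_i state k w i ord0 ^+ 2))%:E <=
   (expR (exp_rate * (k%:R * h)) * expR (d%:R * r ^+ 2))%:E)%E.
Proof.
elim: k => [|k IH].
  rewrite mul0r mulr0 expR0 mul1r -[leRHS]mule1 -(probability_setT P) -integral_cst//.
  apply: ge0_le_integral => //.
  - by move=> w _; rewrite lee_fin.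
  - exact: m_exp.
  move=> w _; rewrite lee_fin /decay expr0 invr1 mul1r.
  case: (small_init_cases w) => -[-> H]; last by rewrite mul0r expR_ge0.
  rewrite mul1r ler_expR mulr_natl -[X in _ *+ X](card_ord d) -sumr_const.
  apply: ler_sum => i _; rewrite -real_normK ?num_real// lerXn2r ?nnegrE ?(ltW r_gt0)//.
  by rewrite /state /= mxE (le_trans (cutoff_norm_le rad_gt0 cut _)).
apply: (@le_trans _ _ (\int[P]_w (g w * expR (decay k.+1 * \sum_i prestate k w i ord0 ^+ 2))%:E)%E).
  apply: ge0_le_integral => //.
  - by move=> w _; rewrite lee_fin.
  - exact: m_exp.
  - exact: m_exp.
  move=> w _; rewrite lee_fin ler_wpM2l ?small_init_ge0// ler_expR ler_wpM2l//.
  apply: ler_sum => i _; rewrite stateS mxE.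
  by rewrite -real_normK ?num_real// -[leRHS]real_normK ?num_real// lerXn2r ?nnegrE//
      (cutoff_norm_le rad_gt0 cut).
apply: (le_trans (prestate_exp_moment_step k)).
apply: (le_trans (lee_wpmul2l _ IH)); first by rewrite lee_fin expR_ge0.
rewrite -EFinM lee_fin.
have -> : exp_rate * (k.+1%:R * h) = exp_rate * h + exp_rate * (k%:R * h).
  by rewrite -natr1; ring.
by rewrite [expR (_ + _)]expRD -[leRHS]mulrA.
Qed.

Lemma prestate_exp_moment k a : 0 <= a -> a <= decay k.+1 ->
  (\int[P]_w (g w * expR (a * \sum_i prestate k w i ord0 ^+ 2))%:E <=
   (expR (exp_rate * (k.+1%:R * h)) * expR (d%:R * r ^+ 2))%:E)%E.
Proof.
move=> a0 ak.
apply: (@le_trans _ _ (\int[P]_w (g w * expR (decay k.+1 * \sum_i prestate k w i ord0 ^+ 2))%:E)%E).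
  apply: ge0_le_integral => //.
  - by move=> w _; rewrite lee_fin.
  - exact: m_exp.
  - exact: m_exp.
  move=> w _; rewrite lee_fin ler_wpM2l ?small_init_ge0// ler_expR ler_wpM2r//.
  by apply: sumr_ge0 => i _; exact: sqr_ge0.
apply: (le_trans (prestate_exp_moment_step k)).
apply: (le_trans (lee_wpmul2l _ (state_exp_moment k))); first by rewrite lee_fin expR_ge0.
rewrite -EFinM lee_fin.
have -> : exp_rate * (k.+1%:R * h) = exp_rate * h + exp_rate * (k%:R * h).
  by rewrite -natr1; ring.
by rewrite [expR (_ + _)]expRD -[leRHS]mulrA.
Qed.

Definition mom k e := Er (fun w => g w * meval (fun i => state k w i ord0) (mpolyX R e)).

(** Nothing changes unless the largest coordinate [N] is at least [rad / 3]. Both monomials are then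
    at most [N ^ |e| <= |e|! e ^ N], and [N <= a N^2 / 2 + 1 / (2 a)]. Of the available [a N^2] a
    half is left over, which is at least [a rad^2 / 18]. *)
Let proj_pointwise k w e a : 0 < a ->
  `|g w * meval (fun i => state k.+1 w i ord0) (mpolyX R e)
    - g w * meval (fun i => prestate k w i ord0) (mpolyX R e)| <=
  (mdeg e)`!%:R * (2 * expR ((2 * a)^-1) * expR (- (a * rad ^+ 2 / 18)))
    * (g w * expR (a * \sum_i prestate k w i ord0 ^+ 2)).
Proof.
move=> a0; have c0 : 0 <= (mdeg e)`!%:R * (2 * expR ((2 * a)^-1) * expR (- (a * rad ^+ 2 / 18))).
  by rewrite !mulr_ge0 ?expR_ge0.
rewrite -mulrBr normrM ger0_norm ?small_init_ge0// [leRHS]mulrCA ler_wpM2l ?small_init_ge0//.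
case: (pselect (forall i, `|prestate k w i ord0| <= rad / 3)) => H.
  rewrite (_ : meval (fun i => state k.+1 w i ord0) _ = meval (fun i => prestate k w i ord0) (mpolyX R e)).
    by rewrite subrr normr0 mulr_ge0 ?expR_ge0.
  apply: meval_eq => i; rewrite stateS mxE; have [_ _ _ -> //] := cut.
move/existsNP: H => [j /negP]; rewrite -ltNge => jr.
have [i0 i0max] := max_coordinate (fun i => prestate k w i ord0) d_gt0.
set N := `|prestate k w i0 ord0| in i0max.
have N0 : 0 <= N by exact: normr_ge0.
have Nr : rad / 3 <= N by exact: le_trans (ltW jr) (i0max j).
have N2 : N ^+ 2 <= \sum_i prestate k w i ord0 ^+ 2.
  by rewrite real_normK ?num_real// (bigD1 i0)//= lerDl sumr_ge0// => i _; exact: sqr_ge0.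
have m1 : `|meval (fun i => state k.+1 w i ord0) (mpolyX R e)| <= N ^+ mdeg e.
  apply: monomial_norm_le => i; rewrite stateS mxE.
  exact: le_trans (cutoff_norm_le rad_gt0 cut _) (i0max i).
have m2 : `|meval (fun i => prestate k w i ord0) (mpolyX R e)| <= N ^+ mdeg e.
  by apply: monomial_norm_le => i; exact: i0max.
apply: (le_trans (ler_normB _ _)); apply: (le_trans (lerD m1 m2)).
rewrite -mulr2n -[leLHS]mulr_natl.
have Nf := exprn_fact_le_expR (mdeg e) N0.
apply: (@le_trans _ _ (2 * ((mdeg e)`!%:R * expR N))); first by rewrite ler_wpM2l.
rewrite [leRHS](_ : _ = 2 * ((mdeg e)`!%:R * (expR ((2 * a)^-1) * expR (- (a * rad ^+ 2 / 18))
  * expR (a * \sum_i prestate k w i ord0 ^+ 2)))); last by ring.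
rewrite ler_wpM2l// ler_wpM2l// -!expRD ler_expR.
have y1 : N <= a * N ^+ 2 / 2 + (2 * a)^-1.
  rewrite -subr_ge0 (_ : _ - _ = (2 * a)^-1 * (a * N - 1) ^+ 2); last by field; rewrite gt_eqF.
  by rewrite mulr_ge0 ?sqr_ge0// invr_ge0 mulr_ge0// ltW.
have y2 : rad ^+ 2 / 9 <= N ^+ 2.
  rewrite (_ : rad ^+ 2 / 9 = (rad / 3) ^+ 2); last by field.
  by rewrite lerXn2r// nnegrE divr_ge0// ltW.
have y3 := ler_wpM2l (ltW a0) y2; have y4 := ler_wpM2l (ltW a0) N2; lra.
Qed.

Hypothesis sB_small : Num.sqrt h * (K * (d%:R * rad + 1)) <= 1.

Let mXst k e : measurable_fun [set: Omega]
  (fun w => g w * meval (fun i => state k w i ord0) (mpolyX R e)).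
Proof.
apply: measurable_funM => //; exact: (measurable_meval (v := fun w => state k w)).
Qed.

Lemma mom_pointwise k e w :
  `|g w * meval (fun i => state k w i ord0) (mpolyX R e)| <= rad ^+ mdeg e.
Proof.
have rad0 := ltW rad_gt0; have H := monomial_norm_le e (state_bound k w).
rewrite normrM ger0_norm ?small_init_ge0//; apply: le_trans H.
by rewrite ler_piMl// small_init_le1.
Qed.

Let rst k e : rint (fun w => g w * meval (fun i => state k w i ord0) (mpolyX R e)).
Proof. exact: rint_bounded (mXst k e) (mom_pointwise k e). Qed.

Lemma mom_le k e : `|mom k e| <= rad ^+ mdeg e.
Proof.
rewrite -(Er_cst P (rad ^+ mdeg e)); apply: Er_norm_le; [exact: rst|exact: rint_cst|].
exact: mom_pointwise.
Qed.

Let frob_state k w : frob (state k w) <= d%:R * rad.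
Proof.
have rad0 := ltW rad_gt0.
rewrite -(@ler_pXn2r _ 2)// ?nnegrE ?frob_ge0 ?mulr_ge0// frobE.
apply: (@le_trans _ _ (\sum_(i < d) rad ^+ 2)).
  apply: ler_sum => i _; rewrite -real_normK ?num_real// lerXn2r ?nnegrE//.
  exact: state_bound.
rewrite sumr_const card_ord -[leLHS]mulr_natl exprMn ler_wpM2r ?sqr_ge0// -natrX ler_nat.
by rewrite leq_pmulr.
Qed.

Let drift_bound k w i : `|meval (fun i => state k w i ord0) (pb i ord0)| <= K * (d%:R * rad + 1).
Proof.
have := entry_le_frob (evalmx pb (state k w)) i ord0; rewrite mxE => /le_trans; apply.
apply: (le_trans (pbK (state_cube k w))).
by rewrite ler_wpM2l ?(ltW K_gt0)// lerD2r.
Qed.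

Let row_bound k w i : \sum_l meval (fun i => state k w i ord0) (ps i l) ^+ 2 <= K ^+ 2.
Proof.
apply: le_trans (thK k w); rewrite (bigD1 i)//= lerDl.
by apply: sumr_ge0 => ? _; apply: sumr_ge0 => ? _; exact: sqr_ge0.
Qed.

Lemma mom_consistency k e a : 0 < a -> a <= decay k.+1 ->
  `|mom k.+1 e - mom k e - h * generator pb ps (extend_linear (mom k)) e| <=
  (mdeg e)`!%:R * (h * Num.sqrt h * step_const d rad (K * (d%:R * rad + 1)) (K ^+ 2) +
    2 * expR ((2 * a)^-1) * expR (- (a * rad ^+ 2 / 18)) *
      (expR (exp_rate * (k.+1%:R * h)) * expR (d%:R * r ^+ 2))).
Proof.
move=> a0 ak.
have [rW C] := one_step_consistency (@Hm k) (@rz k) (@incr k) d_gt0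
  (@state_measurable k) (state_bound k) rad_ge1 (@small_init_measurable k)
  small_init_ge0 small_init_le1 h0 h1 (drift_bound k) (row_bound k) sB_small e.
have WE : (fun w => g w * meval (fun i => state k w i ord0 +
    (h * meval (fun i => state k w i ord0) (pb i ord0) +
     Num.sqrt h * \sum_l meval (fun i => state k w i ord0) (ps i l) * z k w l ord0))
    (mpolyX R e)) = (fun w => g w * meval (fun i => prestate k w i ord0) (mpolyX R e)).
  apply/funext => w; congr (_ * _); apply: meval_eq => i; exact/esym/prestateE.
rewrite WE in rW C.
pose c := (mdeg e)`!%:R * (2 * expR ((2 * a)^-1) * expR (- (a * rad ^+ 2 / 18))).
have c0 : 0 <= c by rewrite /c !mulr_ge0 ?expR_ge0.
have EM := prestate_exp_moment (ltW a0) ak.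
have rE : rint (fun w => g w * expR (a * \sum_i prestate k w i ord0 ^+ 2)).
  apply: rint_ge0 => //; last exact: le_lt_trans EM (ltry _).
  by apply/measurable_EFinP; exact: m_exp.
have EM' : Er (fun w => g w * expR (a * \sum_i prestate k w i ord0 ^+ 2)) <=
   expR (exp_rate * (k.+1%:R * h)) * expR (d%:R * r ^+ 2).
  by rewrite -lee_fin -ErE.
have Pj : `|mom k.+1 e - Er (fun w => g w * meval (fun i => prestate k w i ord0) (mpolyX R e))| <=
    c * (expR (exp_rate * (k.+1%:R * h)) * expR (d%:R * r ^+ 2)).
  rewrite /mom -ErB//; apply: (le_trans _ (ler_wpM2l c0 EM')); rewrite -ErZ//.
  apply: Er_norm_le; [exact: rintB|exact: rintZ|] => w.
  exact: proj_pointwise.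
rewrite [leRHS](_ : _ = c * (expR (exp_rate * (k.+1%:R * h)) * expR (d%:R * r ^+ 2)) +
  (mdeg e)`!%:R * (h * Num.sqrt h * step_const d rad (K * (d%:R * rad + 1)) (K ^+ 2)));
      last by rewrite /c; ring.
set M := Er (fun w => g w * meval (fun i => prestate k w i ord0) (mpolyX R e)) in C Pj.
rewrite (_ : _ - _ - _ = (mom k.+1 e - M) +
   (M - mom k e - h * generator pb ps (extend_linear (mom k)) e)); last by ring.
by apply: le_trans (ler_normD _ _) _; apply: lerD.
Qed.

Hypothesis u0_int : forall e, rint (fun w => meval (fun i => u0 w i ord0) (mpolyX R e)).

(* Markov bound for the complement of the event, with the power [2 q] that the
   stability assumption at time 0 controls. *)
Definition init_tail q : R := \sum_i Er (fun w => u0 w i ord0 ^+ (2 * q)) / r ^+ (2 * q).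

Let u0_powE q i : (fun w => u0 w i ord0 ^+ (2 * q)) =
  (fun w => meval (fun i => u0 w i ord0) (mpolyX R (mnm_muln (mnm1 i) (2 * q)))).
Proof.
apply/funext => w; rewrite mevalX (bigD1 i)//= mulmnE mnm1E eqxx mul1n big1 ?mulr1// => j ji.
by rewrite mulmnE mnm1E eq_sym (negbTE ji) mul0n.
Qed.

(** Off the event the largest coordinate exceeds [r], so raising its power from [mdeg e] to [2 * q]
    gains the missing powers of [r]. *)
Let tail_pointwise q e w : (mdeg e <= 2 * q)%N ->
  `|(1 - g w) * meval (fun i => u0 w i ord0) (mpolyX R e)| <=
  r ^+ mdeg e * \sum_i (r ^+ (2 * q))^-1 * u0 w i ord0 ^+ (2 * q).
Proof.
move=> eq; have r0 := ltW r_gt0.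
have S0 i : 0 <= (r ^+ (2 * q))^-1 * u0 w i ord0 ^+ (2 * q).
  by apply: mulr_ge0; [rewrite invr_ge0 exprn_ge0|rewrite exprM exprn_ge0// sqr_ge0].
case: (small_init_cases w) => -[-> H].
  by rewrite subrr mul0r normr0 mulr_ge0 ?exprn_ge0// sumr_ge0.
rewrite subr0 mul1r; have [i0 i0max] := max_coordinate (fun i => u0 w i ord0) d_gt0.
case: H => j rj; set N := `|u0 w i0 ord0| in i0max.
have rN : r <= N by exact: le_trans (ltW rj) (i0max j).
apply: (le_trans (monomial_norm_le e i0max)).
apply: (@le_trans _ _ (r ^+ mdeg e * ((r ^+ (2 * q))^-1 * u0 w i0 ord0 ^+ (2 * q)))); last first.
  by rewrite ler_wpM2l ?exprn_ge0// (bigD1 i0)//= lerDl sumr_ge0.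
rewrite [u0 w i0 ord0 ^+ (2 * q)]exprM -[u0 w i0 ord0 ^+ 2]real_normK ?num_real// -/N -exprM.
rewrite mulrA.
have -> : r ^+ mdeg e / r ^+ (2 * q) = (r ^+ (2 * q - mdeg e))^-1.
  rewrite -[in LHS](subnKC eq) exprD invfM mulrA divff ?mul1r//.
  by rewrite gt_eqF// exprn_gt0.
rewrite mulrC ler_pdivlMr ?exprn_gt0//.
have N0 : 0 <= N by exact: normr_ge0.
by rewrite -[in leRHS](subnKC eq) exprD ler_wpM2l ?exprn_ge0// lerXn2r ?nnegrE.
Qed.

Let tail_int q : rint (fun w => \sum_i (r ^+ (2 * q))^-1 * u0 w i ord0 ^+ (2 * q)).
Proof. by apply: rint_sum => i; apply: rintZ; rewrite u0_powE; exact: u0_int. Qed.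

Let tail_Er q : Er (fun w => \sum_i (r ^+ (2 * q))^-1 * u0 w i ord0 ^+ (2 * q)) = init_tail q.
Proof.
have rt i : rint (fun w => u0 w i ord0 ^+ (2 * q)) by rewrite u0_powE; exact: u0_int.
rewrite (Er_sum _ (fun i => rintZ _ (rt i))); apply: eq_bigr => i _.
by rewrite ErZ// mulrC.
Qed.

Lemma mom_state k e q :
  `|Er (fun w => meval (fun i => state k w i ord0) (mpolyX R e)) - mom k e| <=
  rad ^+ mdeg e * init_tail q.
Proof.
have rad0 := ltW rad_gt0.
have mX : measurable_fun [set: Omega] (fun w => meval (fun i => state k w i ord0) (mpolyX R e)).
  exact: (measurable_meval (v := fun w => state k w)).
have rX : rint (fun w => meval (fun i => state k w i ord0) (mpolyX R e)).
  by apply: (@rint_bounded _ _ _ _ _ (rad ^+ mdeg e)) => // w;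
     apply: monomial_norm_le => i; exact: state_bound.
rewrite /mom -ErB// -tail_Er -ErZ//.
apply: Er_norm_le; [exact: rintB|exact: rintZ|] => w.
rewrite -{1}[meval _ _]mul1r -mulrBl normrM mulrC.
apply: ler_pM => //; first by apply: monomial_norm_le => i; exact: state_bound.
have := @tail_pointwise q mnm0 w; rewrite mdeg0 mpolyX0 meval1 mulr1 expr0 mul1r; exact.
Qed.

(** On the event the cut-off is the identity at [u0], since [r <= rad / 3]; only the complement
    contributes. *)
Lemma mom_init e q : (mdeg e <= 2 * q)%N ->
  `|mom 0 e - Er (fun w => meval (fun i => u0 w i ord0) (mpolyX R e))| <=
  r ^+ mdeg e * init_tail q.
Proof.
move=> eq; rewrite /mom -ErB// -tail_Er -ErZ//.
apply: Er_norm_le; [exact: rintB|exact: rintZ|] => w.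
rewrite (_ : _ - _ = - ((1 - g w) * meval (fun i => u0 w i ord0) (mpolyX R e))).
  by rewrite normrN; exact: tail_pointwise.
case: (small_init_cases w) => -[-> H]; last by rewrite mul0r sub0r subr0 mul1r.
rewrite subrr mul0r oppr0 mul1r (_ : meval _ _ = meval (fun i => u0 w i ord0) (mpolyX R e)) ?subrr//.
apply: meval_eq => i; rewrite /state /= mxE; have [_ _ _ -> //] := cut.
exact: le_trans (H i) r_le.
Qed.

End Trajectory.

Lemma momentE (R : realType) (disp : measure_display) (Omega : measurableType disp)
  (P : probability Omega R) (d : nat) (X : Omega -> 'cV[R]_d) (g : multinom d) :
  moment P X g = Er P (fun w => meval (fun i => X w i ord0) (mpolyX R g)).
Proof.
rewrite /moment unlock /Er /Rintegral; congr fine; apply: eq_integral => w _.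
by rewrite mevalX.
Qed.

Lemma step_const_ge0 (R : realType) d (V B k : R) : 0 <= B -> 0 <= step_const d V B k.
Proof.
move=> B0; rewrite /step_const /noise_const.
by apply: addr_ge0; rewrite !mulr_ge0 ?expR_ge0.
Qed.

(** * The error bound at a fixed step size *)

Section FixedBound.
Context (R : realType) (disp : measure_display) (Omega : measurableType disp)
  (P : probability Omega R).
Variables (d m : nat) (u0 : Omega -> 'cV[R]_d) (z : nat -> Omega -> 'cV[R]_m).
Hypothesis noise : driving_noise P u0 z.
Variables (chi : R -> R) (h rad r K cN T a Q eps tau E0 Cdelta : R) (n L S : nat).
Variables (pb : 'cV[mpoly d R]_d) (ps : 'M[mpoly d R]_(d, m)) (ch : rpc_choice d L S).
Hypothesis d_gt0 : (0 < d)%N.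
Hypothesis rad_ge1 : 1 <= rad.
Hypothesis r_gt0 : 0 < r.
Hypothesis r_le : r <= rad / 3.
Hypothesis cut : cutoff rad chi.
Hypothesis h0 : 0 <= h.
Hypothesis h1 : h <= 1.
Hypothesis K_gt0 : 0 < K.
Hypothesis pbK : forall x, cube rad x -> frob (evalmx pb x) <= K * (frob x + 1).
Hypothesis psK : forall x, cube rad x -> frob (evalmx ps x) <= K.
Hypothesis h_small : 8 * d%:R * K ^+ 2 * h <= 1.
Hypothesis cN0 : 0 <= cN.
Hypothesis cNE : (\int[normal_prob 0 1]_y (expR (y ^+ 2 / 4))%:E = cN%:E :> \bar R)%E.
Hypothesis sB_small : Num.sqrt h * (K * (d%:R * rad + 1)) <= 1.
Hypothesis u0_int : forall e, rint P (fun w => meval (fun i => u0 w i ord0) (mpolyX R e)).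
Hypothesis nhT : n%:R * h = T.
Hypothesis a_gt0 : 0 < a.
Hypothesis a_le : forall k, (k <= n)%N -> a <= decay h K k.
Hypothesis SL : (S <= L)%N.
Hypothesis degb : (degmx pb <= S)%N.
Hypothesis degs : (2 * degmx ps <= S)%N.
Local Notation J := (2 * L + S)%N.
Local Notation B := (2 * L + 2 * S)%N.
Hypothesis massQ :
  (d ^ 2)%:R * (coef_mass S B pb + 2^-1 * coef_mass S B (ps *m ps^T)) <= Q.
Hypothesis stab : rpc_stability ch h pb ps (moment P u0) Cdelta n.
Hypothesis tau_ge0 : 0 <= tau.
Hypothesis tauP : forall j, (2 * L < j)%N ->
  rad ^+ j + Cdelta * Num.sqrt j`!%:R <= j`!%:R * tau.
Hypothesis E0P : init_tail P u0 r L <= E0.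
Hypothesis eps_ge0 : 0 <= eps.
Hypothesis epsP : J.+1%:R ^+ d *
  (h * Num.sqrt h * step_const d rad (K * (d%:R * rad + 1)) (K ^+ 2) +
   2 * expR ((2 * a)^-1) * expR (- (a * rad ^+ 2 / 18)) *
     (expR (exp_rate d K cN * T) * expR (d%:R * r ^+ 2))) <= h * eps.

Local Notation st := (state u0 z chi h pb ps).
Local Notation mu := (mom P u0 z chi h r pb ps).
Local Notation mk := (rpc_moment ch h pb ps (moment P u0)).

Let rad0 : 0 <= rad. Proof. exact: le_trans rad_ge1. Qed.

Let E0_ge0 : 0 <= E0.
Proof.
apply: le_trans E0P; apply: sumr_ge0 => i _; rewrite mulr_ge0 ?invr_ge0 ?exprn_ge0 ?(ltW r_gt0)//.
by apply: Er_ge0 => w; rewrite exprM exprn_ge0// sqr_ge0.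
Qed.

Let kh k : (k <= n)%N -> k%:R * h <= T.
Proof. by move=> kn; rewrite -nhT ler_wpM2r// ler_nat. Qed.

Let Q0 : 0 <= Q.
Proof.
by apply: le_trans massQ; rewrite mulr_ge0// addr_ge0 ?mulr_ge0 ?invr_ge0 ?coef_mass_ge0.
Qed.

(** No cancellation is sought: one moment is bounded by the cube, the other by stability. *)
Let high k g : (k <= n)%N -> (2 * L < mdeg g <= B)%N ->
  `|mu k g - mk k g| <= (mdeg g)`!%:R * tau.
Proof.
move=> kn /andP[lg gB]; apply: le_trans (ler_normB _ _) _; apply: le_trans (tauP lg).
apply: lerD; first exact: mom_le.
exact: stab.2.
Qed.

Let consistency k : (k < n)%N ->
  moment_norm J (fun g => mu k.+1 g - mu k g - h * generator pb ps (extend_linear (mu k)) g)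
  <= h * eps.
Proof.
move=> kn; apply: le_trans epsP; apply: moment_norm_le.
  have sc : 0 <= step_const d rad (K * (d%:R * rad + 1)) (K ^+ 2).
    by apply: step_const_ge0; rewrite mulr_ge0 ?(ltW K_gt0)// addr_ge0// mulr_ge0.
  apply: addr_ge0; last by rewrite !mulr_ge0 ?expR_ge0.
  by apply: mulr_ge0 => //; rewrite mulr_ge0 ?sqrtr_ge0.
move=> g _.
have := mom_consistency noise d_gt0 rad_ge1 r_gt0 cut h0 h1 K_gt0 pbK psK h_small cN0 cNE
  sB_small g a_gt0 (a_le kn).
move=> /le_trans; apply; rewrite ler_wpM2l// lerD2l ler_wpM2l ?mulr_ge0 ?expR_ge0//.
rewrite ler_wpM2r ?expR_ge0// ler_expR ler_wpM2l ?kh//.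
rewrite /exp_rate; apply: addr_ge0; last exact: rate3_ge0.
by apply: mulr_ge0 => //; apply: mulr_ge0; rewrite ?sqr_ge0 ?mulr_ge0.
Qed.

Let init_err : moment_norm J (fun g => mu 0%N g - mk 0%N g) <=
  J.+1%:R ^+ d * (expR rad * E0 + tau).
Proof.
have c0 : 0 <= expR rad * E0 + tau by rewrite addr_ge0 ?mulr_ge0 ?expR_ge0.
apply: moment_norm_le => // g gJ.
(* The Markov bound of power [2 * L] does not reach the degrees from [2 * L + 1] to [J]; these fall
   under the bound [tau] already at time 0. *)
have [gL|gL] := leqP (mdeg g) (2 * L)%N; last first.
  apply: (@le_trans _ _ ((mdeg g)`!%:R * tau)).
    by apply: high => //; rewrite gL (leq_trans gJ)// leq_add2l leq_pmull.
  by rewrite ler_wpM2l// lerDr mulr_ge0 ?expR_ge0.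
have -> : mk 0%N g = Er P (fun w => meval (fun i => u0 w i ord0) (mpolyX R g)).
  by rewrite /rpc_moment gJ /= momentE.
have r0 := ltW r_gt0.
have := mom_init noise h pb ps d_gt0 rad_ge1 r_gt0 r_le cut u0_int gL.
move=> /le_trans; apply.
apply: (@le_trans _ _ ((mdeg g)`!%:R * expR r * E0)).
  apply: ler_pM => //; first exact: exprn_ge0.
    apply: sumr_ge0 => i _; rewrite mulr_ge0 ?invr_ge0 ?exprn_ge0//.
    by apply: Er_ge0 => w; rewrite exprM exprn_ge0// sqr_ge0.
  exact: exprn_fact_le_expR.
rewrite -mulrA ler_wpM2l// -[leLHS]addr0 lerD// ler_wpM2r// ler_expR.
by apply: (le_trans r_le); have := rad_ge1; lra.
Qed.

(** [E0] occurs twice: for removing the restriction to the event at time [k], and for the initial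
    error inside Gronwall. *)
Lemma fixed_bound k : (k <= n)%N ->
  moment_dist J (moment P (st k)) (mk k) <=
  J.+1%:R ^+ d * (expR rad * E0) + expR (T * Q) *
    (J.+1%:R ^+ d * (expR rad * E0 + tau) + T * (Q * (B.+1%:R ^+ d * tau) + eps)).
Proof.
move=> kn; pose e1 g := moment P (st k) g - mu k g; pose e2 g := mu k g - mk k g.
apply: (@le_trans _ _ (moment_norm J e1 + moment_norm J e2)).
  apply: (@moment_normD R d J (fun g => moment P (st k) g - mk k g) e1 e2) => g.
  rewrite /e1 /e2.
  by rewrite (le_trans _ (ler_normD _ _))// subrKA.
apply: lerD.
  apply: moment_norm_le => [|g _]; first by rewrite mulr_ge0 ?expR_ge0.
  rewrite /e1 momentE.
  have := mom_state noise h pb ps d_gt0 rad_ge1 r_gt0 cut u0_int k g L.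
  move=> /le_trans; apply; rewrite mulrA; apply: ler_pM => //; first exact: exprn_ge0.
    apply: sumr_ge0 => i _; rewrite mulr_ge0 ?invr_ge0 ?exprn_ge0 ?(ltW r_gt0)//.
    by apply: Er_ge0 => w; rewrite exprM exprn_ge0// sqr_ge0.
  exact: exprn_fact_le_expR.
have tail j g : (j <= n)%N -> (J < mdeg g <= B)%N -> `|mu j g - mk j g| <= (mdeg g)`!%:R * tau.
  move=> jn /andP[Jg gB]; apply: high => //; rewrite gB andbT.
  exact: leq_ltn_trans (leq_addr S _) Jg.
apply: (le_trans (rpc_error SL h0 eps_ge0 tau_ge0 degb degs massQ stab.1 consistency tail kn)).
have t0 : 0 <= B.+1%:R ^+ d * tau by rewrite mulr_ge0 ?exprn_ge0.
apply: ler_pM; rewrite ?expR_ge0//.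
- by rewrite addr_ge0 ?moment_norm_ge0// mulr_ge0// addr_ge0 ?mulr_ge0.
- by rewrite ler_expR mulrA ler_wpM2r// kh.
apply: lerD; first exact: init_err.
by rewrite -mulrA -mulrDr mulrA ler_wpM2r ?kh// addr_ge0// mulr_ge0.
Qed.

End FixedBound.

(** * Asymptotics *)

Section Asymptotics.
Variable R : realType.
Implicit Types x b A Y : R.

Lemma powR_large (p M : R) : 0 < p ->
  exists2 R0 : R, 1 <= R0 & forall x, R0 <= x -> M <= x `^ p.
Proof.
move=> p0; have M1 : 0 <= `|M| + 1 by rewrite addr_ge0.
exists (Num.max 1 ((`|M| + 1) `^ p^-1)) => [|x]; first by rewrite le_max lexx.
rewrite ge_max => /andP[x1 Mx].
apply: (@le_trans _ _ (`|M| + 1)).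
  by rewrite (le_trans (ler_norm M))// lerDl.
have -> : `|M| + 1 = ((`|M| + 1) `^ p^-1) `^ p.
  by rewrite -powRrM mulVf ?powRr1// gt_eqF.
by rewrite ge0_ler_powR// ?nnegrE ?powR_ge0 ?(ltW p0)// (le_trans _ x1).
Qed.

(** The inequality [y ^ n <= n! e ^ y] at [y = x e ^ b]: any decay rate [b] in [n] can be bought at
    the price of a factor [e ^ b] on [x]. *)
Lemma exprn_fact_decay x b n : 0 <= x ->
  x ^+ n <= n`!%:R * expR (x * expR b - b * n%:R).
Proof.
move=> x0; have xb0 : 0 <= x * expR b by rewrite mulr_ge0 ?expR_ge0.
have := exprn_fact_le_expR n xb0; rewrite exprMn -expRM_natr => H.
by rewrite expRB mulrA ler_pdivlMr ?expR_gt0.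
Qed.

(** The same inequality at [y = e ^ (2 b)], followed by a square root. *)
Lemma sqrt_fact_decay b n :
  Num.sqrt n`!%:R <= n`!%:R * (expR (expR (2 * b) / 2) * expR (- (b * n%:R))).
Proof.
have F0 : 0 < n`!%:R :> R by rewrite ltr0n fact_gt0.
have s0 : 0 < Num.sqrt n`!%:R :> R by rewrite sqrtr_gt0.
have ss : Num.sqrt n`!%:R ^+ 2 = n`!%:R :> R by rewrite sqr_sqrtr// ltW.
have H : expR (b * n%:R) <= Num.sqrt n`!%:R * expR (expR (2 * b) / 2).
  have e0 : 0 <= expR (2 * b) by exact: expR_ge0.
  have H := exprn_fact_le_expR n e0; rewrite -expRM_natr -ss in H.
  rewrite -(@ler_pXn2r _ 2)// ?nnegrE ?mulr_ge0 ?expR_ge0 ?(ltW s0)//.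
  rewrite exprMn -!expRM_natl [2%:R * (b * _)]mulrA; apply: (le_trans H).
  have e2 : 2%:R * (expR (2 * b) / 2) = expR (2 * b) by field.
  by rewrite e2.
rewrite -[X in X * (_ * _)]ss expr2 -mulrA ler_peMr ?(ltW s0)//.
by rewrite mulrA expRN ler_pdivlMr ?expR_gt0// mul1r.
Qed.

(** One of the [A + 2] units of [Y] pays for [rad * expR b] in [exprn_fact_decay]. *)
Lemma tail_moment_decay (rad Cd b A Y : R) n : 0 <= rad -> 0 <= Cd ->
  rad * expR b <= Y -> (A + 2) * Y <= b * n%:R -> 0 <= Y ->
  rad ^+ n + Cd * Num.sqrt n`!%:R <=
  n`!%:R * ((1 + Cd * expR (expR (2 * b) / 2)) * expR (- ((A + 1) * Y))).
Proof.
move=> rad0 Cd0 rY bn Y0; rewrite mulrDl mulrDr mul1r; apply: lerD.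
  apply: le_trans (exprn_fact_decay b n rad0) _; rewrite ler_wpM2l// ler_expR; lra.
apply: le_trans (ler_wpM2l Cd0 (sqrt_fact_decay b n)) _.
rewrite mulrCA ler_wpM2l// -mulrA ler_wpM2l// ler_wpM2l ?expR_ge0// ler_expR; lra.
Qed.

(** Since [(2 n)! <= (2 n) ^ (2 n)], the quotient is at most [(2 n / t) ^ n]; [c] stands for
    [2 n]. *)
Lemma fact_power_decay (t c b : R) n : 0 < t -> 0 <= c -> c <= t * expR (- b) ->
  c = (2 * n)%:R -> Num.sqrt (2 * n)`!%:R / t ^+ n <= expR (- (b * n%:R)).
Proof.
move=> t0 c0 ct cE; rewrite ler_pdivrMr ?exprn_gt0//.
have f : Num.sqrt (2 * n)`!%:R <= (2 * n)%:R ^+ n :> R.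
  rewrite -[leRHS]ger0_norm ?exprn_ge0// -sqrtr_sqr ler_wsqrtr// -exprM.
  have := fact_le_exp 0 (2 * n); rewrite add0n fact0 mul1n => H.
  by rewrite -natrX ler_nat [(n * 2)%N]mulnC.
apply: (le_trans f); rewrite -cE.
apply: (@le_trans _ _ ((t * expR (- b)) ^+ n)).
  by apply: lerXn2r => //; rewrite nnegrE mulr_ge0 ?expR_ge0// ltW.
by rewrite exprMn -expRM_natr mulNr mulrC.
Qed.

Lemma error_budget (d J B : nat) (rad Y T D cW A tau E0 eps c1 c2 c3 : R) :
  0 <= T -> 0 <= D -> 0 <= Y -> 0 <= c1 -> 0 <= c2 -> 0 <= c3 -> 0 <= rad ->
  0 <= E0 -> 0 <= tau -> 0 <= eps -> 0 <= cW ->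
  (J <= B)%N -> B.+1%:R ^+ d <= expR (cW * Y) -> rad <= Y -> A = cW + T * D + 1 ->
  E0 <= c1 * expR (- ((A + 1) * Y)) -> tau <= c2 * expR (- ((A + 1) * Y)) ->
  eps <= expR (cW * Y) * (c3 * expR (- ((A + 1) * Y))) ->
  J.+1%:R ^+ d * (expR rad * E0) + expR (T * (D * Y)) *
    (J.+1%:R ^+ d * (expR rad * E0 + tau) + T * (D * Y * (B.+1%:R ^+ d * tau) + eps))
  <= (c1 + (c1 + c2) + T * (D * c2 + c3)) * expR (- Y).
Proof.
move=> T0 D0 Y0 c10 c20 c30 rad0 E00 tau0 eps0 cW0 JB BW radY AE E0le taule epsle.
have J0 : 0 <= J.+1%:R ^+ d :> R by rewrite exprn_ge0.
have B0 : 0 <= B.+1%:R ^+ d :> R by rewrite exprn_ge0.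
have JW : J.+1%:R ^+ d <= expR (cW * Y).
  by apply: le_trans BW; rewrite lerXn2r ?nnegrE// ler_nat.
set X := expR (- ((A + 1) * Y)) in E0le taule epsle *.
set w := expR (cW * Y) in BW JW epsle *.
set u := expR (T * (D * Y)); pose y := expR Y.
have X0 : 0 <= X by exact: expR_ge0.
have w0 : 0 <= w by exact: expR_ge0.
have u1 : 1 <= u by rewrite -expR0 ler_expR !mulr_ge0.
have y1 : 1 <= y by rewrite -expR0 ler_expR.
have Yy : Y <= y by apply: le_trans (expR_ge1Dx Y); rewrite lerDr.
(* The rate [A + 1] pays for the number of moments [w], the Gronwall factor [u] and one factor [y],
   spent on [expR rad] or on the linear factor [Y]; exactly [expR (- Y)] is left. *)
have EX : expR (- Y) = w * u * y * X.
  by rewrite /w /u /y /X -!expRD; congr expR; rewrite AE; ring.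
have ry : expR rad <= y by rewrite ler_expR.
have u0 : 0 <= u by exact: le_trans u1.
have y0 : 0 <= y by exact: le_trans y1.
have eE : expR rad * E0 <= y * (c1 * X) by apply: ler_pM; rewrite ?expR_ge0.
have eE0 : 0 <= expR rad * E0 by rewrite mulr_ge0 ?expR_ge0.
have WX0 : 0 <= w * y * X by rewrite !mulr_ge0.
have t1 : J.+1%:R ^+ d * (expR rad * E0) <= c1 * (w * u * y * X).
  apply: (@le_trans _ _ (w * (y * (c1 * X)))); first exact: ler_pM.
  rewrite [leLHS](_ : _ = c1 * (1 * (w * y * X))); last by ring.
  rewrite [leRHS](_ : _ = c1 * (u * (w * y * X))); last by ring.
  by rewrite ler_wpM2l// ler_wpM2r.
have t2 : u * (J.+1%:R ^+ d * (expR rad * E0 + tau)) <= (c1 + c2) * (w * u * y * X).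
  apply: (@le_trans _ _ (u * (w * (y * (c1 * X) + y * (c2 * X))))); last first.
    by rewrite le_eqVlt; apply/orP; left; apply/eqP; ring.
  rewrite ler_wpM2l//; apply: ler_pM => //; first by rewrite addr_ge0.
  by apply: lerD => //; apply: le_trans taule _; rewrite ler_peMl// mulr_ge0.
have t3 : u * (T * (D * Y * (B.+1%:R ^+ d * tau))) <= T * (D * c2) * (w * u * y * X).
  rewrite [leLHS](_ : _ = (u * T * D) * (Y * (B.+1%:R ^+ d * tau))); last by ring.
  rewrite [leRHS](_ : _ = (u * T * D) * (y * (w * (c2 * X)))); last by ring.
  rewrite ler_wpM2l ?mulr_ge0//; apply: ler_pM => //; first by rewrite mulr_ge0.
  exact: ler_pM.
have t4 : u * (T * eps) <= T * c3 * (w * u * y * X).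
  rewrite [leLHS](_ : _ = (u * T) * (1 * eps)); last by ring.
  rewrite [leRHS](_ : _ = (u * T) * (y * (w * (c3 * X)))); last by ring.
  by rewrite ler_wpM2l ?mulr_ge0//; apply: ler_pM.
rewrite EX [leRHS](_ : _ = c1 * (w * u * y * X) + ((c1 + c2) * (w * u * y * X) +
  (T * (D * c2) * (w * u * y * X) + T * c3 * (w * u * y * X)))); last by ring.
apply: le_trans (lerD t1 (lerD t2 (lerD t3 t4))).
by rewrite le_eqVlt; apply/orP; left; apply/eqP; ring.
Qed.

(** At [x = rad] the base is [- ln h]. An integer [M >= N] gives [x ^ (2 M) <= (2 M)! e ^ x], so
    exponential decay in [rad] beats any power of the logarithm. *)
Lemma expRN_le_powR (N delta : R) : 0 <= N -> 0 < delta ->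
  exists2 c : R, 0 < c &
    forall x, 1 <= x -> expR (- x) <= c * (delta * x ^+ 2 / 2) `^ (- N).
Proof.
move=> N0 d0; pose M := (Num.truncn N).+1.
have NM : N <= M%:R by apply: ltW; rewrite /M -truncn_lt_nat.
exists ((2 * M)`!%:R * (delta / 2) `^ N).
  by rewrite mulr_gt0 ?ltr0n ?fact_gt0// powR_gt0// divr_gt0.
move=> x x1; have x0 : 0 < x by exact: lt_le_trans x1.
have d2 : 0 < delta / 2 by rewrite divr_gt0.
have -> : delta * x ^+ 2 / 2 = delta / 2 * x ^+ 2 by rewrite mulrAC.
rewrite powRN [(delta / 2 * _) `^ N]powRM ?sqr_ge0 ?(ltW d2)// invfM.
rewrite [leRHS](_ : _ = (2 * M)`!%:R / (x ^+ 2) `^ N); last first.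
  by field; rewrite !gt_eqF// powR_gt0// exprn_gt0.
rewrite expRN ler_pdivlMr ?powR_gt0 ?exprn_gt0// mulrC ler_pdivrMr ?expR_gt0//.
apply: (@le_trans _ _ (x ^+ (2 * M))).
  rewrite exprM -[(x ^+ 2) ^+ M]powR_mulrn ?sqr_ge0// ler_powR// expr2.
  by rewrite -[1]mulr1 ler_pM.
exact: exprn_fact_le_expR (ltW x0).
Qed.

End Asymptotics.

(** * Integrability of the initial datum and growth of the approximants *)

Section InitialMoments.
Context (R : realType) (disp : measure_display) (Omega : measurableType disp)
  (P : probability Omega R) (d : nat) (u0 : Omega -> 'cV[R]_d).
Hypothesis ru : random_vector u0.

(** Domination by [1 + |x| ^ (2 n)], whose even power is an [n]-th power of [|x| ^ 2] and so is
    controlled by the exponential. *)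
Lemma initial_moments_integrable (delta0 : R) : 0 < delta0 ->
  initial_assumption P delta0 u0 ->
  forall e, rint P (fun w => meval (fun i => u0 w i ord0) (mpolyX R e)).
Proof.
move=> d0 H e; set n := mdeg e.
have frobE w : frob (u0 w) ^+ 2 = \sum_i u0 w i ord0 ^+ 2.
  by rewrite frob_sqr; apply: eq_bigr => i _; rewrite big_ord1.
have mE : measurable_fun [set: Omega] (fun w => expR (delta0 * frob (u0 w) ^+ 2)).
  apply: measurableT_comp => //; apply: measurable_funM => //.
  under eq_fun do rewrite frobE.
  by apply: measurable_sum => i; apply: measurable_funX; exact: ru.
have rE : rint P (fun w => expR (delta0 * frob (u0 w) ^+ 2)).
  apply: rint_ge0 => //.
  by move: H; rewrite /initial_assumption unlock.
have rB := rintD (rint_cst P 1) (rintZ (n`!%:R / delta0 ^+ n) rE).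
apply: rint_le rB _; first exact: (measurable_meval (v := u0)).
move=> w; have F0 := frob_ge0 (u0 w).
apply: (@le_trans _ _ (frob (u0 w) ^+ n)).
  by apply: monomial_norm_le => i; exact: entry_le_frob.
apply: (@le_trans _ _ (1 + (frob (u0 w) ^+ 2) ^+ n)).
  rewrite -exprM mulnC exprM; have := sqr_ge0 (frob (u0 w) ^+ n - 1).
  have := exprn_ge0 n F0; nra.
rewrite lerD2l mulrAC ler_pdivlMr ?exprn_gt0// mulrC -exprMn.
by apply: exprn_fact_le_expR; rewrite mulr_ge0 ?sqr_ge0 ?ltW.
Qed.

Lemma init_tail_le (r c : R) q : 0 < r ->
  (forall g, mdeg g = (2 * q)%N -> `|moment P u0 g| <= c) ->
  init_tail P u0 r q <= d%:R * (c / r ^+ (2 * q)).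
Proof.
move=> r0 H; rewrite -{2}(card_ord d) mulr_natl -sumr_const; apply: ler_sum => i _.
rewrite ler_wpM2r ?invr_ge0 ?exprn_ge0 ?(ltW r0)//.
have := H (mnm_muln (mnm1 i) (2 * q)); rewrite mdegMn mdeg1 mul1n => /(_ erefl).
rewrite momentE => H1; apply: le_trans H1; rewrite (le_trans _ (ler_norm _))//.
rewrite le_eqVlt; apply/orP; left; apply/eqP; congr Er; apply/funext => w.
rewrite mevalX (bigD1 i)//= mulmnE mnm1E eqxx mul1n big1 ?mulr1// => j ji.
by rewrite mulmnE mnm1E eq_sym (negbTE ji) mul0n.
Qed.

End InitialMoments.

Lemma frobD (R : realType) (p q : nat) (A B : 'M[R]_(p, q)) :
  frob (A + B) <= frob A + frob B.
Proof.
have A0 := frob_ge0 A; have B0 := frob_ge0 B.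
rewrite -(@ler_pXn2r _ 2)// ?nnegrE ?frob_ge0 ?addr_ge0//.
have fE (M : 'M[R]_(p, q)) : frob M ^+ 2 = \sum_ij M ij.1 ij.2 ^+ 2.
  by rewrite frob_sqr pair_bigA.
have cs : \sum_ij A ij.1 ij.2 * B ij.1 ij.2 <= frob A * frob B.
  apply: le_trans (ler_norm _) _.
  rewrite -(@ler_pXn2r _ 2)// ?nnegrE ?mulr_ge0// real_normK ?num_real// exprMn !fE.
  exact: cauchy_schwarz_sum.
rewrite fE sqrrD !fE.
have -> : \sum_ij (A + B) ij.1 ij.2 ^+ 2 = \sum_ij A ij.1 ij.2 ^+ 2
    + 2 * \sum_ij A ij.1 ij.2 * B ij.1 ij.2 + \sum_ij B ij.1 ij.2 ^+ 2.
  rewrite mulr_sumr -!big_split; apply: eq_bigr => ij _ /=; rewrite mxE; ring.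
rewrite lerD2r lerD2l mulr2n; lra.
Qed.

Lemma frobN (R : realType) (p q : nat) (A : 'M[R]_(p, q)) : frob (- A) = frob A.
Proof.
rewrite /frob; congr (Num.sqrt _); apply: eq_bigr => i _.
by rewrite !mxE; apply: eq_bigr => j _; rewrite !mxE mulrNN.
Qed.

Section Coefficients.
Variables (R : realType) (T K r C Rstar lam1 lam2 eta Cbs : R) (d m : nat).
Variables (b : R -> 'cV[R]_d -> 'cV[R]_d) (sigma : R -> 'cV[R]_d -> 'M[R]_(d, m)).
Variables (pb : R -> R -> nat -> 'cV[mpoly d R]_d)
  (ps : R -> R -> nat -> 'M[mpoly d R]_(d, m)).
Hypothesis coef : coefficient_assumption T K r C Rstar lam1 lam2 eta Cbs b sigma pb ps.
Variables (n S : nat) (rad : R).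
Hypothesis n_gt0 : (0 < n)%N.
Hypothesis rad_gt0 : 0 < rad.
Hypothesis S_gt0 : (0 < S)%N.
Hypothesis approx1 : C * rad `^ r * S%:R `^ (- r) <= 1.
Local Notation h := (step T n).

Lemma approx_degree : (degmx (pb h rad S) <= S)%N /\ (2 * degmx (ps h rad S) <= S)%N.
Proof.
have [_ ap _] := coef; have [+ _] := ap n n_gt0 rad S rad_gt0.
by rewrite geq_max => /andP.
Qed.

Let close (x : 'cV[R]_d) : cube rad x ->
  frob (b h x - evalmx (pb h rad S) x) <= 1 /\ frob (sigma h x - evalmx (ps h rad S) x) <= 1.
Proof.
move=> cx; have [_ ap _] := coef; have [_ /(_ S_gt0)] := ap n n_gt0 rad S rad_gt0.
rewrite ge_max => /andP[H1 H2]; split; rewrite -lee_fin.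
  apply: le_trans (_ : _ <= (C * rad `^ r * S%:R `^ (- r))%:E)%E _; last by rewrite lee_fin.
  by apply: le_trans H1; apply: ereal_sup_ubound; exists x.
apply: le_trans (_ : _ <= (C * rad `^ r * S%:R `^ (- r))%:E)%E _; last by rewrite lee_fin.
by apply: le_trans H2; apply: ereal_sup_ubound; exists x.
Qed.

(** On the cube the approximant is within 1 of the coefficient, which raises the growth constant
    from [K] to [K + 1]. *)
Lemma approx_drift x : cube rad x -> frob (evalmx (pb h rad S) x) <= (K + 1) * (frob x + 1).
Proof.
move=> cx; have [gr _ _] := coef; have [H _ _ _] := gr n n_gt0.
have [c1 _] := close cx; have F0 := frob_ge0 x.
have -> : evalmx (pb h rad S) x = b h x + - (b h x - evalmx (pb h rad S) x).
  by rewrite opprB addrC subrK.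
apply: le_trans (frobD _ _) _; rewrite frobN mulrDl mul1r; apply: lerD; first exact: H.
by apply: le_trans c1 _; rewrite lerDr.
Qed.

Lemma approx_diffusion x : cube rad x -> frob (evalmx (ps h rad S) x) <= K + 1.
Proof.
move=> cx; have [gr _ _] := coef; have [_ H _ _] := gr n n_gt0.
have [_ c1] := close cx.
have -> : evalmx (ps h rad S) x = sigma h x + - (sigma h x - evalmx (ps h rad S) x).
  by rewrite opprB addrC subrK.
apply: le_trans (frobD _ _) _; rewrite frobN; apply: lerD => //.
rewrite -lee_fin; apply: ltW; apply: le_lt_trans H.
by apply: ereal_sup_ubound; exists x.
Qed.

End Coefficients.

(** * Consequences of a large truncation radius *)

Section Regime.
Variables (R : realType) (d : nat) (T K lam1 lam2 eta D a cN : R).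
Hypothesis d_gt0 : (0 < d)%N.
Hypothesis T_gt0 : 0 < T.
Hypothesis K_gt0 : 0 < K.
Hypothesis lam2_gt0 : 0 < lam2.
Hypothesis lam21 : lam2 <= lam1.
Hypothesis D_ge0 : 0 <= D.
Hypothesis a_gt0 : 0 < a.

(* With [Y = rad ^ eta], the number of moments is at most
   [e ^ (rate_weight Y)] and the Gronwall factor is [e ^ (T D Y)], so an error of
   size [e ^ (- (rate_total + 1) Y)] ends up below [e ^ (- Y)].  The rates
   [rate_tail] and [rate_init] achieve this size for the moments of degree above
   [2 L] and for the truncated initial datum; [rate_step] is the growth of the
   Taylor remainder. *)
Definition rate_weight : R := d%:R * (4 * lam1).
Definition rate_total : R := rate_weight + T * D + 1.
Definition rate_tail : R := (rate_total + 2) / lam1.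
Definition rate_init : R := 2 * (rate_total + 1) / lam1.
Definition box_scale : R := a / (36 * d%:R).
Definition rate_step : R := expR 1 + 1.
Definition step_factor : R :=
  noise_const d (K ^+ 2) + 2 * expR (expR 1) * (K * (d%:R + 1)).
Definition exit_factor : R := 2 * expR (2 * a)^-1 * expR (exp_rate d K cN * T).
Local Notation delta := (a / 36).

Let lam1_gt0 : 0 < lam1. Proof. exact: lt_le_trans lam2_gt0 lam21. Qed.
Let dR : 1 <= d%:R :> R. Proof. by rewrite ler1n. Qed.

Lemma rate_weight_ge0 : 0 <= rate_weight.
Proof. by rewrite /rate_weight !mulr_ge0 ?(ltW lam1_gt0). Qed.

Lemma rate_total_ge0 : 0 <= rate_total.
Proof. by rewrite /rate_total !addr_ge0 ?rate_weight_ge0// mulr_ge0// ltW. Qed.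

Lemma rate_tail_ge0 : 0 <= rate_tail.
Proof.
apply: divr_ge0 (ltW lam1_gt0); have := rate_total_ge0; lra.
Qed.

Lemma step_factor_ge0 : 0 <= step_factor.
Proof.
rewrite /step_factor /noise_const; have k0 := ltW K_gt0.
by rewrite addr_ge0// !mulr_ge0 ?expR_ge0 ?addr_ge0 ?expR_ge0.
Qed.

Lemma exit_factor_ge0 : 0 <= exit_factor.
Proof. by rewrite /exit_factor !mulr_ge0 ?expR_ge0. Qed.

Let scale_gt0 : 0 < box_scale.
Proof. by rewrite /box_scale divr_gt0// mulr_gt0// (lt_le_trans _ dR). Qed.

Let delta_gt0 : 0 < delta. Proof. by rewrite divr_gt0. Qed.

Variables (rad h c : R).
Hypothesis rad_ge1 : 1 <= rad.
Hypothesis c_ge0 : 0 <= c.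
(** Since [rad * rad ^ (eta - 1) = Y] and [rad ^ 2 = Y * Z], the first bound makes [Y] dominate
    multiples of [rad] and the next one makes [rad ^ 2] dominate multiples of [Y]. For [1 < eta < 2]
    large [rad] meets both. Each left side adds up two thresholds, used separately. *)
Hypothesis rad_drift : expR rate_tail + 2 * c / lam2 <= rad `^ (eta - 1).
Hypothesis rad_gauss : 2 * lam1 * expR rate_init / box_scale +
  4 * (rate_total + 1 + rate_step) / delta <= rad `^ (2 - eta).
Hypothesis rad_lam : 2 / lam2 <= rad.
Hypothesis rad_h : 16 * d%:R * K ^+ 2 / delta <= rad.
Hypothesis rad_sqrth : 4 * (K * (d%:R + 1)) / delta <= rad.
Hypothesis hE : h = expR (- (delta * rad ^+ 2 / 2)).

Local Notation Y := (rad `^ eta).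
Local Notation Z := (rad `^ (2 - eta)).
Local Notation L := (Lof lam1 eta rad).
Local Notation S := (Sof lam2 eta rad).
Local Notation J := (2 * L + S)%N.
Local Notation B := (2 * L + 2 * S)%N.

Let rad_gt0 : 0 < rad. Proof. exact: lt_le_trans rad_ge1. Qed.
Let rad_neq0 : rad != 0. Proof. by rewrite gt_eqF. Qed.
Let Y_ge0 : 0 <= Y. Proof. exact: powR_ge0. Qed.

Let radYE : rad * rad `^ (eta - 1) = Y.
Proof.
by rewrite -{1}[rad](@powRr1 _ rad) ?(ltW rad_gt0)// -powRD ?rad_neq0 ?implybT// addrC subrK.
Qed.

Let sqrE : rad ^+ 2 = Y * Z.
Proof.
rewrite -powRD ?rad_neq0 ?implybT// addrC subrK.
by rewrite -powR_mulrn// ltW.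
Qed.

Lemma regime_tail : rad * expR rate_tail <= Y.
Proof.
rewrite -radYE ler_wpM2l ?(ltW rad_gt0)//; apply: le_trans rad_drift.
by rewrite lerDl divr_ge0 ?mulr_ge0 ?(ltW lam2_gt0).
Qed.

Lemma regime_rad : rad <= Y.
Proof.
apply: le_trans regime_tail; rewrite ler_peMr ?(ltW rad_gt0)//.
by rewrite -expR0 ler_expR rate_tail_ge0.
Qed.

Let lam2Y : 2 <= lam2 * Y.
Proof.
by rewrite mulrC -ler_pdivrMr//; apply: le_trans regime_rad.
Qed.

Let lam1Y : 2 <= lam1 * Y.
Proof. by apply: le_trans lam2Y _; rewrite ler_wpM2r. Qed.

Let half_truncn (x : R) : 2 <= x -> x / 2 <= (Num.truncn x)%:R.
Proof. by move=> x2; have := truncnS_gt x; rewrite -natr1; lra. Qed.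

Lemma regime_L_le : L%:R <= lam1 * Y.
Proof. by rewrite truncn_le// mulr_ge0// ltW. Qed.

Lemma regime_L_ge : lam1 * Y / 2 <= L%:R.
Proof. exact: half_truncn. Qed.

Lemma regime_S_ge : lam2 * Y / 2 <= S%:R.
Proof. exact: half_truncn. Qed.

Lemma regime_SL : (S <= L)%N.
Proof. by apply: le_truncn; rewrite ler_wpM2r. Qed.

Lemma regime_S_gt0 : (0 < S)%N.
Proof. by rewrite -(ltr0n R) (lt_le_trans _ regime_S_ge)//; have := lam2Y; lra. Qed.

(** With [c = C ^ (1 / r)] this is the condition under which the approximation error
    [C (rad / S) ^ r] is at most 1. *)
Lemma regime_S_rad : rad * c <= S%:R.
Proof.
apply: le_trans regime_S_ge.
have H : rad * (2 * c / lam2) <= Y.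
  rewrite -radYE ler_wpM2l ?(ltW rad_gt0)//; apply: le_trans rad_drift.
  by rewrite lerDr expR_ge0.
have := ler_wpM2l (ltW lam2_gt0) H.
rewrite (_ : lam2 * (rad * (2 * c / lam2)) = 2 * (rad * c)); first lra.
by field; rewrite gt_eqF.
Qed.

Lemma regime_size : B.+1%:R ^+ d <= expR (rate_weight * Y).
Proof.
have B4 : B%:R <= 4 * lam1 * Y :> R.
  have := regime_L_le; have : (S%:R <= L%:R :> R) by rewrite ler_nat regime_SL.
  rewrite natrD !natrM; lra.
rewrite /rate_weight -mulrA mulrC expRM_natr.
apply: lerXn2r; rewrite ?nnegrE ?expR_ge0//.
rewrite -natr1 addrC; apply: le_trans (expR_ge1Dx _) _.
by rewrite ler_expR.
Qed.

Lemma regime_moment_tail (Cd : R) j : 0 <= Cd -> (2 * L < j)%N ->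
  rad ^+ j + Cd * Num.sqrt j`!%:R <= j`!%:R *
   ((1 + Cd * expR (expR (2 * rate_tail) / 2)) * expR (- ((rate_total + 1) * Y))).
Proof.
move=> Cd0 Lj; apply: tail_moment_decay => //; first exact: ltW.
  exact: regime_tail.
have j2 : lam1 * Y <= j%:R.
  apply: (@le_trans _ _ (2 * L)%:R); last by rewrite ler_nat ltnW.
  by have := regime_L_ge; rewrite natrM; lra.
rewrite /rate_tail -ler_pdivrMl ?divr_gt0 ?ltr_wpDl ?rate_total_ge0//.
apply: le_trans j2; rewrite le_eqVlt; apply/orP; left; apply/eqP; field.
by rewrite !gt_eqF// ltr_wpDl ?rate_total_ge0.
Qed.

Let Z_init : 2 * lam1 * expR rate_init / box_scale <= Z.
Proof.
apply: le_trans rad_gauss; rewrite lerDl; apply: divr_ge0 (ltW delta_gt0).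
have := rate_total_ge0; have : 0 <= expR 1 :> R by exact: expR_ge0.
rewrite /rate_step; lra.
Qed.

Let Z_step : 4 * (rate_total + 1 + rate_step) / delta <= Z.
Proof.
apply: le_trans rad_gauss.
by rewrite lerDr divr_ge0 ?(ltW scale_gt0)// !mulr_ge0 ?expR_ge0// ltW.
Qed.

(** The factorial contributes at most [2 L = O(Y)] per power, against
    [rad ^ 2 * box_scale = Y * Z * box_scale] in the denominator; a large [Z] gives decay
    [rate_init] per unit of [L], and [L] is at least [lam1 * Y / 2]. *)
Lemma regime_initial :
  Num.sqrt (2 * L)`!%:R / (rad * Num.sqrt box_scale) ^+ (2 * L)
  <= expR (- ((rate_total + 1) * Y)).
Proof.
rewrite exprM [(rad * _) ^+ 2]exprMn sqr_sqrtr ?(ltW scale_gt0)//.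
have r2 : 0 < rad ^+ 2 * box_scale by rewrite mulr_gt0// exprn_gt0.
apply: le_trans (@fact_power_decay _ _ (2 * L)%:R rate_init _ r2 _ _ erefl) _ => //.
  rewrite expRN natrM ler_pdivlMr ?expR_gt0// sqrE -mulrA [Z * _]mulrC.
  apply: (@le_trans _ _ (Y * (2 * lam1 * expR rate_init))).
    rewrite [leRHS](_ : _ = 2 * (lam1 * Y) * expR rate_init); last by ring.
    by rewrite ler_wpM2r ?expR_ge0// ler_wpM2l// regime_L_le.
  by rewrite ler_wpM2l// mulrC -ler_pdivrMr.
rewrite ler_expR lerN2.
apply: (@le_trans _ _ (rate_init * (lam1 * Y / 2))).
  rewrite le_eqVlt; apply/orP; left; apply/eqP; rewrite /rate_init; field.
  by rewrite gt_eqF.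
apply: ler_wpM2l regime_L_ge.
by rewrite divr_ge0 ?(ltW lam1_gt0)// mulr_ge0// addr_ge0// rate_total_ge0.
Qed.

Lemma regime_sqrt : Num.sqrt h = expR (- (delta * rad ^+ 2 / 4)).
Proof.
rewrite -[RHS]ger0_norm ?expR_ge0// -sqrtr_sqr hE -expRM_natl; congr (Num.sqrt (expR _)).
by field.
Qed.

Lemma regime_h_le1 : h <= 1.
Proof.
rewrite hE -[leRHS]expR0 ler_expR oppr_le0 divr_ge0//.
by rewrite mulr_ge0 ?sqr_ge0// ltW.
Qed.

Let rad_sqr : rad <= rad ^+ 2.
Proof. by rewrite expr2 ler_peMr// ltW. Qed.

Lemma regime_h_small : 8 * d%:R * K ^+ 2 * h <= 1.
Proof.
rewrite hE expRN ler_pdivrMr ?expR_gt0// mul1r.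
apply: le_trans (expR_ge1Dx _); rewrite -[leLHS]add0r lerD//.
move: rad_h; rewrite ler_pdivrMr// => H; have := le_trans H (ler_wpM2r (ltW delta_gt0) rad_sqr).
lra.
Qed.

Lemma regime_sqrth_small : Num.sqrt h * (K * (d%:R * rad + 1)) <= 1.
Proof.
rewrite regime_sqrt mulrC expRN ler_pdivrMr ?expR_gt0// mul1r.
apply: le_trans (expR_ge1Dx _); rewrite -[leLHS]add0r lerD//.
apply: (@le_trans _ _ (K * (d%:R + 1) * rad)).
  by rewrite -mulrA ler_wpM2l ?(ltW K_gt0)// mulrDl lerD2l mul1r.
move: rad_sqrth; rewrite ler_pdivrMr// => H.
have := ler_wpM2r (ltW rad_gt0) H; rewrite expr2; lra.
Qed.

Let step_constE : step_const d rad (K * (d%:R * rad + 1)) (K ^+ 2)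
  <= step_factor * expR (rate_step * Y).
Proof.
have N0 : 0 <= noise_const d (K ^+ 2) by rewrite !mulr_ge0 ?expR_ge0.
apply: (@le_trans _ _ (step_factor * expR (rate_step * rad))); last first.
  by rewrite ler_wpM2l ?step_factor_ge0// ler_expR ler_wpM2l ?regime_rad// addr_ge0 ?expR_ge0.
have e1 : expR (rate_step * rad) = expR (expR 1 * rad) * expR rad.
  by rewrite -expRD mulrDl mul1r.
have er : rad <= expR rad.
  by apply: le_trans (expR_ge1Dx _); rewrite lerDr.
have er1 : 1 <= expR rad by exact: le_trans er.
rewrite mulrDl lerD// e1.
  rewrite mulrC ler_wpM2l// ler_peMr// expR_ge0//.
rewrite mulrDr mulr1 expRD.
rewrite [leLHS](_ : _ = 2 * expR (expR 1) * K * expR (expR 1 * rad) * (d%:R * rad + 1)); last by ring.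
rewrite [leRHS](_ : _ = 2 * expR (expR 1) * K * expR (expR 1 * rad) * (d%:R * expR rad + expR rad));
    last by ring.
rewrite ler_wpM2l ?mulr_ge0 ?expR_ge0 ?(ltW K_gt0)//.
by rewrite lerD// ler_wpM2l.
Qed.

(** [sqrt h] is [expR (- (delta * Y * Z / 4))], and [Z] exceeds the multiple of [1 / delta] needed
    to absorb [rate_step] and the target rate. *)
Let sqrt_decay q : 0 <= q -> q <= rate_step ->
  Num.sqrt h * expR (q * Y) <= expR (- ((rate_total + 1) * Y)).
Proof.
move=> q0 qr; rewrite regime_sqrt -expRD ler_expR sqrE.
have H := Z_step; rewrite ler_pdivrMr// in H.
have H1 := ler_wpM2l Y_ge0 H; have H2 := ler_wpM2r Y_ge0 qr; lra.
Qed.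

Definition regime_eps : R := J.+1%:R ^+ d *
  (Num.sqrt h * step_const d rad (K * (d%:R * rad + 1)) (K ^+ 2) + h * exit_factor).

Let SC0 : 0 <= step_const d rad (K * (d%:R * rad + 1)) (K ^+ 2).
Proof.
by apply: step_const_ge0; rewrite mulr_ge0 ?(ltW K_gt0)// addr_ge0// mulr_ge0// ltW.
Qed.

Lemma regime_eps_ge0 : 0 <= regime_eps.
Proof.
rewrite mulr_ge0 ?exprn_ge0// addr_ge0// mulr_ge0 ?sqrtr_ge0 ?exit_factor_ge0//.
by rewrite hE expR_ge0.
Qed.

Lemma regime_eps_le : regime_eps <= expR (rate_weight * Y) *
  ((step_factor + exit_factor) * expR (- ((rate_total + 1) * Y))).
Proof.
have h0 : 0 <= h by rewrite hE expR_ge0.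
apply: ler_pM; rewrite ?exprn_ge0//.
- by rewrite addr_ge0// mulr_ge0 ?sqrtr_ge0 ?exit_factor_ge0.
- apply: le_trans regime_size; apply: lerXn2r; rewrite ?nnegrE//.
  by rewrite ler_nat ltnS leq_add2l leq_pmull.
rewrite mulrDl lerD//.
  apply: le_trans (ler_wpM2l (sqrtr_ge0 _) step_constE) _; rewrite mulrCA.
  by rewrite ler_wpM2l ?step_factor_ge0// sqrt_decay// addr_ge0 ?expR_ge0.
rewrite mulrC ler_wpM2l ?exit_factor_ge0//.
apply: (@le_trans _ _ (Num.sqrt h * expR (0 * Y))); last first.
  by apply: sqrt_decay => //; rewrite addr_ge0 ?expR_ge0.
rewrite mul0r expR0 mulr1 -[leLHS](sqr_sqrtr h0) expr2 ler_piMr ?sqrtr_ge0//.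
by rewrite -[leRHS]sqrtr1 ler_wsqrtr// regime_h_le1.
Qed.

(* The value [delta = a / 36] is the one for which
   [e ^ (- a rad ^ 2 / 18) * e ^ (a rad ^ 2 / 36) = h ^ 2]. *)
Lemma regime_epsE : J.+1%:R ^+ d *
  (h * Num.sqrt h * step_const d rad (K * (d%:R * rad + 1)) (K ^+ 2) +
   2 * expR ((2 * a)^-1) * expR (- (a * rad ^+ 2 / 18)) *
     (expR (exp_rate d K cN * T) * expR (d%:R * (rad * Num.sqrt box_scale) ^+ 2))) =
  h * regime_eps.
Proof.
have d0 : d%:R != 0 :> R by rewrite gt_eqF// (lt_le_trans _ dR).
have hh : expR (- (a * rad ^+ 2 / 18)) * expR (d%:R * (rad * Num.sqrt box_scale) ^+ 2) = h * h.
  rewrite hE -!expRD exprMn sqr_sqrtr ?(ltW scale_gt0)//; congr expR.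
  rewrite /box_scale; field; exact: d0.
rewrite /regime_eps /exit_factor [RHS]mulrCA; congr (_ * _).
rewrite [RHS]mulrDr [X in _ = X + _]mulrA; congr (_ + _).
rewrite [h * (h * _)]mulrA -hh; ring.
Qed.

Lemma regime_box : a <= 1 -> rad * Num.sqrt box_scale <= rad / 3.
Proof.
move=> a1; apply: ler_wpM2l; first exact: ltW.
rewrite -[3^-1]ger0_norm// -sqrtr_sqr ler_wsqrtr// ler_pdivrMr ?mulr_gt0 ?(lt_le_trans _ dR)//.
have := dR; rewrite exprVn; lra.
Qed.

End Regime.

Lemma decay_ge (R : realType) (h K T : R) (n k : nat) : 0 <= h -> n%:R * h = T ->
  (k <= n)%N -> expR (- (rate2 K * T)) <= decay h K k.
Proof.
move=> h0 nh kn; have r0 := rate2_ge0 K; rewrite /decay expRN.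
have e0 : 0 < 1 + rate2 K * h by rewrite ltr_wpDr// mulr_ge0.
rewrite lef_pV2 ?posrE ?expR_gt0 ?exprn_gt0//.
apply: (@le_trans _ _ (expR (rate2 K * h) ^+ k)).
  by apply: lerXn2r; rewrite ?nnegrE ?expR_ge0 ?(ltW e0)// expR_ge1Dx.
rewrite -expRM_natr ler_expR -mulrA ler_wpM2l// mulrC -nh ler_wpM2r// ler_nat//.
Qed.

Lemma approx_error_le1 (R : realType) (r C rad s : R) : 0 < r -> 0 < C -> 0 < rad ->
  0 < s -> rad * C `^ r^-1 <= s -> C * rad `^ r * s `^ (- r) <= 1.
Proof.
move=> r0 C0 rad0 s0 le.
have -> : C * rad `^ r = (rad * C `^ r^-1) `^ r.
  rewrite powRM ?powR_ge0 ?(ltW rad0)// -powRrM mulVf ?gt_eqF// powRr1 ?(ltW C0)//.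
  by rewrite mulrC.
rewrite powRN ler_pdivrMr ?powR_gt0// mul1r.
by apply: ge0_ler_powR; rewrite ?nnegrE ?(ltW r0) ?(ltW s0) ?mulr_ge0 ?powR_ge0 ?(ltW rad0).
Qed.

Theorem theorem2p3 (R : realType) (K T delta0 : R)
  (K_gt0 : 0 < K) (T_gt0 : 0 < T) (delta0_gt0 : 0 < delta0) :
  exists2 delta : R, 0 < delta &
  forall (N : R) (d : nat) (Cbs lam1 lam2 : R)
    (eta r C Rstar Cdelta : R),
    0 <= N -> (0 < d)%N ->
    0 < Cbs -> lam2 <= lam1 -> 0 < lam2 ->
    1 < eta -> eta < 2 -> 0 < r -> 0 < C -> 0 < Rstar -> 0 < Cdelta ->
  exists CN hN : R, [/\ 0 < CN, 0 < hN &
  forall (m : nat) (disp : measure_display) (Omega : measurableType disp)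
    (P : probability Omega R)
    (b : R -> 'cV[R]_d -> 'cV[R]_d) (sigma : R -> 'cV[R]_d -> 'M[R]_(d, m))
    (pb : R -> R -> nat -> 'cV[mpoly d R]_d)
    (ps : R -> R -> nat -> 'M[mpoly d R]_(d, m))
    (chi : R -> R -> R)
    (u0 : Omega -> 'cV[R]_d) (z : nat -> Omega -> 'cV[R]_m),
    (0 < m)%N ->
    coefficient_assumption T K r C Rstar lam1 lam2 eta Cbs b sigma pb ps ->
    initial_assumption P delta0 u0 ->
    driving_noise P u0 z ->
    (forall rad : R, 0 < rad -> cutoff rad (chi rad)) ->
  forall n : nat, (0 < n)%N ->
    let h := step T n in
    let rad := (Num.sqrt delta)^-1 * Num.sqrt (- 2 * ln h) in
    let L := Lof lam1 eta rad in
    let S := Sof lam2 eta rad in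
    let J := (2 * L + S)%N in
    let b_pol := pb h rad S in
    let s_pol := ps h rad S in
    h < hN ->
  forall ch : rpc_choice d L S,
    rpc_stability ch h b_pol s_pol (moment P u0) Cdelta n ->
  forall k : nat, (k <= n)%N ->
    moment_dist J
      (moment P (fun w =>
         projected (chi rad) h b_pol s_pol (u0 w) (fun i => z i w) k))
      (rpc_moment ch h b_pol s_pol (moment P u0) k)
    <= CN * (- ln h) `^ (- N)].
Proof.
(* [a] is a lower bound for [decay] over the whole time interval. It depends on [K] and [T] only, so
   [delta] can be fixed before the dimension and the remaining constants. *)
pose K1 := K + 1; pose a := expR (- (rate2 K1 * T)).
have K1_gt0 : 0 < K1 by rewrite addr_gt0.
have a_gt0 : 0 < a by exact: expR_gt0.
have a_le1 : a <= 1.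
  by rewrite -[leRHS]expR0 ler_expR oppr_le0 mulr_ge0 ?rate2_ge0// ltW.
pose delta := a / 36; have delta_gt0 : 0 < delta by rewrite divr_gt0.
exists delta => // N d Cbs lam1 lam2 eta r C Rstar Cdelta N0 d_gt0 Cbs0 lam21 lam2_gt0
  eta1 eta2 r0 C0 Rs0 Cd0.
have [cN cN0 cNE] := normal_expR_sqr R.
pose D := (d ^ 2)%:R * Cbs; have D0 : 0 <= D by rewrite mulr_ge0// ltW.
have lam1_gt0 : 0 < lam1 by exact: lt_le_trans lam21.
pose A := rate_total d T lam1 D; pose b := rate_tail d T lam1 D.
pose c := C `^ r^-1; have c_ge0 : 0 <= c by exact: powR_ge0.
(* [M1] and [M2] are the thresholds for the powers [eta - 1] and [2 - eta] of [rad]. [M3] collects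
   those on [rad] itself; its terms are nonnegative, so the sum dominates each of them. *)
pose M1 := expR b + 2 * c / lam2.
pose M2 := 2 * lam1 * expR (rate_init d T lam1 D) / box_scale d a +
  4 * (A + 1 + rate_step R) / delta.
have e1 : 0 < eta - 1 by rewrite subr_gt0.
have e2 : 0 < 2 - eta by rewrite subr_gt0.
have [R1 R1_ge1 R1P] := powR_large M1 e1; have [R2 R2_ge1 R2P] := powR_large M2 e2.
pose M3 := 1 + Rstar + 2 / lam2 + 16 * d%:R * K1 ^+ 2 / delta + 4 * (K1 * (d%:R + 1)) / delta.
pose R0 := Num.max (Num.max R1 R2) M3.
have [c4 c4_gt0 c4P] := expRN_le_powR N0 delta_gt0.
(* Prefactors of the three errors, each to be multiplied by [expR (- ((A + 1) * Y))]: truncation of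
   the initial datum, high degrees, local error. *)
pose c1 := d%:R * Cdelta; pose c2 := 1 + Cdelta * expR (expR (2 * b) / 2).
pose c3 := step_factor d K1 + exit_factor d T K1 a cN.
have c1_ge0 : 0 <= c1 by rewrite mulr_ge0// ltW.
have c2_gt0 : 0 < c2 by rewrite ltr_pwDl// mulr_ge0 ?expR_ge0 ?(ltW Cd0).
have c3_ge0 : 0 <= c3 by rewrite addr_ge0 ?step_factor_ge0 ?exit_factor_ge0.
pose Ctot := c1 + (c1 + c2) + T * (D * c2 + c3).
have Ctot_gt0 : 0 < Ctot.
  apply: ltr_pwDl; first by rewrite ltr_wpDl// ltr_wpDl.
  by rewrite mulr_ge0 ?(ltW T_gt0)// addr_ge0// mulr_ge0// ltW.
(* Since [h = expR (- (delta * rad ^ 2 / 2))], taking [h] below this value forces [rad] above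
   [R0]. *)
exists (Ctot * c4), (expR (- (delta * R0 ^+ 2 / 2))); split.
- exact: mulr_gt0.
- exact: expR_gt0.
move=> m disp Omega P bh sigma pb ps chi u0 z m_gt0 coef init noise cut n n_gt0 h rad L S J
  b_pol s_pol h_small ch stab k kn.
have h_gt0 : 0 < h by rewrite divr_gt0// ltr0n.
have d1 : 1 <= d%:R :> R by rewrite ler1n.
have R0_ge1 : 1 <= R0 by rewrite !le_max R1_ge1.
have R0_ge0 : 0 <= R0 by exact: le_trans R0_ge1.
have lnh : ln h < - (delta * R0 ^+ 2 / 2).
  by rewrite -[ltRHS]expRK ltr_ln ?posrE ?expR_gt0.
have lnh0 : 0 <= - 2 * ln h.
  have : 0 <= delta * R0 ^+ 2 / 2 by rewrite divr_ge0// mulr_ge0 ?sqr_ge0// ltW.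
  by move: lnh; clear; lra.
have rad2 : delta * rad ^+ 2 / 2 = - ln h.
  rewrite /rad exprMn sqr_sqrtr// exprVn sqr_sqrtr ?(ltW delta_gt0)//; field.
  by rewrite gt_eqF.
have hE : h = expR (- (delta * rad ^+ 2 / 2)) by rewrite rad2 opprK lnK// posrE.
have rad_ge0 : 0 <= rad by rewrite mulr_ge0 ?invr_ge0 ?sqrtr_ge0.
have R0rad : R0 <= rad.
  rewrite -(@ler_pXn2r _ 2)// ?nnegrE// -(ler_pM2l delta_gt0).
  by move: lnh; rewrite -(opprK (ln h)) -rad2 ltrN2 ltr_pM2r// => /ltW.
have rad_ge1 : 1 <= rad by exact: le_trans R0rad.
have rad_gt0 : 0 < rad by exact: lt_le_trans rad_ge1.
have rad_drift : M1 <= rad `^ (eta - 1).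
  by apply: R1P; apply: le_trans R0rad; rewrite !le_max lexx.
have rad_gauss : M2 <= rad `^ (2 - eta).
  by apply: R2P; apply: le_trans R0rad; rewrite !le_max lexx orbT.
have M3rad : M3 <= rad by apply: le_trans R0rad; rewrite le_max lexx orbT.
have t1 : 0 < 2 / lam2 by rewrite divr_gt0.
have t2 : 0 <= 16 * d%:R * K1 ^+ 2 / delta.
  by rewrite divr_ge0 ?(ltW delta_gt0)// mulr_ge0 ?sqr_ge0.
have t3 : 0 <= 4 * (K1 * (d%:R + 1)) / delta.
  by rewrite divr_ge0 ?(ltW delta_gt0)// mulr_ge0// mulr_ge0 ?addr_ge0// ltW.
have rad_star : Rstar < rad by move: M3rad t1 t2 t3 Rs0; rewrite /M3; clear; lra.
have rad_lam : 2 / lam2 <= rad by move: M3rad t1 t2 t3 Rs0; rewrite /M3; clear; lra.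
have rad_h : 16 * d%:R * K1 ^+ 2 / delta <= rad by move: M3rad t1 t2 t3 Rs0; rewrite /M3; clear; lra.
have rad_sqrth : 4 * (K1 * (d%:R + 1)) / delta <= rad by move: M3rad t1 t2 t3 Rs0; rewrite /M3; clear; lra.
have SL : (S <= L)%N by exact: regime_SL.
have S_gt0 : (0 < S)%N.
  by apply: (regime_S_gt0 T_gt0 lam2_gt0 lam21 D0 rad_ge1 c_ge0 rad_drift rad_lam).
have SR : rad * c <= S%:R.
  by apply: (regime_S_rad T_gt0 lam2_gt0 lam21 D0 rad_ge1 c_ge0 rad_drift rad_lam).
have approx1 : C * rad `^ r * S%:R `^ (- r) <= 1.
  by apply: approx_error_le1 SR => //; rewrite ltr0n.
have [degb degs] : (degmx b_pol <= S)%N /\ (2 * degmx s_pol <= S)%N.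
  exact: (approx_degree coef).
have nhT : n%:R * h = T by rewrite mulrC divfK// pnatr_eq0 -lt0n.
pose Y := rad `^ eta; have Y0 : 0 <= Y by exact: powR_ge0.
pose E0 := c1 * expR (- ((A + 1) * Y)); pose tau := c2 * expR (- ((A + 1) * Y)).
pose eps := regime_eps d T K1 lam1 lam2 eta a cN rad h.
pose rr := rad * Num.sqrt (box_scale d a).
have rad_Y : rad <= Y by apply: (regime_rad T_gt0 lam2_gt0 lam21 D0 rad_ge1 c_ge0 rad_drift).
have rr_gt0 : 0 < rr.
  by rewrite mulr_gt0// sqrtr_gt0 divr_gt0// mulr_gt0// (lt_le_trans _ d1).
have initial : init_tail P u0 rr L <= E0.
  apply: (@le_trans _ _ (d%:R * (Cdelta * Num.sqrt (2 * L)`!%:R / rr ^+ (2 * L)))).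
    (* At time 0 and degree [2 * L <= J] the computed moment is the moment of [u0], so stability
       bounds the even moments in the Markov estimate. *)
    apply: init_tail_le => // g gL; have [_ st] := stab.
    have := st 0%N g isT; rewrite /rpc_moment gL !leq_addr => /(_ isT).
    by [].
  rewrite /E0 /c1 -!mulrA ler_wpM2l// ler_wpM2l ?(ltW Cd0)//.
  exact: (regime_initial d_gt0 T_gt0 lam2_gt0 lam21 D0 a_gt0 rad_ge1 c_ge0 rad_drift
    rad_gauss rad_lam).
have mass : (d ^ 2)%:R * (coef_mass S (2 * L + 2 * S) b_pol +
    2^-1 * coef_mass S (2 * L + 2 * S) (s_pol *m s_pol^T)) <= D * Y.
  by rewrite /D -mulrA ler_wpM2l//; have [_ _ +] := coef; apply.
have bound : moment_dist J (moment P (state u0 z (chi rad) h b_pol s_pol k))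
    (rpc_moment ch h b_pol s_pol (moment P u0) k) <= Ctot * expR (- Y).
  apply: le_trans (@fixed_bound R disp Omega P d m u0 z noise (chi rad) h rad rr K1 cN T a
    (D * Y) eps tau E0 Cdelta n L S b_pol s_pol ch d_gt0 rad_ge1 rr_gt0 _ _ _ _ K1_gt0
    _ _ _ cN0 cNE _ _ nhT a_gt0 _ SL degb degs mass stab _ _ initial _ _ k kn) _.
  - exact: regime_box.
  - exact: cut.
  - exact: ltW.
  - exact: (regime_h_le1 a_gt0 hE).
  - exact: (approx_drift coef).
  - exact: (approx_diffusion coef).
  - exact: (regime_h_small a_gt0 rad_ge1 rad_h hE).
  - exact: (regime_sqrth_small K1_gt0 a_gt0 rad_ge1 rad_sqrth hE).
  - have [ru _ _ _] := noise; exact: (initial_moments_integrable ru delta0_gt0 init).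
  - move=> j jn; exact: (decay_ge _ (ltW h_gt0) nhT jn).
  - by rewrite mulr_ge0 ?expR_ge0// ltW.
  - move=> j; apply: (regime_moment_tail T_gt0 lam2_gt0 lam21 D0 rad_ge1 c_ge0 rad_drift
      rad_lam); exact: ltW.
  - exact: (regime_eps_ge0 _ _ _ _ _ _ K1_gt0 rad_ge1 hE).
  - by rewrite (regime_epsE _ _ _ _ _ _ d_gt0 a_gt0 hE).
  apply: (@error_budget _ d _ _ _ _ _ _ (rate_weight d lam1) A) => //.
  - exact: ltW.
  - exact: ltW.
  - by rewrite mulr_ge0 ?expR_ge0.
  - by rewrite mulr_ge0 ?expR_ge0// ltW.
  - exact: (regime_eps_ge0 _ _ _ _ _ _ K1_gt0 rad_ge1 hE).
  - exact: (rate_weight_ge0 _ lam2_gt0 lam21).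
  - by rewrite leq_add2l leq_pmull.
  - exact: (regime_size _ _ lam2_gt0 lam21).
  - exact: (regime_eps_le _ d_gt0 T_gt0 K1_gt0 lam2_gt0 lam21 D0 a_gt0 rad_ge1 c_ge0 rad_drift
      rad_gauss hE).
apply: (le_trans bound); rewrite -mulrA ler_wpM2l ?(ltW Ctot_gt0)//.
have := c4P _ rad_ge1; rewrite rad2; apply: le_trans.
by rewrite ler_expR lerN2.
Qed.
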